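(* Let $B\subset\mathbb R^d$ be a structuring element. Let $Z$ and $\tilde Z$ be two germ-grain models in $\mathbb R^d$ with the same (compact, convex) typical grain $X_0$, with $X_0$ and $B^*$ a.s. in general relative position, based on mixed Poisson processes $N$ and $\tilde N$ with random intensities $\Lambda$ and $\tilde\Lambda$, respectively. If $\Lambda<_{cum}\tilde\Lambda$, then $Z<_{h-B}\tilde Z$, i.e. the directed $B$-relative empty space hazards satisfy $r_B(t,C)\ge\tilde r_B(t,C)$ for all $t\ge0$ and all Borel sets $C\subset\mathbb R^d$.
   Context: Distances. A structuring element is a compact convex set $B\subset\mathbb R^d$ with $0\in B$ (possibly lower-dimensional); $B^*:=\{-x:x\in B\}$. For $x\in\mathbb R^d$, $K\subset\mathbb R^d$, $d_B(x,K):=\inf\{t\ge 0:(x+tB)\cap K\ne\emptyset\}$ (with $\inf\emptyset=\infty$). If $0<d_B(x,K)<\infty$ and $(x+d_B(x,K)B)\cap K=\{y\}$ is a single point, then $u_B(K,x):=(x-y)/d_B(x,K)\in\partial B^*$. A nonempty compact convex $K$ and $B^*$ are in general relative position if they do not contain parallel segments in parallel and equally oriented support hyperplanes. Empty space hazard. For a stationary random closed set $Z$ for which $u_B(Z,0)$ is a.s. well defined on $\{0<d_B(0,Z)<\infty\}$ (this holds here), put $u_B(Z,0):=u_0$ for a fixed $u_0\in\partial B^*$ if $0\in Z$ or $d_B(0,Z)=\infty$, and let $F_B(t,C):=P(d_B(0,Z)\le t,\ u_B(Z,0)\in C)$, $F_B(t):=F_B(t,\mathbb R^d)$. $F_B(\cdot,C)$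 is absolutely continuous on $(0,\infty)$; $f_B(\cdot,C)$ denotes its density, taken in the right-continuous version on $[0,\infty)$ (the right-hand derivative of $F_B(\cdot,C)$). The hazard is $r_B(t,C):=f_B(t,C)/(1-F_B(t))$, with $a/0:=0$; $\tilde r_B$ is the hazard of $\tilde Z$. Mixed Poisson germ-grain model. $Z=\bigcup_{\xi\in N}(X(\xi)+\xi)$, where, given $N$, the $X(\xi)$ are i.i.d. copies of the typical grain $X_0$ (independent also of $\Lambda$), a random nonempty compact convex set with $E[V_d(X_0+K)]<\infty$ for all compact $K$ ($V_d$ is volume); $N$ is a mixed Poisson process: there is a random variable $\Lambda\ge0$ with $E[\Lambda]\in(0,\infty)$ such that, given $\Lambda$, $N$ is a stationary Poisson process with intensity $\Lambda$. Order $<_{cum}$. For nonnegative random variables, $\Lambda<_{cum}\tilde\Lambda$ means that the derivatives of the cumulant generating functions $C_\Lambda(s)=\log E[e^{s\Lambda}]$ satisfy $C'_\Lambda(s)\ge C'_{\tilde\Lambda}(s)$ for all $s\le0$; equivalently $$\frac{E[\Lambda e^{-\Lambda s}]}{E[e^{-\Lambda s}]}\ge\frac{E[\tilde\Lambda e^{-\tilde\Lambda s}]}{E[e^{-\tilde\Lambda s}]},\qquad s\ge0.$$ *)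

(* Defs.v *)
From HB Require Import structures.
From mathcomp Require Import all_boot all_order all_algebra.
From mathcomp Require Import all_classical all_reals all_analysis.

Set Implicit Arguments.
Unset Strict Implicit.
Unset Printing Implicit Defensive.

Import Order.TTheory GRing.Theory Num.Theory.
Import numFieldNormedType.Exports.

Local Open Scope classical_set_scope.
Local Open Scope ring_scope.

(** R^d is ['rV[R]_d] with its (product) topology. *)

Section euclidean_sets.
Context {R : realType} {d : nat}.
Implicit Types (A B K : set 'rV[R]_d) (x y n : 'rV[R]_d).

Definition dotprod x y : R := \sum_(i < d) x 0 i * y 0 i.

Definition borel : set (set 'rV[R]_d) := <<s open >>.

Definition minkowski_sum A B : set 'rV[R]_d :=
  [set x + y | x in A & y in B].

Definition reflection B : set 'rV[R]_d := [set - x | x in B].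

Definition boundary A : set 'rV[R]_d := closure A `\` interior A.

Definition segment x y : set 'rV[R]_d :=
  [set (1 - t) *: x + t *: y | t in `[0, 1]].

(** The part of [A] lying in the support hyperplane of [A] with outer normal
    [n] (for [n != 0]); two support hyperplanes are parallel and equally
    oriented iff they have a common outer normal. *)
Definition support_set n A : set 'rV[R]_d :=
  [set x | A x /\ forall y, A y -> dotprod n y <= dotprod n x].

(** Segments are nondegenerate; [x y] spans the one in [K], [x' y'] the one in
    [B]. *)
Definition general_relative_position K B : Prop :=
  ~ exists n x y x' y',
      [/\ n != 0, x != y & x' != y'] /\
      [/\ segment x y `<=` support_set n K,
          segment x' y' `<=` support_set n B &
          exists c : R, y' - x' = c *: (y - x)].

Definition structuring_element B : Prop :=
  [/\ compact B, @convex_set R 'rV[R]_d B & B 0].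

(** x + tB *)
Definition gauge_ball B x (t : R) : set 'rV[R]_d := [set x + t *: b | b in B].

Definition dist_B B x K : \bar R :=
  ereal_inf [set t%:E | t in
    [set t : R | 0 <= t /\ gauge_ball B x t `&` K !=set0]].

Definition contact_set B x K : set 'rV[R]_d :=
  gauge_ball B x (fine (dist_B B x K)) `&` K.

(** Besides the cases [dist_B B x K = 0] and [dist_B B x K = +oo], the default
    value [u0] is also used when the contact point is not unique. *)
Definition dir_B u0 B K x : 'rV[R]_d :=
  if `[< (0 < dist_B B x K)%E /\ (dist_B B x K < +oo)%E /\
         exists y, contact_set B x K = [set y] >]
  then (fine (dist_B B x K))^-1 *: (x - xget 0 (contact_set B x K))
  else u0.

(** The sigma-algebra of the hit-or-miss topology; random closed sets (in
    particular random convex bodies) are measurable maps into it, and their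
    distributions live on it. *)
Definition hit_sigma : set (set (set 'rV[R]_d)) :=
  <<s [set H | exists2 K, compact K & H = [set F | F `&` K !=set0]] >>.

End euclidean_sets.

(** The d-dimensional Lebesgue measure of a Borel set, as an iterated
    integral of its indicator function. *)
Fixpoint volume {R : realType} (d : nat) : set 'rV[R]_d -> \bar R :=
  match d with
  | 0 => fun A => (\1_A (0 : 'rV[R]_0))%:E
  | d'.+1 => fun A =>
      (\int[lebesgue_measure]_(x in [set: R])
         volume [set y : 'rV[R]_d' | A (row_mx (x%:M : 'rV[R]_1) y)])%E
  end.

(** Written out instead of [poisson_pmf], which is not the mass function of
    the point mass at 0 when the mean is 0. *)
Definition poisson_mass {R : realType} (mean : R) (k : nat) : R :=
  expR (- mean) * mean ^+ k / k`!%:R.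

Section random_sets.
Context {R : realType} {d : nat}.
Context {d1 : measure_display} {T : measurableType d1} (P : probability T R).

Definition random_convex_body (X : T -> set 'rV[R]_d) : Prop :=
  (forall w, [/\ X w !=set0, compact (X w) & @convex_set R 'rV[R]_d (X w)]) /\
  (forall H, hit_sigma H -> measurable (X @^-1` H)).

Definition typical_grain (X0 : T -> set 'rV[R]_d) : Prop :=
  random_convex_body X0 /\
  forall K : set 'rV[R]_d, compact K ->
    (\int[P]_w volume (minkowski_sum (X0 w) K) < +oo)%E.

(** A point process is given by an enumeration [N] of its points:
    [N n w = Some x] means that the n-th point exists and is [x]; [None] allows
    for realizations with finitely many points. *)
Implicit Types (N : nat -> T -> option 'rV[R]_d) (L : T -> R)
  (X : nat -> T -> set 'rV[R]_d).

Definition point_in N n (A : set 'rV[R]_d) : set T :=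
  [set w | exists2 x, A x & N n w = Some x].

Definition point_count N (A : set 'rV[R]_d) (w : T) : \bar R :=
  counting [set n | point_in N n A w].

(** The second clause is the integrated form of: given [L], the numbers of
    points in disjoint sets [A i] are independent and Poisson distributed with
    means [L * volume (A i)]. *)
Definition mixed_poisson_process (L : {RV P >-> R}) N : Prop :=
  [/\ forall w, 0 <= L w,
      (0 < 'E_P[L] < +oo)%E,
      forall n A, borel A -> measurable (point_in N n A) &
      forall (m : nat) (A : 'I_m -> set 'rV[R]_d) (k : 'I_m -> nat)
          (I : set R),
        (forall i, borel (A i) /\ (volume (A i) < +oo)%E) ->
        trivIset setT A -> measurable I ->
        P [set w | I (L w) /\ forall i, point_count N (A i) w = (k i)%:R%:E] =
        (\int[P]_(w in L @^-1` I)
           (\prod_(i < m) poisson_mass (L w * fine (volume (A i))) (k i))%:E)%E].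

(** The events generated by the random intensity and the point process. *)
Definition ground_events L N : set (set T) :=
  <<s [set E | (exists2 I, measurable I & E = L @^-1` I) \/
               (exists n A, borel A /\ E = point_in N n A)] >>.

(** The grains [X n] are i.i.d. copies of [X0], and independent of [L] and of
    the point process. *)
Definition independent_grains {d0 : measure_display} {T0 : measurableType d0}
    (P0 : probability T0 R) (X0 : T0 -> set 'rV[R]_d) L N X : Prop :=
  (forall n, random_convex_body (X n)) /\
  forall (E : set T) (m : nat) (H : nat -> set (set 'rV[R]_d)),
    ground_events L N E -> (forall i, hit_sigma (H i)) ->
    P (E `&` \bigcap_(i < m) X i @^-1` H i) =
    (P E * \prod_(i < m) P0 (X0 @^-1` H i))%E.

Definition germ_grain N X (w : T) : set 'rV[R]_d :=
  [set z | exists n x y, [/\ N n w = Some x, X n w y & z = y + x]].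

Definition mixed_poisson_germ_grain {d0 : measure_display}
    {T0 : measurableType d0} (P0 : probability T0 R)
    (X0 : T0 -> set 'rV[R]_d) (L : {RV P >-> R}) N X : Prop :=
  mixed_poisson_process L N /\ independent_grains P0 X0 L N X.

Definition empty_space_fun (u0 : 'rV[R]_d) (B : set 'rV[R]_d)
    (Z : T -> set 'rV[R]_d) (t : R) (C : set 'rV[R]_d) : R :=
  fine (P [set w | (dist_B B 0 (Z w) <= t%:E)%E /\ C (dir_B u0 B (Z w) 0)]).

(** The right-continuous density is the right-hand derivative. *)
Definition empty_space_density u0 B Z (t : R) C : R :=
  lim ((fun h : R => (empty_space_fun u0 B Z (t + h) C -
                      empty_space_fun u0 B Z t C) / h) @ 0^'+).

Definition empty_space_hazard u0 B Z (t : R) C : R :=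
  empty_space_density u0 B Z t C / (1 - empty_space_fun u0 B Z t setT).

Definition cumulant_gen (L : T -> R) (s : R) : R :=
  ln (fine (mmt_gen_fun P L s)).

(** The left-hand derivative: at [s = 0] the generating function need not be
    finite to the right. *)
Definition cumulant_deriv L (s : R) : R :=
  lim ((fun h : R => (cumulant_gen L (s + h) - cumulant_gen L s) / h) @ 0^'-).

End random_sets.

Section orders.
Context {R : realType}.
Context {d1 : measure_display} {T1 : measurableType d1} (P1 : probability T1 R).
Context {d2 : measure_display} {T2 : measurableType d2} (P2 : probability T2 R).

(** L1 <_cum L2 *)
Definition cum_order (L1 : T1 -> R) (L2 : T2 -> R) : Prop :=
  forall s : R, s <= 0 -> cumulant_deriv P2 L2 s <= cumulant_deriv P1 L1 s.

(** Z1 <_{h-B} Z2 *)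
Definition hazard_order {d : nat} (u0 : 'rV[R]_d) (B : set 'rV[R]_d)
    (Z1 : T1 -> set 'rV[R]_d) (Z2 : T2 -> set 'rV[R]_d) : Prop :=
  forall (t : R) (C : set 'rV[R]_d), 0 <= t -> borel C ->
    empty_space_hazard P2 u0 B Z2 t C <= empty_space_hazard P1 u0 B Z1 t C.

End orders.

(* Main.v *)
(** Given [Lambda], the germ-grain model is Boolean.  Let [v t] be the mean
    volume of the germs whose grain is reached from the origin within distance
    [t], let [G(t,C)] be the part of it with direction in [C], and put
    [M x = E(exp(- Lambda x))], [phi = - M'].  The void probability gives
    [1 - F t = M(v t)], and the event that the grains reached within distance
    [t] reduce to a single one, at distance [> s] and in a direction in [C],
    gives [phi(v t) (G(t,C) - G(s,C)) <= F(t,C) - F(s,C)].  Applied to the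
    complement of [C] this yields the matching bound
    [F(t,C) - F(s,C) <= phi(v s) (G(t,C) - G(s,C))] up to an error
    [(phi(v s) - phi(v t)) (v t - v s)], which disappears over fine partitions
    because [v] is locally Lipschitz (by scaling) and [phi] is monotone.  Hence
    the right derivative of [F(.,C)] at [t] is [phi(v t)] times that of
    [G(.,C)], and the hazard is [C'_Lambda(- v t)] times a factor that does not
    depend on the intensity.  If the right derivative of [G(.,C)] fails to
    exist, both hazards are [0], the value of a divergent [lim]. *)

Require Import Defs.
From HB Require Import structures.
From mathcomp Require Import all_boot all_order all_algebra.
From mathcomp Require Import all_classical all_reals all_analysis.
From mathcomp Require Import measurable_realfun ring lra.

Set Implicit Arguments.
Unset Strict Implicit.
Unset Printing Implicit Defensive.

Import Order.TTheory GRing.Theory Num.Theory.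
Import numFieldNormedType.Exports.

Local Open Scope classical_set_scope.
Local Open Scope ring_scope.

(** The model determines the points only through their counts in disjoint Borel sets, and the grains
    only through independence along an enumeration. All probabilities of reached germs are therefore
    read off from one identity: the mean of the product of factors [1 - q] over the germs with their
    grains. Giving germs the factor [a] and comparing terms of first order in [a] yields the
    probability of a single reached germ, so that no Palm or Mecke formula enters. Configurations
    with several reached germs are simply discarded; this costs nothing in the limit because the
    total over [C] and its complement is known exactly.

    Two points shape the details. The distance to the union is an infimum over infinitely many
    germs, so strict and weak inequalities have to be told apart. The scaling bound on [v] contains
    a factor [1 / t], so the start at distance 0 is reached through right continuity of [v]
    instead. *)

Notation borel_rV R d := (g_sigma_algebraType (@open 'rV[R]_d)).

Lemma bigcup_countType_measurable d (T : measurableType d) (I : countType)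
    (F : I -> set T) :
  (forall i, measurable (F i)) -> measurable (\bigcup_i F i).
Proof.
move=> mF.
rewrite (_ : \bigcup_i F i =
    \bigcup_n (if unpickle n is Some i then F i else set0)); last first.
  apply/seteqP; split => x [i _ Fx].
    by exists (pickle i) => //; rewrite pickleK.
  by case: (unpickle i) Fx => [j Fx|//]; exists j.
by apply: bigcupT_measurable => n; case: unpickle.
Qed.

Definition image_measure d d' (T1 : measurableType d) (T2 : measurableType d')
    (R : realType) (m : {measure set T1 -> \bar R}) (f : T1 -> T2)
    (mf : measurable_fun setT f) : {measure set T2 -> \bar R} :=
  measure_function_pushforward__canonical__measure_function_Measure m mf.

(** * Boxes and volume *)

Section rational_boxes.
Context {R : realType} {d : nat}.
Implicit Types (p : 'rV[rat]_d * rat) (x y : 'rV[R]_d) (O A : set 'rV[R]_d).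

Definition box_center p : 'rV[R]_d := map_mx ratr p.1.

Definition open_box p : set 'rV[R]_d := ball (box_center p) (ratr p.2).

Definition closed_box p : set 'rV[R]_d :=
  [set v | forall i, `[box_center p 0 i - ratr p.2,
                       box_center p 0 i + ratr p.2]%classic (v 0 i)].

Lemma open_box_open p : open (open_box p). Proof. exact: ball_open. Qed.

Lemma closed_box_compact p : compact (closed_box p).
Proof.
apply: (@rV_compact R d (fun i => `[box_center p 0 i - ratr p.2,
                       box_center p 0 i + ratr p.2]%classic)) => i.
exact: segment_compact.
Qed.

(** The conjunct [0 < e] matters in dimension 0, where there is no coordinate to force it. *)
Lemma mx_ballP x y (e : R) :
  ball x e y <-> 0 < e /\ forall i, `|x 0 i - y 0 i| < e.
Proof.
split => [[e0 xy]|[e0 xy]].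
  by split => // i; have := xy 0 i; rewrite -ball_normE.
by split => // i j; rewrite (ord1 i) -ball_normE; exact: xy.
Qed.

Lemma open_box_closed_box p : open_box p `<=` closed_box p.
Proof.
move=> x /mx_ballP[_ px] i /=; rewrite in_itv/=.
have := ltW (px i); rewrite ler_distlC => /andP[a b].
by rewrite a b.
Qed.

(** The ball contains even the closed box: it is compact, and events about grains are generated by
    hitting compact sets. *)
Lemma rational_box_basis_small x (e : R) : 0 < e ->
  exists p, open_box p x /\ forall v, closed_box p v -> ball x e v.
Proof.
move=> e0.
have e20 : 0 < e / 2 by rewrite divr_gt0.
(* Each coordinate of a point of the box differs from that of [x] by less than [2 r]. *)
have [r] := rat_in_itvoo e20; rewrite in_itv/= => /andP[r0 re].
have /choice[c cP] : forall i, exists c : rat, `|ratr c - x 0 i| < ratr r :> R.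
  move=> i; have : x 0 i - ratr r < x 0 i + ratr r by rewrite ltrD2l gtrN.
  move=> /rat_in_itvoo[c]; rewrite in_itv/= => cx; exists c.
  by rewrite distrC ltr_distlC.
exists (\row_i c i, r); split.
  by apply/mx_ballP; split => // i; rewrite !mxE.
move=> v vp; apply/mx_ballP; split => // i.
have := vp i; rewrite /= in_itv/= !mxE => /andP[v1 v2].
have := cP i; rewrite distrC ltr_distlC => /andP[c1 c2].
rewrite ltr_norml; apply/andP; split; lra.
Qed.

Lemma rational_box_basis O x : open O -> O x ->
  exists p, open_box p x /\ closed_box p `<=` O.
Proof.
move=> /[apply] /nbhs_ballP[e /= e0 eO].
have [p [px pb]] := rational_box_basis_small x e0.
by exists p; split => // v /pb /eO.
Qed.

Lemma open_bigcup_box O : open O ->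
  O = \bigcup_p (if `[< closed_box p `<=` O >] then open_box p else set0).
Proof.
move=> oO; apply/seteqP; split => [x Ox|x [p _]].
  have [p [px pO]] := rational_box_basis oO Ox.
  by exists p => //; case: asboolP.
by case: asboolP => // pO /open_box_closed_box /pO.
Qed.

End rational_boxes.

Section cons_rV.
Context {R : realType} {d : nat}.

Definition cons_rV (p : R * 'rV[R]_d) : 'rV[R]_d.+1 :=
  row_mx (p.1%:M : 'rV[R]_1) p.2.

Lemma ball_cons_rV (c : 'rV[R]_d.+1) (e : R) :
  cons_rV @^-1` ball c e =
  ball (c 0 0) e `*` ball (rsubmx (c : 'rV[R]_(1 + d))) e.
Proof.
apply/seteqP; split => -[x y]; rewrite /cons_rV/=.
  move=> /mx_ballP[e0 xy]; split.
    rewrite /= -ball_normE /=; have := xy (lshift d (0 : 'I_1)).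
    rewrite (@row_mxEl _ 1 1 d) !mxE eqxx mulr1n.
    by congr (`| c _ _ - _ | < _); exact/val_inj.
  apply/mx_ballP; split => // i; have := xy (rshift 1 i).
  by rewrite (@row_mxEr _ 1 1 d) !mxE.
move=> [/= + /mx_ballP[e0 yc]]; rewrite -ball_normE /= => xc.
apply/mx_ballP; split => // i.
rewrite -[i](@splitK 1 d); case: splitP => j _ /=.
  rewrite (@row_mxEl _ 1 1 d) !mxE ord1 eqxx mulr1n.
  by move: xc; congr (`| c _ _ - _ | < _); exact/val_inj.
by rewrite (@row_mxEr _ 1 1 d); have := yc j; rewrite !mxE.
Qed.

(** The product sigma-algebra is generated by rectangles, so continuity alone does not suffice: an
    open set is written as a countable union of boxes, whose preimages are rectangles. *)
Lemma measurable_cons_rV : measurable_fun setT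
  (cons_rV : (R * borel_rV R d)%type -> borel_rV R d.+1).
Proof.
apply: (@measurability _ _ (R * borel_rV R d)%type (borel_rV R d.+1) setT
  (cons_rV : (R * borel_rV R d)%type -> borel_rV R d.+1) open) => //.
move=> _ [U oU <-]; rewrite setTI (open_bigcup_box oU) preimage_bigcup.
apply: bigcup_countType_measurable => p; case: asboolP => _; last first.
  by rewrite preimage_set0.
rewrite /open_box ball_cons_rV; apply: measurableX.
  by apply: open_measurable; exact: ball_open.
by apply: sub_sigma_algebra; exact: ball_open.
Qed.

End cons_rV.

(** * Lebesgue measure and volume under affine maps *)

Section affine_lebesgue.
Context {R : realType}.
Local Notation mu := (@lebesgue_measure R).
Variables (l c : R).
Hypothesis l_neq0 : l != 0.

Let affine : measurableTypeR R -> measurableTypeR R := fun x => l * x + c.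

Let measurable_affine : measurable_fun setT affine.
Proof.
by apply: measurable_funD => //; apply: (@measurable_funM _ _ R setT).
Qed.

Let preimage_affine_ocitv (a b : R) : a <= b ->
  mu (affine @^-1` `]a, b]%classic) = (`|l|^-1 * (b - a))%:E.
Proof.
rewrite le_eqVlt => /predU1P[->|ab].
  by rewrite set_itvE preimage_set0 measure0 subrr mulr0.
have [l0|l0] : 0 < l \/ l < 0 by case/orP: (lt_total l_neq0) => ->; [right|left].
  rewrite (_ : _ @^-1` _ = `](a - c) / l, (b - c) / l]%classic); last first.
    apply/seteqP; split => x /=; rewrite !in_itv/= /affine;
      by rewrite ltr_pdivrMr// ler_pdivlMr// (mulrC x) ltrBlDr lerBrDr.
  rewrite lebesgue_measure_itv/= lte_fin ltr_pM2r ?invr_gt0// ltrD2r ab.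
  by rewrite -EFinB -mulrBl gtr0_norm// mulrC; congr (_ * _)%:E; lra.
rewrite (_ : _ @^-1` _ = `[(b - c) / l, (a - c) / l[%classic); last first.
  apply/seteqP; split => x /=; rewrite !in_itv/= /affine;
    by rewrite ltr_ndivlMr// ler_ndivrMr// (mulrC x) ltrBlDr lerBrDr andbC.
rewrite lebesgue_measure_itv/= lte_fin ltr_nM2r ?invr_lt0// ltrD2r ab.
rewrite -EFinB -mulrBl ltr0_norm// mulrC invrN mulNr -mulrN.
by congr (_ * _)%:E; lra.
Qed.

(** By uniqueness of Lebesgue measure: the image measure scaled by [|l|] gives half-open intervals
    their length. *)
Lemma lebesgue_measure_affine (A : set R) : measurable A ->
  mu A = (`|l|%:E * mu ((fun x => l * x + c)%R @^-1` A))%E.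
Proof.
have l0 : 0 <= `|l| by [].
move=> mA.
have := (@lebesgue_measure_unique R
  (mscale (NngNum l0) (image_measure mu measurable_affine))). apply => // _ [[a b] _ <-]/=.
rewrite /mscale/= /pushforward.
have [ab|ba] := leP a b; last first.
  by rewrite set_itv_ge ?preimage_set0 ?measure0 ?mule0// bnd_simp -leNgt ltW.
rewrite preimage_affine_ocitv// -EFinM mulrA divff ?normr_eq0// mul1r.
rewrite lebesgue_measure_itv/= lte_fin.
by move: ab; rewrite le_eqVlt => /predU1P[->|->//]; rewrite ltxx subrr.
Qed.

Lemma ge0_integral_affine (f : R -> \bar R) :
  measurable_fun setT f -> (forall x, 0 <= f x)%E ->
  (\int[mu]_x f x = `|l|%:E * \int[mu]_x f (l * x + c)%R)%E.
Proof.
move=> mf f0; have l0 : 0 <= `|l| by [].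
rewrite (@eq_measure_integral _ _ _ _
  (mscale (NngNum l0) (image_measure mu measurable_affine))); last first.
  by move=> A mA _; exact: lebesgue_measure_affine.
rewrite ge0_integral_mscale//=.
by rewrite ge0_integral_pushforward.
Qed.

End affine_lebesgue.

(** As a measure, [volume] is the image under [cons_rV] of the product of Lebesgue measure with the
    volume in one dimension less. Finiteness on balls is carried through the induction to obtain the
    sigma-finiteness that the next product and Tonelli's theorem require. *)
Lemma volume_measure_exists (R : realType) (d : nat) :
  exists mu : {sigma_finite_measure set (borel_rV R d) -> \bar R},
    (forall r : R, (mu (ball (0 : 'rV[R]_d)%R r) < +oo)%E) /\
    forall A, measurable A -> mu A = volume A.
Proof.
elim: d => [|d [mu [mufin muE]]].
  exists (@dirac _ (borel_rV R 0) 0 R); split => [r|A mA].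
    by rewrite /= /dirac/= ltry.
  by [].
pose f : (R * borel_rV R d)%type -> borel_rV R d.+1 := cons_rV.
have mf : measurable_fun setT f := measurable_cons_rV.
pose m := image_measure (@lebesgue_measure R \x mu)%E mf.
have mE (A : set (borel_rV R d.+1)) : measurable A -> m A = volume A.
  move=> mA; rewrite /m/= /pushforward/= /product_measure1; apply: eq_integral => x _.
  rewrite /= muE; last first.
    apply: measurable_xsection; rewrite -[X in measurable X]setTI.
    exact: measurable_cons_rV.
  by congr volume; apply/seteqP; split => y /=; rewrite /xsection/= inE.
have mball (k : nat) (r : R) : measurable (ball (0 : 'rV[R]_k) r : set (borel_rV R k)).
  by apply: sub_sigma_algebra; exact: ball_open.
have mfin (r : R) : (m (ball (0 : 'rV[R]_d.+1)%R r) < +oo)%E.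
  rewrite /m/= /pushforward ball_cons_rV product_measure1E; last 2 first.
    by apply: open_measurable; exact: ball_open.
    rewrite linear0; exact: mball.
  rewrite mxE linear0 lte_mul_pinfty// ?mufin//.
  rewrite ge0_fin_numE// (@le_lt_trans _ _ (lebesgue_measure `[- r, r]%classic))//.
    apply: le_measure; rewrite ?inE//.
      by apply: open_measurable; exact: ball_open.
    move=> x; rewrite -ball_normE/= sub0r normrN in_itv/= => /ltW.
    by rewrite ler_norml.
  by rewrite lebesgue_measure_itv/=; case: ifP => _; rewrite ?ltry// -EFinB ltry.
have sf : sigma_finite setT m.
  exists (fun n => ball (0 : 'rV[R]_d.+1) n.+1%:R).
    apply/seteqP; split => // z _.
    exists (Num.bound `|z|) => //; rewrite -ball_normE/= sub0r normrN.
    rewrite (lt_le_trans (archi_boundP _))// ler_nat.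
    exact: leqnSn.
  by move=> n; split => //; exact: mball.
pose H := Measure_isSigmaFinite.Build _ _ _ m sf.
pose M : {sigma_finite_measure set (borel_rV R d.+1) -> \bar R} :=
  HB.pack (Measure.sort m) H.
by exists M; split.
Qed.

Definition volume_measure (R : realType) (d : nat) :
  {sigma_finite_measure set (borel_rV R d) -> \bar R} :=
  sval (cid (volume_measure_exists R d)).

Lemma volume_measureE (R : realType) (d : nat) (A : set (borel_rV R d)) :
  measurable A -> volume_measure R d A = volume A.
Proof. by rewrite /volume_measure; case: cid => mu /= [_]; exact. Qed.

Lemma borel_preimage (R : realType) (d k : nat) (f : 'rV[R]_d -> 'rV[R]_k)
    (A : set (borel_rV R k)) :
  continuous f -> measurable A -> measurable (f @^-1` A : set (borel_rV R d)).
Proof.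
move=> cf mA; pose g : borel_rV R d -> borel_rV R k := f.
suff mg : measurable_fun setT g.
  by rewrite -[X in measurable X]setTI; exact: mg.
apply: (@measurability _ _ (borel_rV R d) (borel_rV R k) setT g open) => //.
move=> _ [U oU <-]; rewrite setTI; apply: sub_sigma_algebra.
by move/continuousP : cf; apply.
Qed.

Lemma affine_continuous (R : realType) (V : normedModType R) (l : R) (c : V) :
  continuous (fun x : V => l *: x + c).
Proof.
by move=> x; apply: cvgD; [apply: cvgZ; [exact: cvg_cst|exact: cvg_id]|exact: cvg_cst].
Qed.

Lemma affine_cons_rV (R : realType) (d : nat) (l : R) (p q : R * 'rV[R]_d) :
  l *: cons_rV p + cons_rV q = cons_rV (l * p.1 + q.1, l *: p.2 + q.2).
Proof.
rewrite /cons_rV/= raddfD/= -scale_scalar_mx -(@add_row_mx _ 1 1 d).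
by rewrite -(@scale_row_mx _ 1 1 d).
Qed.

(** The affine map acts separately on the first coordinate and on the rest; the former contributes
    one factor [|l|] by substitution in the outer integral. *)
Lemma volume_affine (R : realType) (d : nat) (l : R) (c : 'rV[R]_d)
    (A : set (borel_rV R d)) : l != 0 -> measurable A ->
  volume A = ((`|l| ^+ d)%:E * volume [set x | A (l *: x + c)%R])%E.
Proof.
move=> l0; elim: d c A => [|d IH] c A mA.
  rewrite expr0 mul1e; congr (volume _); apply/funext => x /=; congr A.
  by apply/rowP; case.
have mf : measurable_fun setT
    (cons_rV : (R * borel_rV R d)%type -> borel_rV R d.+1) := measurable_cons_rV.
have mS : measurable ((cons_rV : (R * borel_rV R d)%type -> borel_rV R d.+1) @^-1` A).
  by rewrite -[X in measurable X]setTI; exact: mf.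
have mx (x : R) : measurable ([set y | A (cons_rV (x, y))] : set (borel_rV R d)).
  rewrite (_ : [set y | _] = xsection (cons_rV @^-1` A) x); last first.
    by apply/seteqP; split => y; rewrite /xsection/= inE.
  exact: measurable_xsection.
have mV : measurable_fun setT (fun x : R => volume [set y | A (cons_rV (x, y))]).
  rewrite (_ : (fun x => _) =
    volume_measure R d \o xsection (cons_rV @^-1` A)); last first.
    apply/funext => x /=; rewrite volume_measureE//; last exact: measurable_xsection.
    by congr volume; apply/seteqP; split => y; rewrite /xsection/= inE.
  exact: measurable_fun_xsection.
have V0 k (X : set (borel_rV R k)) : measurable X -> (0 <= volume X)%E.
  by move=> mX; rewrite -volume_measureE.
pose V (x : R) := volume [set y : 'rV[R]_d | A (cons_rV (x, y))].
pose c' : 'rV[R]_d := rsubmx (c : 'rV[R]_(1 + d)).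
have ld0 : `|l| ^+ d != 0 by rewrite expf_neq0// normr_eq0.
have WE x : volume [set y | A (cons_rV (x, l *: y + c'))] =
    ((`|l| ^+ d)^-1%:E * V x)%E.
  by rewrite /V (IH c' _ (mx x)) muleA -EFinM mulVf// mul1e.
have cE : c = cons_rV (c 0 0, c').
  rewrite /cons_rV/= -[LHS](@hsubmxK _ 1 1 d) [lsubmx _]mx11_scalar mxE.
  by congr (row_mx (c _ _)%:M _); exact/val_inj.
transitivity (\int[lebesgue_measure]_x V x)%E => //.
rewrite (@ge0_integral_affine _ l (c 0 0))//; last by move=> x; exact: V0.
have -> : volume [set x | A (l *: x + c)] =
    (\int[lebesgue_measure]_x ((`|l| ^+ d)^-1%:E * V (l * x + c 0 0)%R))%E.
  apply: eq_integral => x _; rewrite -WE; congr volume; apply/funext => y /=.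
  by rewrite [in LHS]cE -[row_mx _ _]/(cons_rV (x, y)) affine_cons_rV.
rewrite ge0_integralZl//.
- by rewrite muleA -EFinM exprS mulfK.
- apply: (measurableT_comp mV).
  by apply: measurable_funD => //; apply: measurable_funM.
- by move=> x _; exact: V0.
Qed.

Definition to_mfun d d' (T : measurableType d) (T' : measurableType d')
    (f : T -> T') (mf : measurable_fun setT f) : {mfun T >-> T'} :=
  HB.pack f (isMeasurableFun.Build _ _ _ _ f mf).

(** * Independent marks *)

Section independent_pair.
Context d1 d2 d3 (T : measurableType d1) (S1 : measurableType d2)
  (S2 : measurableType d3) (R : realType).
Variables (P : probability T R) (Q : probability S2 R) (Y : T -> S1) (X : T -> S2).
Hypotheses (mY : measurable_fun setT Y) (mX : measurable_fun setT X).
Hypothesis YX : forall A H, measurable A -> measurable H ->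
  (P (Y @^-1` A `&` X @^-1` H) = P (Y @^-1` A) * Q H)%E.

(** The joint law agrees with the product law on rectangles, hence everywhere; the rest is Tonelli's
    theorem. *)
Lemma ge0_integral_independent (f : S1 * S2 -> \bar R) :
  measurable_fun setT f -> (forall z, 0 <= f z)%E ->
  (\int[P]_w f (Y w, X w) = \int[P]_w \int[Q]_k f (Y w, k))%E.
Proof.
move=> mf f0.
pose YX' := to_mfun (measurable_fun_pair mY mX).
pose Y' := to_mfun mY.
have E (A : set (S1 * S2)) : measurable A ->
    distribution P YX' A = (distribution P Y' \x Q)%E A.
  move=> mA; rewrite (product_measure_unique (m' := distribution P YX'))//.
rewrite -[LHS](@ge0_integral_distribution _ _ _ _ _ P YX')//.
rewrite (eq_measure_integral (distribution P Y' \x Q)%E); last by move=> *; exact: E.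
rewrite fubini_tonelli1//.
apply: (@ge0_integral_distribution _ _ _ _ _ P Y').
  exact: measurable_fun_fubini_tonelli_F.
by move=> y; apply: integral_ge0.
Qed.

End independent_pair.

Section independent_marks.
Context d1 d2 (T : measurableType d1) (S : measurableType d2) (R : realType).
Variables (P : probability T R) (Q : probability S R).
Variables (G : set (set T)) (X : nat -> T -> S).
Local Notation TG := (g_sigma_algebraType G).
Hypothesis G_measurable : G `<=` measurable.
Hypothesis mX : forall n, measurable_fun setT (X n).
Hypothesis indep : forall (E : set TG) M (H : nat -> set S),
  measurable E -> (forall i, measurable (H i)) ->
  (P (E `&` \bigcap_(i < M) X i @^-1` H i) = P E * \prod_(i < M) Q (H i))%E.

(** An intersection-stable generator of the sigma-algebra of the ground events and of the marks with
    index below [M]. *)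
Let past M : set (set T) := [set E' | exists E H,
  [/\ (measurable : set (set TG)) E, forall i, measurable (H i) &
    E' = E `&` \bigcap_(i < M) X i @^-1` H i]].

Local Notation TP M := (g_sigma_algebraType (past M)).

Let ground_measurable (A : set TG) : measurable A -> (measurable : set (set T)) A.
Proof. by apply: smallest_sub => //; exact: sigma_algebra_measurable. Qed.

Let bigcap_mark_measurable M (H : nat -> set S) : (forall i, measurable (H i)) ->
  (measurable : set (set T)) (\bigcap_(i < M) X i @^-1` H i).
Proof.
move=> mH; apply: bigcap_measurableType => i _.
by rewrite -[X in measurable X]setTI; exact: mX.
Qed.

Let past_sub M : past M `<=` measurable.
Proof.
move=> _ [E [H [mE mH ->]]]; apply: measurableI; first exact: ground_measurable.
exact: bigcap_mark_measurable.
Qed.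

Let past_measurable M (A : set (TP M)) :
  measurable A -> (measurable : set (set T)) A.
Proof.
by apply: smallest_sub; [exact: sigma_algebra_measurable|exact: past_sub].
Qed.

Let measurable_id_past M : measurable_fun setT (idfun : T -> TP M).
Proof. by move=> _ A mA; rewrite setTI; exact: (past_measurable mA). Qed.

Let past_setI M : setI_closed (past M).
Proof.
move=> _ _ [E [H [mE mH ->]]] [E' [H' [mE' mH' ->]]].
exists (E `&` E'), (fun i => H i `&` H' i); split.
- exact: measurableI.
- by move=> i; exact: measurableI.
- by rewrite setIACA -bigcapI.
Qed.

Let past_setT M : past M setT.
Proof.
exists setT, (fun=> setT); split => //.
by rewrite setTI; apply/seteqP; split.
Qed.

Let ground_of_past M : measurable_fun setT (idfun : TP M -> TG).
Proof.
move=> _ A mA; rewrite setTI; apply: sub_sigma_algebra.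
exists A, (fun=> setT); split => //.
by rewrite (_ : bigcap _ _ = setT) ?setIT//; apply/seteqP; split.
Qed.

Let past_mark M i : (i < M)%N -> measurable_fun setT (X i : TP M -> S).
Proof.
move=> iM _ H mH; rewrite setTI; apply: sub_sigma_algebra.
exists setT, (fun j => if j == i then H else setT); split => //.
  by move=> j; case: ifP.
rewrite setTI; apply/seteqP; split => w /=.
  by move=> Hw j _ /=; case: eqVneq => [->|].
by move=> /(_ i iM); rewrite /= eqxx.
Qed.

(** Both sides are finite measures in [A], so it suffices to compare them on the generator
    [past M]. *)
Let past_independent M (A : set (TP M)) (B : set S) :
  measurable A -> measurable B ->
  (P (A `&` X M @^-1` B) = P A * Q B)%E.
Proof.
move=> mA mB.
have mXB : measurable (X M @^-1` B).
  by rewrite -[X in measurable X]setTI; exact: mX.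
have Q0 : 0 <= fine (Q B) by exact: fine_ge0.
have QE : (Q B = (fine (Q B))%:E)%E by rewrite fineK ?fin_num_measure.
transitivity (mrestr P mXB A) => //.
transitivity (mscale (NngNum Q0) P A); last by rewrite /mscale/= muleC -QE.
apply: (@g_sigma_algebra_measure_unique _ R T (past M) _ (fun=> setT)) => //.
- by rewrite bigcup_const.
- move=> _ [E [H [mE mH ->]]]; rewrite /= /mrestr /mscale/= -QE.
  (* The condition on the mark [M] joins those on the earlier marks, which brings the claim to the
     form of [indep] with [M.+1] marks. *)
  pose H' i := if i == M then B else H i.
  have mH' i : measurable (H' i) by rewrite /H'; case: ifP.
  have H'M : H' M = B by rewrite /H' eqxx.
  have := @indep E M.+1 H' mE mH'; rewrite big_ord_recr/= H'M.
  have -> : (\prod_(i < M) Q (H' i) = \prod_(i < M) Q (H i))%E.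
    by apply: eq_bigr => i _; rewrite /H' ltn_eqF.
  rewrite muleA -(@indep E M H mE mH) muleC => <-; congr (P _).
  apply/seteqP; split => w /=.
    move=> [[Ew Hw] Bw]; split => // i /=; rewrite ltnS /H'.
    by case: eqVneq => [->//|iM ilM]; apply: Hw; rewrite /= ltn_neqAle iM.
  move=> [Ew Hw]; split; last by have := Hw M (ltnSn M); rewrite /= H'M.
  split=> // i /= iM; have := Hw i (ltnW iM); rewrite /H'/=.
  by rewrite ltn_eqF.
- by move=> _; rewrite /= /mrestr setTI -ge0_fin_numE ?fin_num_measure.
Qed.

(** The marks are integrated out one at a time, the last one first, since it is independent of the
    ground and of all earlier marks. The weight [g] makes the induction work: it absorbs the means
    already computed. *)
Lemma integral_marked_prod M (h : nat -> TG * S -> R) (hb : nat -> T -> R)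
    (g : TG -> R) :
  measurable_fun setT g -> (forall w, 0 <= g w) ->
  (forall i, measurable_fun setT (h i)) -> (forall i z, 0 <= h i z) ->
  (forall i w, ((hb i w)%:E = \int[Q]_k (h i (w, k))%:E)%E) ->
  (\int[P]_w (g w * \prod_(i < M) h i (w, X i w))%:E =
   \int[P]_w (g w * \prod_(i < M) hb i w)%:E)%E.
Proof.
move=> mg g0 mh h0 hbE.
have hb0 i w : 0 <= hb i w.
  by rewrite -lee_fin hbE integral_ge0// => k _; rewrite lee_fin.
have mhb i : measurable_fun setT (hb i : TG -> R).
  apply/measurable_EFinP; rewrite (_ : EFin \o _ =
    fubini_F Q (fun z : TG * S => (h i z)%:E)); last by apply/funext => w /=; exact: hbE.
  apply: measurable_fun_fubini_tonelli_F; first exact/measurable_EFinP.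
  by move=> z; rewrite lee_fin.
elim: M g mg g0 => [|M IH] g mg g0.
  by apply: eq_integral => w _; rewrite !big_ord0.
pose f (z : TP M * S) : \bar R := (g z.1 * \prod_(i < M) h i (z.1, X i z.1)
  * h M z)%:E.
transitivity (\int[P]_w f (w, X M w))%E.
  by apply: eq_integral => w _; rewrite big_ord_recr/= mulrA.
rewrite (@ge0_integral_independent _ _ _ _ _ _ _ P Q (idfun : T -> TP M) (X M))//.
(* The mean over the last mark depends on the ground only and becomes part of the weight. *)
- transitivity (\int[P]_w ((g w * hb M w) * \prod_(i < M) h i (w, X i w))%:E)%E.
    apply: eq_integral => w _; rewrite /f/=.
    under eq_integral do rewrite EFinM.
    rewrite ge0_integralZl//=.
    - by rewrite -hbE -EFinM mulrAC.
    - apply/measurable_EFinP.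
      exact: (measurable_fun_pair2 (w : TG) (mh M)).
    - by move=> k _; rewrite lee_fin.
    - by rewrite lee_fin mulr_ge0// prodr_ge0.
  rewrite IH//.
  + by apply: eq_integral => w _; rewrite big_ord_recr/= mulrAC mulrA.
  + exact: measurable_funM.
  + by move=> w; rewrite mulr_ge0.
- exact: past_independent.
- have mfst : measurable_fun setT ((fun z => z.1) : (TP M * S)%type -> TG).
    exact: (measurableT_comp (@ground_of_past M) measurable_fst).
  have mpair (i : nat) (k : (TP M * S)%type -> S) : measurable_fun setT k ->
      measurable_fun setT (fun z : (TP M * S)%type => h i (z.1, k z)).
    move=> mk; apply: (measurableT_comp (mh i)).
    exact: (@measurable_fun_pair _ _ _ (TP M * S)%type TG S).
  apply/measurable_EFinP; apply: measurable_funM; last first.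
    rewrite (_ : h M = fun z => h M (z.1, z.2)); last by apply/funext => -[].
    exact: mpair measurable_snd.
  apply: measurable_funM; first exact: (measurableT_comp mg mfst).
  apply: measurable_prod => i _; apply: (mpair i (fun z => X i z.1)).
  exact: (measurableT_comp (past_mark (ltn_ord i)) measurable_fst).
- move=> z; rewrite lee_fin !mulr_ge0//; first exact: prodr_ge0.
Qed.

End independent_marks.

Section product_of_series.
Context d (T : measurableType d) (R : realType) (mu : {measure set T -> \bar R}).
Variables (m : nat) (a b : 'I_m -> nat -> T -> R) (A B : 'I_m -> T -> R).
Hypotheses (ma : forall i k, measurable_fun setT (a i k))
  (mb : forall i k, measurable_fun setT (b i k)).
Hypotheses (a0 : forall i k w, 0 <= a i k w) (b0 : forall i k w, 0 <= b i k w).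
Hypotheses (aA : forall i w, ((A i w)%:E = \sum_(k <oo) (a i k w)%:E)%E)
  (bB : forall i w, ((B i w)%:E = \sum_(k <oo) (b i k w)%:E)%E).

(** The factors with index below [j] are already summed, the others are single terms of their
    series. Raising [j] sums one more factor by monotone convergence. *)
Let partial (c : 'I_m -> nat -> T -> R) (C : 'I_m -> T -> R) (j : nat)
    (k : 'I_m -> nat) (w : T) (i : 'I_m) : R :=
  if (i < j)%N then C i w else c i (k i) w.

Let measurable_sum_series (c : 'I_m -> nat -> T -> R) (C : 'I_m -> T -> R) :
  (forall i k, measurable_fun setT (c i k)) -> (forall i k w, 0 <= c i k w) ->
  (forall i w, ((C i w)%:E = \sum_(k <oo) (c i k w)%:E)%E) ->
  forall i, measurable_fun setT (C i) /\ (forall w, 0 <= C i w).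
Proof.
move=> mc c0 cC i; split; last first.
  by move=> w; rewrite -lee_fin cC nneseries_ge0// => k _ _; rewrite lee_fin.
apply/measurable_EFinP; rewrite (_ : EFin \o _ =
    fun w => \sum_(k <oo | k \in xpredT) (c i k w)%:E)%E; last first.
  by apply/funext => w /=; rewrite cC; apply: eq_eseriesl.
apply: ge0_emeasurable_sum => [k w _ _|k _]; first by rewrite lee_fin.
exact/measurable_EFinP.
Qed.

Let integral_partialS (c : 'I_m -> nat -> T -> R) (C : 'I_m -> T -> R)
    (j : 'I_m) k :
  (forall i k, measurable_fun setT (c i k)) -> (forall i k w, 0 <= c i k w) ->
  (forall i w, ((C i w)%:E = \sum_(k <oo) (c i k w)%:E)%E) ->
  (\int[mu]_w (\prod_i partial c C j.+1 k w i)%:E =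
   \sum_(l <oo) \int[mu]_w
     (\prod_i partial c C j (fun i => if i == j then l else k i) w i)%:E)%E.
Proof.
move=> mc c0 cC; have mC := measurable_sum_series mc c0 cC.
rewrite -integral_nneseries//; last 2 first.
- move=> l; apply/measurable_EFinP; apply: measurable_prod => i _.
  by rewrite /partial; case: (i < j)%N => //; exact: (mC i).1.
- move=> l w _; rewrite lee_fin; apply: prodr_ge0 => i _.
  by rewrite /partial; case: ifP => _ //; exact: (mC i).2.
apply: eq_integral => w _.
pose r := \prod_(i < m | i != j) partial c C j k w i.
have r0 : 0 <= r.
  apply: prodr_ge0 => i _; rewrite /partial; case: ifP => _ //; exact: (mC i).2.
transitivity (\sum_(l <oo) (r%:E * (c j l w)%:E))%E; last first.
  apply: eq_eseriesr => l _; rewrite -EFinM; congr _%:E.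
  rewrite (bigD1 j)//= mulrC {1}/partial ltnn eqxx; congr (_ * _).
  by apply: eq_bigr => i ij; rewrite /partial (negbTE ij).
rewrite nneseriesZl//; last by move=> l _; rewrite lee_fin.
rewrite -cC -EFinM; congr _%:E.
rewrite (bigD1 j)//= {1}/partial ltnSn mulrC; congr (_ * _).
apply: eq_bigr => i ij; rewrite /partial ltnS leq_eqVlt.
by rewrite (_ : _ == _ :> nat = false)//; apply/negbTE.
Qed.

(** This passes from joint probabilities of counts to products of generating functions. *)
Lemma integral_prod_nneseries :
  (forall k : 'I_m -> nat, \int[mu]_w (\prod_i a i (k i) w)%:E =
    \int[mu]_w (\prod_i b i (k i) w)%:E)%E ->
  (\int[mu]_w (\prod_i A i w)%:E = \int[mu]_w (\prod_i B i w)%:E)%E.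
Proof.
move=> ab.
have claim j : (j <= m)%N -> forall k,
    (\int[mu]_w (\prod_i partial a A j k w i)%:E =
     \int[mu]_w (\prod_i partial b B j k w i)%:E)%E.
  elim: j => [_ k|j IH jm k]; first exact: ab.
  rewrite (@integral_partialS a A (Ordinal jm))//.
  rewrite (@integral_partialS b B (Ordinal jm))//.
  by apply: eq_eseriesr => l _; apply: IH; exact: ltnW.
have := claim m (leqnn m) (fun=> 0%N).
have E (c : 'I_m -> nat -> T -> R) (C : 'I_m -> T -> R) :
    (\int[mu]_w (\prod_i partial c C m (fun=> 0%N) w i)%:E =
     \int[mu]_w (\prod_i C i w)%:E)%E.
  by apply: eq_integral => w _; congr _%:E; apply: eq_bigr => i _;
     rewrite /partial ltn_ord.
by rewrite !E.
Qed.

End product_of_series.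

(** * Generating functionals of mixed Poisson processes *)

Section power_counting.
Context {R : realType}.
Implicit Types (c : R) (S : set nat).

(** The value [0] on infinite sets is the right one for [0 <= c < 1]. *)
Definition power_counting c S : R :=
  if pselect (exists k, counting S = k%:R%:E :> \bar R) is left e
  then c ^+ projT1 (cid e) else 0.

Lemma power_countingE c S : 0 <= c ->
  ((power_counting c S)%:E =
   \sum_(k <oo) (c ^+ k * (counting S == k%:R%:E :> \bar R)%:R)%:E)%E.
Proof.
move=> c0; rewrite /power_counting; case: pselect => [e|ne]; last first.
  rewrite eseries0// => k _ _; case: eqP => [ke|]; last by rewrite mulr0.
  by case: ne; exists k.
case: cid => k /= ->; rewrite (@nneseriesD1 _ _ k)//; last first.
  by move=> j _; rewrite lee_fin mulr_ge0// exprn_ge0.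
rewrite eqxx mulr1 eseries0 ?adde0// => j _ /= jk.
by rewrite eqe eqr_nat eq_sym (negbTE jk) mulr0.
Qed.

Let cnt S M : nat := \sum_(n < M) `[< S n >].

Let countingE S : ((cnt S M)%:R%:E : \bar R) @[M --> \oo] --> counting S.
Proof.
rewrite counting_dirac.
have -> : (fun M => (cnt S M)%:R%:E : \bar R) =
    (fun M => \sum_(0 <= i < M) (\d_i S : \bar R))%E.
  apply/funext => M; rewrite big_mkord /cnt natr_sum -sumEFin.
  apply: eq_bigr => i _; rewrite diracE.
  by case: asboolP => [Si|nSi]; rewrite ?(mem_set Si) ?(memNset nSi).
by apply: is_cvg_nneseries => n _ _; rewrite diracE lee_fin.
Qed.

(** The partial product is [c] to the number of indices of [S] below [M]: eventually constant if [S]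
    is finite, and tending to 0 otherwise because [c < 1]. *)
Lemma cvg_power_counting c S : 0 <= c < 1 ->
  \prod_(n < M) (1 - (1 - c) * (`[< S n >])%:R) @[M --> \oo] --> power_counting c S.
Proof.
move=> /andP[c0 c1].
have -> : (fun M => \prod_(n < M) (1 - (1 - c) * (`[< S n >])%:R)) =
    (fun M => c ^+ cnt S M).
  apply/funext => M; rewrite /cnt expr_sum; apply: eq_bigr => i _.
  case: `[< S i >]; last by rewrite expr0 mulr0 subr0.
  by rewrite expr1 mulr1 subKr.
have cntS := @countingE S.
have cnt_nd : {homo cnt S : i j / (i <= j)%N}.
  move=> i j ij; rewrite /cnt -!(big_mkord xpredT (fun n => nat_of_bool `[< S n >])).
  by rewrite (@big_cat_nat _ _ _ i 0 j)//= leq_addr.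
rewrite /power_counting; case: pselect => [e|ne].
  case: cid => k /= Sk; move: cntS; rewrite Sk => /fine_cvgP[_ /= cntk].
  have [M0 _ M0k] : \forall M \near \oo, cnt S M = k.
    have /cvgrPdist_lt/(_ 1 ltr01)[M0 _ M0k] := cntk.
    exists M0 => // M /M0k /=; rewrite ltr_distlC.
    rewrite ltrBlDr natr1 natr1 !ltr_nat !ltnS => /andP[h1 h2].
    by apply/eqP; rewrite eqn_leq h1 h2.
  apply: cvg_near_cst; exists M0 => // M M0M /=; by rewrite M0k.
have cnt_oo : forall k, \forall M \near \oo, (k <= cnt S M)%N.
  move=> k; case: (pselect (exists M, (k <= cnt S M)%N)) => [[M kM]|nM].
    by exists M => // M' /= MM'; exact: leq_trans kM (cnt_nd _ _ MM').
  have Soo : counting S = +oo%E :> \bar R.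
    have [//|kS] : counting S = +oo%E :> \bar R \/
        exists k, counting S = k%:R%:E :> \bar R; last by case: ne.
    by rewrite /counting; case: asboolP => _; [right; eexists|left].
  move: cntS; rewrite Soo => /cvgeyPge/(_ k%:R)[M0 _ /(_ M0 (leqnn _))]/=.
  by rewrite lee_fin ler_nat => kM; case: nM; exists M0.
apply/cvgrPdist_lt => e e0.
have [k _ ke] : \forall n \near \oo, c ^+ n < e.
  have /cvg_expr/cvgrPdist_lt/(_ e e0) : `|c| < 1 by rewrite ger0_norm.
  by case=> k _ kc; exists k => // n /kc /=; rewrite sub0r normrN ger0_norm ?exprn_ge0.
near=> M.
rewrite sub0r normrN ger0_norm ?exprn_ge0//; apply: ke => /=.
by near: M; exact: cnt_oo.
Unshelve. all: by end_near. Qed.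

End power_counting.

Section infinite_product.
Context {R : realType}.
Implicit Types (u v : nat -> R).

Definition infinite_prod u : R := limn (fun M => \prod_(n < M) u n).

Lemma prod_le1 u M : (forall n, 0 <= u n <= 1) -> 0 <= \prod_(n < M) u n <= 1.
Proof.
move=> u01; elim: M => [|M /andP[IH0 IH1]]; first by rewrite big_ord0 ler01 lexx.
have /andP[u0 u1] := u01 M; rewrite big_ord_recr/= mulr_ge0//=.
exact: mulr_ile1.
Qed.

Lemma cvg_infinite_prod u : (forall n, 0 <= u n <= 1) ->
  \prod_(n < M) u n @[M --> \oo] --> infinite_prod u.
Proof.
move=> u01; apply: (@nonincreasing_is_cvgn R); last first.
  by exists 0 => _ [M _ <-]; have /andP[] := prod_le1 M u01.
apply/nonincreasing_seqP => M; rewrite big_ord_recr/=.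
have /andP[p0 _] := prod_le1 M u01; have /andP[_ u1] := u01 M.
by rewrite ler_piMr.
Qed.

Lemma infinite_prod_le u M : (forall n, 0 <= u n <= 1) ->
  infinite_prod u <= \prod_(n < M) u n.
Proof.
move=> u01; apply: (@nonincreasing_cvgn_ge R); last first.
  by apply: cvgP; exact: cvg_infinite_prod.
apply/nonincreasing_seqP => k; rewrite big_ord_recr/=.
have /andP[p0 _] := prod_le1 k u01; have /andP[_ u1] := u01 k.
by rewrite ler_piMr.
Qed.

Lemma infinite_prod_ge0 u : (forall n, 0 <= u n <= 1) -> 0 <= infinite_prod u.
Proof.
move=> u01; apply: limr_ge.
  by apply: cvgP; exact: cvg_infinite_prod.
by apply: nearW => M; have /andP[] := prod_le1 M u01.
Qed.

Lemma ler_infinite_prod u v : (forall n, 0 <= u n) -> (forall n, u n <= v n) ->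
  (forall n, v n <= 1) -> infinite_prod u <= infinite_prod v.
Proof.
move=> u0 uv v1.
have u01 n : 0 <= u n <= 1 by rewrite u0 (le_trans (uv n)).
have v01 n : 0 <= v n <= 1 by rewrite v1 (le_trans (u0 n)).
apply: ler_lim.
- by apply: cvgP; exact: cvg_infinite_prod.
- by apply: cvgP; exact: cvg_infinite_prod.
- by apply: nearW => M; apply: ler_prod => i _; rewrite u0 uv.
Qed.

(** An interchange of limits without uniformity in [k]: the bound from below is [v <= u k], and from
    above a partial product of fixed length already suffices. *)
Lemma cvg_infinite_prod_seq (u : nat -> nat -> R) v :
  (forall k n, 0 <= u k n <= 1) -> (forall n, 0 <= v n) ->
  (forall k n, v n <= u k n) -> (forall n, u k n @[k --> \oo] --> v n) ->
  infinite_prod (u k) @[k --> \oo] --> infinite_prod v.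
Proof.
move=> u01 v0 vu uv.
have v01 n : 0 <= v n <= 1.
  by rewrite v0 (le_trans (vu 0%N n))//; have /andP[] := u01 0%N n.
apply/cvgrPdist_lt => e e0.
have e20 : 0 < e / 2 by rewrite divr_gt0.
have /cvgrPdist_lt/(_ _ e20)[M _ /(_ M (leqnn _))/= vM] := cvg_infinite_prod v01.
have cM : \prod_(n < M) u k n @[k --> \oo] --> \prod_(n < M) v n.
  elim: {vM}M => [|M IH].
    under eq_fun do rewrite big_ord0; rewrite big_ord0; exact: cvg_cst.
  under eq_fun do rewrite big_ord_recr/=; rewrite big_ord_recr/=.
  exact: cvgM.
near=> k.
have lev : infinite_prod v <= infinite_prod (u k).
  apply: ler_infinite_prod => // n; by have /andP[] := u01 k n.
rewrite distrC ger0_norm ?subr_ge0//.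
have uk := infinite_prod_le M (u01 k).
have : `|\prod_(n < M) v n - \prod_(n < M) u k n| < e / 2.
  by near: k; move/cvgrPdist_lt : cM; exact.
rewrite ltr_distlC => /andP[_ h].
move: vM; rewrite ltr_distlC => /andP[_ h']; lra.
Unshelve. all: by end_near. Qed.

End infinite_product.

Lemma expR_nneseries (R : realType) (x : R) : 0 <= x ->
  ((expR x)%:E = \sum_(k <oo) (x ^+ k / k`!%:R)%:E)%E.
Proof.
move=> x0; rewrite /expR -EFin_lim; last exact: is_cvg_series_exp_coeff.
apply: congr_lim; apply/funext => n /=.
by rewrite /series/= -sumEFin.
Qed.

Lemma bounded_convergence d (T : measurableType d) (R : realType)
    (P : probability T R) (f_ : nat -> T -> R) (f : T -> R) :
  (forall n, measurable_fun setT (f_ n)) -> measurable_fun setT f ->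
  (forall n w, 0 <= f_ n w <= 1) -> (forall w, f_ n w @[n --> \oo] --> f w) ->
  (\int[P]_w (f_ n w)%:E @[n --> \oo] --> \int[P]_w (f w)%:E)%E.
Proof.
move=> mf_ mf f01 ff.
apply: (@dominated_cvg _ _ _ P setT measurableT (fun n w => (f_ n w)%:E)
  (fun w => (f w)%:E) (cst 1%E)) => //.
- by move=> n; exact/measurable_EFinP.
- by move=> w _; apply/fine_cvgP; split; [exact: nearW|exact: ff].
- by apply: finite_measure_integrable_cst.
- by move=> n w _ /=; rewrite lee_fin; have /andP[a b] := f01 n w; rewrite ger0_norm.
Qed.

Section poisson_functional.
Context {R : realType} {d : nat} {d1 : measure_display} {T : measurableType d1}.
Context (P : probability T R) (L : {RV P >-> R}).
Variable N : nat -> T -> option 'rV[R]_d.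
Hypothesis LN : mixed_poisson_process L N.

Local Notation vol := (volume_measure R d).

Let L_ge0 w : 0 <= L w. Proof. by case: LN. Qed.

Lemma measurable_point_in n (A : set (borel_rV R d)) :
  measurable A -> measurable (point_in N n A).
Proof. by case: LN => _ _ mN _; exact: mN. Qed.

Lemma measurable_point_count (A : set (borel_rV R d)) :
  measurable A -> measurable_fun setT (point_count N A).
Proof.
move=> mA; rewrite (_ : point_count N A =
    fun w => (\sum_(n <oo | n \in xpredT) (\1_(point_in N n A) w)%:E)%E); last first.
  apply/funext => w; rewrite /point_count counting_dirac.
  rewrite (eq_eseriesl (Q := xpredT))//; apply: eq_eseriesr => n _.
apply: ge0_emeasurable_sum => [n w _ _|n _]; first by rewrite lee_fin.
by apply/measurable_EFinP; apply: measurable_indic; exact: measurable_point_in.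
Qed.

Lemma measurable_point_count_eq (A : set (borel_rV R d)) k :
  measurable A -> measurable [set w | point_count N A w = k%:R%:E].
Proof.
move=> mA; rewrite -[X in measurable X]setTI; apply: measurable_eqe => //.
exact: measurable_point_count.
Qed.

Let measurable_poisson_mass (v : R) k :
  measurable_fun setT (fun w => poisson_mass (L w * v) k).
Proof.
have mLv : measurable_fun setT (fun w => L w * v) by exact: measurable_funM.
apply: measurable_funM => //; apply: measurable_funM.
  by apply: measurableT_comp => //; apply: measurableT_comp.
exact: measurable_funX.
Qed.

Let poisson_mass_ge0 (v : R) k w : 0 <= v -> 0 <= poisson_mass (L w * v) k.
Proof.
by move=> v0; rewrite /poisson_mass divr_ge0// mulr_ge0 ?expR_ge0// exprn_ge0// mulr_ge0.
Qed.

(** Conditionally on [L] these are generating functions of Poisson variables. Both sides are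
    expanded in powers of the [c i], and the coefficients agree by the law of the counts in disjoint
    sets. *)
Lemma poisson_power_counting m (A : 'I_m -> set (borel_rV R d)) (c : 'I_m -> R) :
  (forall i, measurable (A i)) -> (forall i, vol (A i) < +oo)%E ->
  trivIset setT A -> (forall i, 0 <= c i < 1) ->
  (\int[P]_w (\prod_(i < m)
     power_counting (c i) [set n | point_in N n (A i) w])%:E =
   \int[P]_w (\prod_(i < m)
     expR (- (L w * (fine (vol (A i)) * (1 - c i)))))%:E)%E.
Proof.
move=> mA volA tA c01.
pose a i k w := c i ^+ k * (point_count N (A i) w == k%:R%:E)%:R : R.
pose b i k w := c i ^+ k * poisson_mass (L w * fine (vol (A i))) k : R.
have c0 i : 0 <= c i by have /andP[] := c01 i.
apply: (@integral_prod_nneseries _ _ _ _ _ a b).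
- move=> i k; apply: measurable_funM => //.
  rewrite (_ : (fun w => _) = \1_[set w | point_count N (A i) w = k%:R%:E]).
    by apply: measurable_indic; exact: measurable_point_count_eq.
  apply/funext => w; rewrite indicE; congr (nat_of_bool _)%:R.
  by apply/idP/idP => [/eqP ?|/set_mem/eqP//]; exact/mem_set.
- by move=> i k; apply: measurable_funM.
- by move=> i k w; rewrite mulr_ge0// exprn_ge0.
- by move=> i k w; rewrite mulr_ge0 ?exprn_ge0// poisson_mass_ge0// fine_ge0.
- by move=> i w; exact: power_countingE.
- move=> i w; set v := fine (vol (A i)).
  have v0 : 0 <= v by exact: fine_ge0.
  have -> : expR (- (L w * (v * (1 - c i)))) =
      expR (- (L w * v)) * expR (c i * (L w * v)).
    by rewrite -expRD; congr expR; ring.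
  rewrite EFinM (@expR_nneseries _ (c i * (L w * v))) ?mulr_ge0// -nneseriesZl//; last first.
    by move=> k _; rewrite lee_fin divr_ge0// exprn_ge0// !mulr_ge0.
  apply: eq_eseriesr => k _; rewrite -EFinM /b /poisson_mass; congr _%:E.
  by rewrite exprMn; ring.
- move=> k.
  have ck0 : 0 <= \prod_i c i ^+ k i by apply: prodr_ge0 => i _; exact: exprn_ge0.
  have mE : measurable [set w | forall i, point_count N (A i) w = (k i)%:R%:E].
    rewrite (_ : [set w | _] = \bigcap_(i in [set: 'I_m])
        [set w | point_count N (A i) w = (k i)%:R%:E]).
      apply: fin_bigcap_measurable => // i _; exact: measurable_point_count_eq.
    by apply/seteqP; split => w /= h; [move=> i _|move=> i]; apply: h.
  transitivity ((\prod_i c i ^+ k i)%:E * \int[P]_w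
      (\1_[set w | forall i, point_count N (A i) w = (k i)%:R%:E] w)%:E)%E.
    rewrite -ge0_integralZl_EFin//; last first.
      by apply/measurable_EFinP; exact: measurable_indic.
    apply: eq_integral => w _; rewrite -EFinM big_split/=; congr (_ * _)%:E.
    rewrite indicE; case: (boolP (w \in _)) => [/set_mem/= wk|wk].
      by rewrite big1// => i _; rewrite wk eqxx.
    have [i wi] : exists i, point_count N (A i) w != (k i)%:R%:E.
      apply: contrapT => h; move/negP: wk; apply; apply/mem_set => i /=.
      by apply: contrapT => wi; apply: h; exists i; apply/eqP.
    by rewrite (bigD1 i)//= (negbTE wi) mul0r.
  transitivity ((\prod_i c i ^+ k i)%:E * \int[P]_w
      (\prod_(i < m) poisson_mass (L w * fine (vol (A i))) (k i))%:E)%E; last first.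
    rewrite -ge0_integralZl_EFin//.
    + by apply: eq_integral => w _; rewrite -EFinM -big_split.
    + move=> w _; rewrite lee_fin; apply: prodr_ge0 => i _.
      by rewrite poisson_mass_ge0// fine_ge0.
    + by apply/measurable_EFinP; apply: measurable_prod.
  congr (_ * _)%E; rewrite integral_indic// setIT.
  case: LN => _ _ _ /(_ m A k setT) LNA.
  transitivity (P [set w | setT (L w) /\ forall i, point_count N (A i) w = (k i)%:R%:E]).
    by congr (P _); apply/seteqP; split => w /= => [?|[]].
  rewrite LNA//; last by move=> i; split; [exact: mA|rewrite -volume_measureE].
  rewrite preimage_setT; apply: eq_integral => w _; congr _%:E.
  by apply: eq_bigr => i _; rewrite volume_measureE.
Qed.

End poisson_functional.

Import HBSimple HBNNSimple.

Lemma cvg_big_prod (R : realType) m (u : 'I_m -> nat -> R) (l : 'I_m -> R) :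
  (forall i, u i M @[M --> \oo] --> l i) ->
  \prod_(i < m) u i M @[M --> \oo] --> \prod_(i < m) l i.
Proof.
elim: m u l => [|m IH] u l ul.
  by under eq_fun do rewrite big_ord0; rewrite big_ord0; exact: cvg_cst.
under eq_fun do rewrite big_ord_recl; rewrite big_ord_recl.
by apply: cvgM => //; apply: IH => i; exact: ul.
Qed.

Section poisson_functional_general.
Context {R : realType} {d : nat} {d1 : measure_display} {T : measurableType d1}.
Context (P : probability T R) (L : {RV P >-> R}).
Variable N : nat -> T -> option 'rV[R]_d.
Hypothesis LN : mixed_poisson_process L N.

Local Notation vol := (volume_measure R d).

Lemma measurable_oapp_point (q : borel_rV R d -> R) n :
  measurable_fun setT q -> measurable_fun setT (fun w => oapp q 0 (N n w)).
Proof.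
move=> mq _ Y mY; rewrite setTI.
have mp (A : set (borel_rV R d)) : measurable A -> measurable (point_in N n A).
  exact: (measurable_point_in LN).
(* A missing point has the value 0, so the realizations without an n-th point are added exactly if
   [Y] contains 0. *)
rewrite (_ : _ @^-1` Y = point_in N n (q @^-1` Y) `|`
    (if `[< Y 0 >] then ~` point_in N n setT else set0)).
  apply: measurableU.
    by apply: mp; rewrite -[X in measurable X]setTI; exact: mq.
  by case: asboolP => // _; apply: measurableC; exact: mp.
apply/seteqP; split => w /=.
  case E : (N n w) => [x|]/= Yq; first by left; exists x.
  by right; case: asboolP => //= _ [x _]; rewrite E.
case=> [[x Yx ->]//|]; case: asboolP => //= Y0.
by case E : (N n w) => [x|//] h; case: h; exists x.
Qed.

(** The mean of this product over the points is the generating functional at [1 - q]; if [q] is an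
    indicator, the product is the indicator of a void event. *)
Definition void_functional (q : 'rV[R]_d -> R) (w : T) : R :=
  infinite_prod (fun n => 1 - oapp q 0 (N n w)).

Lemma oapp01 (q : 'rV[R]_d -> R) : (forall x, 0 <= q x <= 1) ->
  forall o, 0 <= 1 - oapp q 0 o <= 1.
Proof.
move=> q01 [x|] /=; last by rewrite subr0 ler01 lexx.
by have /andP[] := q01 x; lra.
Qed.

Lemma measurable_void_functional (q : borel_rV R d -> R) :
  measurable_fun setT q -> (forall x, 0 <= q x <= 1) ->
  measurable_fun setT (void_functional q).
Proof.
move=> mq q01.
apply: (measurable_fun_cvg (h := fun M w => \prod_(n < M) (1 - oapp q 0 (N n w)))).
  move=> M; apply: measurable_prod => n _; apply: measurable_funB => //.
  exact: measurable_oapp_point.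
by move=> w _; apply: cvg_infinite_prod => n; exact: oapp01.
Qed.

Lemma void_functional01 (q : 'rV[R]_d -> R) w : (forall x, 0 <= q x <= 1) ->
  0 <= void_functional q w <= 1.
Proof.
move=> q01; have u01 n := oapp01 q01 (N n w).
rewrite infinite_prod_ge0//= (le_trans (infinite_prod_le 0 u01))//.
by rewrite big_ord0.
Qed.

Lemma nnsfun_range_seq (f : {nnsfun borel_rV R d >-> R}) : exists s : seq R,
  uniq s /\ (forall y, y \in s -> y != 0) /\ (forall x, f x != 0 -> f x \in s) /\
  (forall y, y \in s -> exists x, f x = y).
Proof.
have /finite_seqP[s0 fs0] := fimfunP f.
exists [seq y <- undup s0 | y != 0]; split; first exact/filter_uniq/undup_uniq.
have in_s0 y : (y \in s0) <-> (exists x, f x = y).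
  have : range f y <-> [set` s0] y by rewrite fs0.
  by move=> [h1 h2]; split => [/h2[x _ <-]|[x fx]]; [exists x|apply: h1; exists x].
split=> [y|]; first by rewrite mem_filter => /andP[].
split=> [x fx0|y]; rewrite mem_filter mem_undup.
  by rewrite fx0; apply/in_s0; exists x.
by move=> /andP[_ /in_s0].
Qed.

(** Since [f] is a combination of indicators of disjoint level sets, [1 - f] is a product over the
    levels, and the functional is the product of the powers of [1 - y i] with the number of points
    in [A i] as exponent. The value 0 is left out, as its level set may have infinite volume. *)
Lemma poisson_void_sfun (f : {nnsfun borel_rV R d >-> R}) :
  (forall x, f x <= 1) -> (\int[vol]_x (f x)%:E < +oo)%E ->
  (\int[P]_w (void_functional f w)%:E =
   \int[P]_w (expR (- (L w * fine (\int[vol]_x (f x)%:E)%E)))%:E)%E.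
Proof.
move=> f1 intf.
have [s [us [s0 [fs sf]]]] := nnsfun_range_seq f.
pose m := size s; pose y (i : 'I_m) := s`_i.
pose A (i : 'I_m) : set (borel_rV R d) := f @^-1` [set y i].
have mA i : measurable (A i) by exact: measurable_sfunP.
have ys i : y i \in s by apply: mem_nth.
have y0 i : 0 < y i.
  by rewrite lt_neqAle eq_sym s0//=; have [x <-] := sf _ (ys i).
have y1 i : y i <= 1 by have [x <-] := sf _ (ys i).
have tA : trivIset setT A.
  move=> i j _ _ [x [fi fj]]; have : y i == y j by rewrite -fi -fj.
  by rewrite nth_uniq// => /eqP/val_inj.
have fE x : f x = \sum_(i < m) y i * \1_(A i) x.
  have [fx0|fx0] := eqVneq (f x) 0.
    rewrite big1 => // i _; rewrite indicE memNset ?mulr0//= /A/= fx0 => yi0.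
    by have := y0 i; rewrite -yi0 ltxx.
  have fxs := fs _ fx0; have im : (index (f x) s < m)%N by rewrite index_mem.
  rewrite (bigD1 (Ordinal im))//= big1 ?addr0.
    by rewrite /y/= nth_index// indicE mem_set ?mulr1//= /A/= /y/= nth_index.
  move=> i ine; rewrite indicE memNset ?mulr0//= /A/= => fxi; move/eqP: ine; apply.
  by apply/val_inj; rewrite /= fxi index_uniq.
have f1E x : 1 - f x = \prod_(i < m) (1 - y i * \1_(A i) x).
  have [fx0|fx0] := eqVneq (f x) 0.
    rewrite fx0 big1 ?subr0// => i _.
    rewrite indicE memNset ?mulr0 ?subr0//= /A/= fx0 => yi0.
    by have := y0 i; rewrite -yi0 ltxx.
  have fxs := fs _ fx0; have im : (index (f x) s < m)%N by rewrite index_mem.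
  rewrite (bigD1 (Ordinal im))//= big1 ?mulr1.
    by rewrite /y/= nth_index// indicE mem_set ?mulr1//= /A/= /y/= nth_index.
  move=> i ine; rewrite indicE memNset ?mulr0 ?subr0//= /A/= => fxi.
  by move/eqP: ine; apply; apply/val_inj; rewrite /= fxi index_uniq.
have intfE : (\int[vol]_x (f x)%:E = \sum_(i < m) (y i)%:E * vol (A i))%E.
  under eq_integral do rewrite fE -sumEFin.
  rewrite ge0_integral_sum//.
  - apply: eq_bigr => i _; under eq_integral do rewrite EFinM.
    rewrite ge0_integralZl_EFin// ?integral_indic ?setIT// ?ltW//.
    by apply/measurable_EFinP; exact: measurable_indic.
  - by move=> i; apply/measurable_EFinP; apply: measurable_funM.
  - by move=> i x _; rewrite lee_fin mulr_ge0// ltW.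
have volA i : (vol (A i) < +oo)%E.
  move: intf; rewrite intfE => sfin; rewrite ltey; apply/negP => /eqP volA.
  move: sfin; rewrite (bigD1 i)//= volA gt0_muley ?lte_fin// addye//.
  by rewrite gt_eqF// (lt_le_trans (ltNye 0))// sume_ge0// => j _; rewrite mule_ge0// lee_fin ltW.
transitivity (\int[P]_w (\prod_(i < m)
     power_counting (1 - y i) [set n | point_in N n (A i) w])%:E)%E.
  apply: eq_integral => w _; congr _%:E.
  apply: cvg_lim => //.
  (* The product over the points and the finite product over the levels are exchanged before the
     limit is taken. *)
  rewrite (_ : (fun M => _) = (fun M => \prod_(i < m) \prod_(n < M)
      (1 - (1 - (1 - y i)) * (`[< [set n | point_in N n (A i) w] n >])%:R))).
    apply: cvg_big_prod => i; apply: cvg_power_counting.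
    by rewrite subr_ge0 y1 ltrBlDr ltrDl y0.
  apply/funext => M; rewrite exchange_big/=; apply: eq_bigr => n _.
  case Nnw : (N n w) => [x|]/=.
    rewrite f1E; apply: eq_bigr => i _; rewrite subKr indicE.
    congr (1 - _ * (nat_of_bool _)%:R).
    apply/idP/idP => [/set_mem Aix|/asboolP[z Az]].
      by apply/asboolP; exists x.
    by rewrite Nnw => -[->]; exact/mem_set.
  rewrite subr0 big1// => i _; rewrite asboolF ?mulr0 ?subr0//.
  by move=> [z _]; rewrite Nnw.
rewrite (poisson_power_counting LN)//; last first.
  by move=> i; rewrite subr_ge0 y1 ltrBlDr ltrDl y0.
apply: eq_integral => w _; congr _%:E.
rewrite intfE -expR_sum; congr expR.
rewrite -sum_fine; last by move=> i _; rewrite fin_numM// ge0_fin_numE.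
rewrite mulr_sumr -sumrN; apply: eq_bigr => i _.
rewrite fineM//; last by rewrite ge0_fin_numE.
by rewrite /= subKr mulrC (mulrC (y i)) mulrC.
Qed.

End poisson_functional_general.

Section poisson_void.
Context {R : realType} {d : nat} {d1 : measure_display} {T : measurableType d1}.
Context (P : probability T R) (L : {RV P >-> R}).
Variable N : nat -> T -> option 'rV[R]_d.
Hypothesis LN : mixed_poisson_process L N.

Local Notation vol := (volume_measure R d).

(** Simple functions increasing to [q] give factors decreasing to [1 - q]; both sides pass to the
    limit by bounded convergence, and the volume integral by monotone convergence. *)
Lemma poisson_void_functional (q : borel_rV R d -> R) :
  measurable_fun setT q -> (forall x, 0 <= q x <= 1) ->
  (\int[vol]_x (q x)%:E < +oo)%E ->
  (\int[P]_w (void_functional N q w)%:E =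
   \int[P]_w (expR (- (L w * fine (\int[vol]_x (q x)%:E)%E)))%:E)%E.
Proof.
move=> mq q01 intq.
have mEq : measurable_fun setT (EFin \o q) by exact/measurable_EFinP.
pose f := nnsfun_approx measurableT mEq.
have q0 x : (0 <= (q x)%:E)%E by rewrite lee_fin; have /andP[] := q01 x.
have fq x : f k x @[k --> \oo] --> q x.
  have /(_ (fun x _ => q0 x) x I) := @cvg_nnsfun_approx _ _ R _ measurableT _ mEq.
  by move=> /fine_cvgP[].
have fle k x : f k x <= q x.
  rewrite -(cvg_lim _ (fq x))//; apply: (@nondecreasing_cvgn_le R (f ^~ x)).
    by move=> i j ij; have /lefP := nd_nnsfun_approx measurableT mEq ij; exact.
  by apply: cvgP; exact: fq.
have f01 k x : 0 <= f k x <= 1.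
  by rewrite fun_ge0 (le_trans (fle k x))//; have /andP[] := q01 x.
have intf k : (\int[vol]_x (f k x)%:E <= \int[vol]_x (q x)%:E)%E.
  apply: ge0_le_integral => //.
  - by move=> x _; rewrite lee_fin; have /andP[] := f01 k x.
  - exact/measurable_EFinP.
  - by move=> x _; rewrite lee_fin.
have fE k := poisson_void_sfun LN (fun x => proj2 (andP (f01 k x)))
  (le_lt_trans (intf k) intq).
have lhs : (\int[P]_w (void_functional N (f k) w)%:E @[k --> \oo] -->
    \int[P]_w (void_functional N q w)%:E)%E.
  apply: bounded_convergence.
  - by move=> k; apply: (measurable_void_functional LN).
  - exact: (measurable_void_functional LN).
  - by move=> k w; exact: void_functional01.
  - move=> w; apply: cvg_infinite_prod_seq.
    + by move=> k n; exact: oapp01.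
    + by move=> n; have /andP[] := oapp01 q01 (N n w).
    + by move=> k n; case: (N n w) => //= x; rewrite lerB.
    + move=> n; apply: cvgB; first exact: cvg_cst.
      by case: (N n w) => [x|] /=; [exact: fq|exact: cvg_cst].
have intfq : fine (\int[vol]_x (f k x)%:E) @[k --> \oo] -->
    fine (\int[vol]_x (q x)%:E).
  apply: fine_cvg; rewrite fineK ?ge0_fin_numE ?integral_ge0//.
  have -> : (\int[vol]_x (q x)%:E = \int[vol]_x limn (fun k => (f k x)%:E))%E.
    apply: eq_integral => x _; apply/esym/cvg_lim => //.
    by apply/fine_cvgP; split; [exact: nearW|exact: fq].
  apply: cvg_monotone_convergence => //.
  - by move=> k; exact/measurable_EFinP.
  - by move=> k x _; rewrite lee_fin; have /andP[] := f01 k x.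
  - move=> x _ i j ij; rewrite lee_fin.
    by have /lefP := nd_nnsfun_approx measurableT mEq ij; exact.
have rhs : (\int[P]_w (expR (- (L w * fine (\int[vol]_x (f k x)%:E)%E)))%:E
    @[k --> \oo] -->
    \int[P]_w (expR (- (L w * fine (\int[vol]_x (q x)%:E)%E)))%:E)%E.
  have mexp (v : R) : measurable_fun setT (fun w => expR (- (L w * v))).
    apply: measurableT_comp => //; apply: measurableT_comp => //.
    exact: measurable_funM.
  apply: bounded_convergence => //.
  - move=> k w; rewrite expR_ge0 -[leRHS]expR0 ler_expR oppr_le0 mulr_ge0//.
      by case: LN.
    by apply: fine_ge0; apply: integral_ge0 => x _; rewrite lee_fin; have /andP[] := f01 k x.
  - move=> w; apply: continuous_cvg; first exact: continuous_expR.
    by apply: cvgN; apply: cvgMr.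
move: lhs; under eq_fun do rewrite fE; move=> lhs.
exact: (cvg_unique _ lhs rhs).
Qed.

End poisson_void.

Lemma sigma_algebra_setT T (G : set (set T)) : <<s G >> setT.
Proof.
have [h0 hC _] := smallest_sigma_algebra setT G.
by rewrite -[X in _ X](setD0 setT); exact: hC.
Qed.

(** * Germ-grain models as marked processes *)

Section marks.
Context {R : realType} {d : nat}.
Implicit Types K : set 'rV[R]_d.

Definition convex_body K : Prop :=
  [/\ K !=set0, compact K & @convex_set R 'rV[R]_d K].

(** [hit_sigma] separates convex bodies, but neither the set of all convex
    bodies nor that of all compact sets belongs to it; identifying sets that
    contain the same convex bodies makes it measurable. *)
Definition mark_events : set (set (set 'rV[R]_d)) :=
  [set S | exists2 H, hit_sigma H & forall K, convex_body K -> (S K <-> H K)].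

Lemma sigma_algebra_mark_events : sigma_algebra setT mark_events.
Proof.
have HT : forall H : set (set 'rV[R]_d), hit_sigma H -> hit_sigma (~` H).
  by move=> H; apply: sigma_algebraC.
split.
- by exists set0 => //; exact: sigma_algebra0.
- move=> A [H hH AH]; exists (~` H); first exact: HT.
  move=> K gK; have [h1 h2] := AH K gK; split => [[_ nA] /h2//|nH].
  by split => // /h1.
- move=> A hA.
  have /choice[H hH] : forall n, exists H, hit_sigma H /\
      forall K, convex_body K -> (A n K <-> H K).
    by move=> n; have [H ? ?] := hA n; exists H.
  exists (\bigcup_n H n).
    by apply: sigma_algebra_bigcup => n; have [] := hH n.
  move=> K gK; split => -[n _ hn]; exists n => //; by apply/((hH n).2 K gK).
Qed.

End marks.

Notation marks R d := (g_sigma_algebraType (@mark_events R d)).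

Section marks_measurable.
Context {R : realType} {d : nat}.

Lemma marks_measurableE (S : set (marks R d)) : measurable S -> mark_events S.
Proof.
by rewrite /measurable/= (sigma_algebra_id sigma_algebra_mark_events).
Qed.

Lemma hit_sigma_measurable (H : set (marks R d)) : hit_sigma H -> measurable H.
Proof. by move=> hH; apply: sub_sigma_algebra; exists H. Qed.

Lemma convex_body_measurable : measurable ([set K | convex_body K] : set (marks R d)).
Proof.
apply: sub_sigma_algebra; exists setT.
  exact: sigma_algebra_setT.
by move=> K gK; split.
Qed.

Lemma measurable_random_convex_body d1 (T : measurableType d1)
    (P : probability T R) (X : T -> set 'rV[R]_d) :
  random_convex_body X -> measurable_fun setT (X : T -> marks R d).
Proof.
move=> [bX mX] _ S /marks_measurableE[H hH SH]; rewrite setTI.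
rewrite (_ : X @^-1` S = X @^-1` H); first exact: mX.
by apply/seteqP; split => w /=; apply (SH _ (bX w)).
Qed.

End marks_measurable.

Section marked_process.
Context {R : realType} {d : nat}.
Context {d0 : measure_display} {T0 : measurableType d0} (P0 : probability T0 R).
Variable X0 : T0 -> set 'rV[R]_d.
Hypothesis X0_body : random_convex_body X0.
Context {d1 : measure_display} {T : measurableType d1} (P : probability T R).
Variables (L : {RV P >-> R}) (N : nat -> T -> option 'rV[R]_d)
  (X : nat -> T -> set 'rV[R]_d).
Hypothesis model : mixed_poisson_germ_grain P0 X0 L N X.

Local Notation vol := (volume_measure R d).
Local Notation G := [set E | (exists2 I, measurable I & E = L @^-1` I) \/
               (exists n A, borel A /\ E = point_in N n A)].
Local Notation TG := (g_sigma_algebraType G).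
Local Notation pairs := (borel_rV R d * marks R d)%type.

Definition mark_law : probability (marks R d) R :=
  distribution P0 (to_mfun (measurable_random_convex_body P0 X0_body)).

Let LN : mixed_poisson_process L N. Proof. by case: model. Qed.

Let measurable_mark n : measurable_fun setT (X n : T -> marks R d).
Proof.
by apply: (measurable_random_convex_body P); case: model => _ [].
Qed.

Let ground_sub : G `<=` (measurable : set (set T)).
Proof.
move=> E [[I mI ->]|[n [A [bA ->]]]]; last exact: (measurable_point_in LN).
by rewrite -[X in measurable X]setTI; apply: measurable_funPT.
Qed.

Let marks_independent (E : set TG) M (H : nat -> set (marks R d)) :
  measurable E -> (forall i, measurable (H i)) ->
  (P (E `&` \bigcap_(i < M) X i @^-1` H i) = P E * \prod_(i < M) mark_law (H i))%E.
Proof.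
move=> mE mH; have [_ [bX indep]] := model.
have /choice[H' hH'] : forall i, exists H', hit_sigma H' /\
    forall K, convex_body K -> (H i K <-> H' K).
  by move=> i; have [H' ? ?] := marks_measurableE (mH i); exists H'.
have := indep E M H' mE (fun i => (hH' i).1).
rewrite (_ : \bigcap_(i < M) X i @^-1` H i = \bigcap_(i < M) X i @^-1` H' i).
  move=> ->; congr (_ * _)%E; apply: eq_bigr => i _.
  rewrite /mark_law/= /distribution/= /pushforward; congr (P0 _).
  by apply/seteqP; split => w /=; apply ((hH' i).2 _ (X0_body.1 w)).
by apply: eq_bigcapr => i _; apply/seteqP; split => w /=;
  apply ((hH' i).2 _ ((bX i).1 w)).
Qed.


Definition marked_in n (D : set pairs) : set T :=
  [set w | exists2 x, N n w = Some x & D (x, X n w)].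

Let ground_marked n (D : set pairs) : set (TG * marks R d) :=
  [set z | exists2 x, N n z.1 = Some x & D (x, z.2)].

Let measurable_ground_marked n D :
  measurable D -> measurable (ground_marked n D).
Proof.
have mT : measurable (ground_marked n setT).
  rewrite (_ : ground_marked n setT =
      (point_in N n setT : set TG) `*` (setT : set (marks R d))).
    apply: measurableX => //; apply: sub_sigma_algebra; right.
    by exists n, setT; split => //; exact: sigma_algebra_setT.
  apply/seteqP; split => z /=; first by move=> [x Nx _]; split => //; exists x.
  by move=> [[x _ Nx] _]; exists x.
rewrite measurable_prod_measurableType.
apply: (@smallest_sub _ _ _ [set D | measurable (ground_marked n D)]).
  split => /=.
  - rewrite (_ : ground_marked n set0 = set0)//.
    by apply/seteqP; split => z // [].
  - move=> A mA; rewrite (_ : ground_marked n (setT `\` A) =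
        ground_marked n setT `\` ground_marked n A); first exact: measurableD.
    apply/seteqP; split => z /=.
      move=> [x Nx [_ nA]]; split; first by exists x.
      by move=> [y]; rewrite Nx => -[<-].
    by move=> [[x Nx _] nA]; exists x => //; split => // Ax; apply: nA; exists x.
  - move=> A mA; rewrite (_ : ground_marked n (\bigcup_i A i) =
        \bigcup_i ground_marked n (A i)); first exact: bigcupT_measurable.
    apply/seteqP; split => z /=.
      by move=> [x Nx [i _ Ai]]; exists i => //; exists x.
    by move=> [i _ [x Nx Ai]]; exists x => //; exists i.
move=> _ [A mA [B mB <-]] /=.
rewrite (_ : ground_marked n (A `*` B) = (point_in N n A : set TG) `*` B).
  by apply: measurableX => //; apply: sub_sigma_algebra; right; exists n, A.
apply/seteqP; split => z /=; first by move=> [x Nx [Ax Bz]]; split => //; exists x.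
by move=> [[x Ax Nx] Bz]; exists x.
Qed.

Let measurable_ground_oapp n (q : pairs -> R) : measurable_fun setT q ->
  measurable_fun setT
    (fun z : TG * marks R d => oapp (fun x => q (x, z.2)) 0 (N n z.1)).
Proof.
move=> mq _ Y mY; rewrite setTI.
have mqY : measurable (q @^-1` Y) by rewrite -[X in measurable X]setTI; exact: mq.
rewrite (_ : _ @^-1` Y = ground_marked n (q @^-1` Y) `|`
    (if `[< Y 0 >] then ~` ground_marked n setT else set0)).
  apply: measurableU; first exact: measurable_ground_marked.
  by case: asboolP => // _; apply: measurableC; exact: measurable_ground_marked.
apply/seteqP; split => z /=.
  case E : (N n z.1) => [x|]/= Yq; first by left; exists x.
  by right; case: asboolP => //= _ [x]; rewrite E.
case=> [[x -> //]|]; case: asboolP => //= Y0.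
by case E : (N n z.1) => [x|//] h; case: h; exists x.
Qed.

Let measurable_ground_mark n :
  measurable_fun setT ((fun w => (w, X n w)) : T -> (TG * marks R d)%type).
Proof.
apply: (@measurable_fun_pair _ _ _ T TG (marks R d) (fun w => w) (X n)); last first.
  exact: measurable_mark.
move=> _ A mA; rewrite setTI; apply: smallest_sub mA => //.
exact: sigma_algebra_measurable.
Qed.

Lemma measurable_marked_oapp n (q : pairs -> R) : measurable_fun setT q ->
  measurable_fun setT (fun w => oapp (fun x => q (x, X n w)) 0 (N n w)).
Proof.
move=> mq.
exact: (measurableT_comp (measurable_ground_oapp n mq) (@measurable_ground_mark n)).
Qed.

Lemma measurable_marked_in n (D : set pairs) :
  measurable D -> measurable (marked_in n D).
Proof.
move=> mD; have := @measurable_ground_mark n measurableT _ (measurable_ground_marked n mD).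
by rewrite setTI.
Qed.

Definition marked_void_functional (q : pairs -> R) (w : T) : R :=
  infinite_prod (fun n => 1 - oapp (fun x => q (x, X n w)) 0 (N n w)).

(** The marking theorem. In a product over finitely many points the marks are integrated out, which
    replaces [q] by its mean [qb] over the law of the grain; letting the number of points grow leads
    to the unmarked functional of [qb], whose volume integral is that of [q] by Tonelli. *)
Lemma marked_poisson_void_functional (q : pairs -> R) :
  measurable_fun setT q -> (forall z, 0 <= q z <= 1) ->
  (\int[vol \x mark_law]_z (q z)%:E < +oo)%E ->
  (\int[P]_w (marked_void_functional q w)%:E =
   \int[P]_w (expR (- (L w * fine (\int[vol \x mark_law]_z (q z)%:E)%E)))%:E)%E.
Proof.
move=> mq q01.
have mEq : measurable_fun setT (EFin \o q) by exact/measurable_EFinP.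
have law1 : mark_law setT = 1%E by exact: probability_setT.
have int1 : (\int[mark_law]_k 1%:E = 1)%E.
  by rewrite -[RHS]law1 -[RHS]mul1e -integral_cst.
have q0 z : (0 <= (q z)%:E)%E by rewrite lee_fin; have /andP[] := q01 z.
rewrite fubini_tonelli1//; set qb := fubini_F _ _ => intq.
have qb01 x : (0 <= qb x <= 1)%E.
  rewrite /qb /fubini_F integral_ge0//=.
  rewrite -int1.
  apply: ge0_le_integral => //.
  - exact: (measurableT_comp mEq (measurable_pair1 _)).
  - by move=> k _; rewrite lee_fin; have /andP[] := q01 (x, k).
have qbE x : qb x = (fine (qb x))%:E.
  rewrite fineK// ge0_fin_numE; have /andP[a b] := qb01 x; first exact: le_lt_trans b (ltry _).
  by [].
have mqb : measurable_fun setT qb by exact: measurable_fun_fubini_tonelli_F.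
have intqE : (\int[vol]_x qb x = \int[vol]_x ((fine \o qb) x)%:E)%E.
  by apply: eq_integral => x _; exact: qbE.
have qb01' x : 0 <= (fine \o qb) x <= 1.
  by rewrite -!lee_fin /= -qbE.
have mfqb : measurable_fun setT (fine \o qb) by exact: measurableT_comp.
have qn01 n w : 0 <= 1 - oapp (fun x => q (x, X n w)) 0 (N n w) <= 1.
  exact: (@oapp01 _ _ (fun x => q (x, X n w))).
rewrite intqE -(poisson_void_functional LN mfqb qb01'); last by rewrite -intqE.
have lhs : (\int[P]_w (\prod_(n < M)
    (1 - oapp (fun x => q (x, X n w)) 0 (N n w)))%:E @[M --> \oo] -->
    \int[P]_w (marked_void_functional q w)%:E)%E.
  have mM M : measurable_fun setT (fun w => \prod_(n < M)
      (1 - oapp (fun x => q (x, X n w)) 0 (N n w))).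
    apply: measurable_prod => n _; apply: measurable_funB => //.
    exact: measurable_marked_oapp.
  have cM w : \prod_(n < M) (1 - oapp (fun x => q (x, X n w)) 0 (N n w))
      @[M --> \oo] --> marked_void_functional q w by exact: cvg_infinite_prod.
  apply: bounded_convergence => //.
  - exact: (measurable_fun_cvg mM (fun w _ => cM w)).
  - by move=> M w; exact: (prod_le1 M (fun n => qn01 n w)).
have rhs : (\int[P]_w (\prod_(n < M)
    (1 - oapp (fine \o qb) 0 (N n w)))%:E @[M --> \oo] -->
    \int[P]_w (void_functional N (fine \o qb) w)%:E)%E.
  apply: bounded_convergence => //.
  - move=> M; apply: measurable_prod => n _; apply: measurable_funB => //.
    exact: (measurable_oapp_point LN).
  - exact: (measurable_void_functional LN).
  - by move=> M w; exact: (prod_le1 M (fun n => oapp01 qb01' (N n w))).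
  - by move=> w; exact: (cvg_infinite_prod (fun n => oapp01 qb01' (N n w))).
suff E M : (\int[P]_w (\prod_(n < M)
      (1 - oapp (fun x => q (x, X n w)) 0 (N n w)))%:E =
    \int[P]_w (\prod_(n < M) (1 - oapp (fine \o qb) 0 (N n w)))%:E)%E.
  by move: lhs; under eq_fun do rewrite E; move=> lhs; exact: (cvg_unique _ lhs rhs).
have := @integral_marked_prod _ _ T (marks R d) R P mark_law G X ground_sub
  measurable_mark marks_independent M
  (fun n (z : TG * marks R d) => 1 - oapp (fun x => q (x, z.2)) 0 (N n z.1))
  (fun n w => 1 - oapp (fine \o qb) 0 (N n w)) (cst 1).
under eq_integral do rewrite mul1r; move=> h.
under [RHS]eq_integral do rewrite -[X in X%:E]mul1r; apply: h => //.
- move=> n; apply: measurable_funB => //; exact: measurable_ground_oapp.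
- by move=> n z; have /andP[] := @oapp01 _ _ (fun x => q (x, z.2)) (fun x => q01 _) (N n z.1).
- move=> n w; case: (N n w) => [x|] /=; last first.
    by rewrite subr0 -int1; apply: eq_integral => k _.
  under eq_integral do rewrite EFinB.
  have icst : mark_law.-integrable setT (cst 1%E) by exact: finite_measure_integrable_cst.
  rewrite integralB//=; last first.
    apply: (le_integrable measurableT _ _ icst).
    + exact: (measurableT_comp mEq (measurable_pair1 _)).
    + by move=> k _ /=; rewrite lee_fin; have /andP[a b] := q01 (x, k); rewrite !ger0_norm.
  by rewrite [X in _ = (X - _)%E]int1 EFinB -qbE.
Qed.

End marked_process.

Lemma infinite_prod_le_factor (R : realType) (u : nat -> R) n :
  (forall n, 0 <= u n <= 1) -> infinite_prod u <= u n.
Proof.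
move=> u01; apply: le_trans (infinite_prod_le n.+1 u01) _.
rewrite big_ord_recr/= ler_piMl//; first by have /andP[] := u01 n.
by have /andP[] := prod_le1 n u01.
Qed.

Lemma infinite_prod_le_factors (R : realType) (u : nat -> R) m n :
  (forall n, 0 <= u n <= 1) -> (m < n)%N -> infinite_prod u <= u m * u n.
Proof.
move=> u01 mn; apply: le_trans (infinite_prod_le n.+1 u01) _.
rewrite big_ord_recr/= ler_wpM2r//; first by have /andP[] := u01 n.
rewrite (bigD1 (Ordinal mn))//= ler_piMr//; first by have /andP[] := u01 m.
suff /andP[] : 0 <= \prod_(i < n | i != Ordinal mn) u i <= 1 by [].
elim/big_ind: _ => [|x y /andP[x0 x1] /andP[y0 y1]|i _]; last exact: u01.
  by rewrite ler01 lexx.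
by rewrite mulr_ge0//= mulr_ile1.
Qed.

(** * Probabilities of no reached point and of a single one *)

Section point_events.
Context {R : realType} {d : nat}.
Context {d0 : measure_display} {T0 : measurableType d0} (P0 : probability T0 R).
Variable X0 : T0 -> set 'rV[R]_d.
Hypothesis X0_body : random_convex_body X0.
Context {d1 : measure_display} {T : measurableType d1} (P : probability T R).
Variables (L : {RV P >-> R}) (N : nat -> T -> option 'rV[R]_d)
  (X : nat -> T -> set 'rV[R]_d).
Hypothesis model : mixed_poisson_germ_grain P0 X0 L N X.

Local Notation nu := (volume_measure R d \x mark_law P0 X0_body)%E.
Local Notation pairs := (borel_rV R d * marks R d)%type.

Definition no_point (D : set pairs) : set T :=
  [set w | forall n, ~ marked_in N X n D w].

Definition single_point (D1 D : set pairs) : set T :=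
  [set w | exists n, marked_in N X n D1 w /\
                     forall m, m != n -> ~ marked_in N X m D w].

Variables D1 D : set pairs.
Hypotheses (mD1 : measurable D1) (mD : measurable D) (D1D : D1 `<=` D)
  (Dfin : (nu D < +oo)%E).

Let mM n (A : set pairs) : measurable A -> measurable (marked_in N X n A).
Proof. exact: measurable_marked_in model _ _. Qed.

Lemma measurable_no_point : measurable (no_point D).
Proof.
rewrite (_ : no_point D = \bigcap_n ~` marked_in N X n D).
  by apply: bigcapT_measurable => n; apply: measurableC; exact: mM.
by apply/seteqP; split => w /= h; [move=> n _|move=> n]; exact: h.
Qed.

Lemma measurable_single_point : measurable (single_point D1 D).
Proof.
rewrite (_ : single_point D1 D = \bigcup_n (marked_in N X n D1 `&`
    \bigcap_m (if m == n then setT else ~` marked_in N X m D))).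
  apply: bigcupT_measurable => n; apply: measurableI; first exact: mM.
  apply: bigcapT_measurable => m; case: ifP => // _.
  by apply: measurableC; exact: mM.
apply/seteqP; split => w /=.
  move=> [n [nD1 nD]]; exists n => //; split => // m _.
  by case: eqVneq => [//|mn]; exact: nD.
move=> [n _ [nD1 nD]]; exists n; split => // m mn.
by have := nD m I; rewrite (negbTE mn).
Qed.

(** The factor [1 - q a] is [a] on [D1], 0 on the rest of [D] and 1 elsewhere. Hence the functional
    picks out configurations whose points in [D] all lie in [D1], weighted by [a] to their number,
    and its term of first order in [a] belongs to [single_point D1 D]. *)
Let q (a : R) (z : pairs) : R := \1_D z - a * \1_D1 z.

Let qE a z : q a z = if z \in D1 then 1 - a else (z \in D)%:R.
Proof.
rewrite /q !indicE; case: ifPn => [zD1|_]; last by rewrite mulr0 subr0.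
by rewrite mulr1 mem_set//; apply: D1D; exact: set_mem.
Qed.

Let q01 a : 0 <= a <= 1 -> forall z, 0 <= q a z <= 1.
Proof.
by move=> a01 z; rewrite qE; case: ifP => _; [lra|case: (z \in D); rewrite /= ?ler01 lexx].
Qed.

Let mq a : measurable_fun setT (q a).
Proof.
apply: measurable_funB; first exact: measurable_indic.
by apply: measurable_funM => //; exact: measurable_indic.
Qed.

Let D1fin : (nu D1 < +oo)%E.
Proof. by apply: le_lt_trans Dfin; apply: le_measure; rewrite ?inE. Qed.

Let int_q a : 0 <= a <= 1 -> (\int[nu]_z (q a z)%:E)%E =
  (fine (nu D) - a * fine (nu D1))%:E.
Proof.
move=> a01.
have iind (A : set pairs) : measurable A -> (nu A < +oo)%E ->
    nu.-integrable setT (EFin \o \1_A).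
  move=> mA Afin; apply/integrableP; split; first exact/measurable_EFinP.
  rewrite (eq_integral (fun z => (\1_A z)%:E)) ?integral_indic ?setIT//.
  by move=> z _; rewrite /= ger0_norm.
under eq_integral do rewrite EFinB EFinM.
rewrite integralB//=; last 2 first.
- exact: iind.
- by apply: integrableZl => //; exact: iind.
rewrite integralZl//; last exact: iind.
by rewrite !integral_indic// !setIT EFinB EFinM !fineK// ge0_fin_numE.
Qed.

Let factor a n w : 0 <= a <= 1 ->
  0 <= 1 - oapp (fun x => q a (x, X n w)) 0 (N n w) <= 1.
Proof. by move=> a01; apply: (@oapp01 _ _ (fun x => q a (x, X n w))) => x; exact: q01. Qed.

Let factor_le a n w : 0 <= a <= 1 -> marked_in N X n D w ->
  1 - oapp (fun x => q a (x, X n w)) 0 (N n w) <= a.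
Proof.
move=> a01 [x -> /= Dx]; rewrite qE (mem_set Dx).
by case: ifP => _ /=; lra.
Qed.

Let factor_eq0 a n w : 0 <= a <= 1 -> marked_in N X n D w ->
  ~ marked_in N X n D1 w ->
  1 - oapp (fun x => q a (x, X n w)) 0 (N n w) = 0.
Proof.
move=> a01 [x Nx Dx] nD1; rewrite Nx /= qE (mem_set Dx) memNset ?subrr//.
by move=> D1x; apply: nD1; exists x.
Qed.

Let void_int a : 0 <= a <= 1 ->
  (\int[P]_w (marked_void_functional N X (q a) w)%:E =
   \int[P]_w (expR (- (L w * (fine (nu D) - a * fine (nu D1)))))%:E)%E.
Proof.
move=> a01.
by rewrite (marked_poisson_void_functional (X0_body := X0_body) model (mq a) (q01 a01)) int_q// ltry.
Qed.

(** At [a = 0] all factors are 0 or 1, and the functional is the indicator of the event. *)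
Lemma no_point_probability :
  (P (no_point D) = \int[P]_w (expR (- (L w * fine (nu D))))%:E)%E.
Proof.
have z01 : 0 <= (0 : R) <= 1 by rewrite lexx ler01.
have := void_int z01; under [in RHS]eq_integral do rewrite mul0r subr0; move=> <-.
transitivity (\int[P]_w (\1_(no_point D) w)%:E)%E.
  by rewrite integral_indic ?setIT//; exact: measurable_no_point.
apply: eq_integral => w _; congr _%:E; rewrite indicE.
have [/set_mem nD|/negP nD] := boolP (w \in no_point D).
  apply/esym/cvg_lim => //; apply: cvg_near_cst; apply: nearW => M.
  apply/eqP; rewrite big1// => n _.
  case E : (N n w) => [x|]/=; last by rewrite subr0.
  have nDx : ~ D (x, X n w) by move=> Dx; apply: (nD n); exists x.
  rewrite qE memNset; last by move=> /D1D.
  by rewrite memNset// subr0.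
apply/esym/eqP; rewrite eq_le infinite_prod_ge0 ?andbT; last by move=> n; exact: factor.
have [n nDn] : exists n, marked_in N X n D w.
  apply: contrapT => h; apply: nD; apply/mem_set => n nDn; apply: h; by exists n.
apply: le_trans (infinite_prod_le_factor n (fun n => factor n w z01)) _.
exact: factor_le.
Qed.

(** Two points in [D] already contribute two factors of size at most [a], and a point in [D] outside
    [D1] contributes a factor 0. *)
Let void_le a w : 0 <= a <= 1 -> marked_void_functional N X (q a) w <=
  \1_(no_point D) w + a * \1_(single_point D1 D) w + a ^+ 2.
Proof.
move=> a01; have u01 n := factor n w a01; have a0 : 0 <= a by case/andP: a01.
have i0 (A : set T) : 0 <= \1_A w :> R by rewrite indicE; case: (w \in A).
have a20 : 0 <= a ^+ 2 by rewrite exprn_ge0.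
have [nD|/existsNP[n /contrapT nD]] := pselect (no_point D w).
  rewrite [X in X + _ + _]indicE mem_set// -addrA ler_wpDr ?addr_ge0 ?mulr_ge0//.
  by apply: le_trans (infinite_prod_le 0 u01) _; rewrite big_ord0.
rewrite (@le_trans _ _ (a * \1_(single_point D1 D) w + a ^+ 2))//; last first.
  by rewrite -addrA lerDr.
have [sD|nsD] := pselect (single_point D1 D w).
  rewrite indicE mem_set// mulr1 ler_wpDr//.
  apply: le_trans (infinite_prod_le_factor n u01) _; exact: factor_le.
rewrite indicE memNset// mulr0 add0r.
have [nD1|nnD1] := pselect (marked_in N X n D1 w); last first.
  apply: le_trans (infinite_prod_le_factor n u01) _.
  by rewrite factor_eq0.
have [m [mn mD']] : exists m, m != n /\ marked_in N X m D w.
  apply: contrapT => h; apply: nsD; exists n; split => // m mn mDw.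
  by apply: h; exists m.
have [lt_mn|lt_nm|eq_mn] := ltngtP m n; last by rewrite eq_mn eqxx in mn.
  apply: le_trans (infinite_prod_le_factors u01 lt_mn) _.
  by rewrite expr2 ler_pM ?factor_le//; have /andP[] := u01 m; have /andP[] := u01 n.
apply: le_trans (infinite_prod_le_factors u01 lt_nm) _.
by rewrite expr2 ler_pM ?factor_le//; have /andP[] := u01 m; have /andP[] := u01 n.
Qed.

(** The mean of the functional of [q a] is known exactly. By convexity of the exponential it exceeds
    the void probability by at least [a] times the left-hand side, while [void_le] bounds it by the
    void probability plus [a] times the right-hand side plus [a ^+ 2]. It remains to divide by [a]
    and let [a] tend to 0. *)
Lemma single_point_probability :
  (\int[P]_w (L w * fine (nu D1) * expR (- (L w * fine (nu D))))%:E <=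
   P (single_point D1 D))%E.
Proof.
have L0 w : 0 <= L w by case: model => -[].
set v1 := fine (nu D1); set v := fine (nu D).
have v10 : 0 <= v1 by exact: fine_ge0.
have v0 : 0 <= v by exact: fine_ge0.
have v1v : v1 <= v.
  rewrite /v1 /v fine_le ?ge0_fin_numE//.
  by apply: le_measure; rewrite ?inE.
pose F w := L w * v1 * expR (- (L w * v)).
have mLv (x : R) : measurable_fun setT (fun w => L w * x) by exact: measurable_funM.
have mexp (x : R) : measurable_fun setT (fun w => expR (- (L w * x))).
  by apply: measurableT_comp => //; exact: measurableT_comp.
have mF : measurable_fun setT F by exact: measurable_funM.
have mn := measurable_no_point; have ms := measurable_single_point.
suff h (a : R) : 0 < a -> a <= 1 ->
    (\int[P]_w (F w)%:E <= P (single_point D1 D) + a%:E)%E.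
  apply/lee_addgt0Pr => e e0.
  have m0 : 0 < Num.min e 1 by rewrite lt_min e0 ltr01.
  apply: le_trans (h _ m0 _) _; first by rewrite ge_min lexx orbT.
  by rewrite leeD2l// lee_fin ge_min lexx.
move=> a0 a1; have a0' : 0 <= a by exact: ltW.
have a01 : 0 <= a <= 1 by rewrite a0'.
have step : (\int[P]_w (marked_void_functional N X (q a) w)%:E <=
    P (no_point D) + a%:E * P (single_point D1 D) + (a ^+ 2)%:E)%E.
  apply: (@le_trans _ _ (\int[P]_w ((\1_(no_point D) w)%:E +
      a%:E * (\1_(single_point D1 D) w)%:E + (a ^+ 2)%:E))%E).
    apply: ge0_le_integral => //.
    + move=> w _; rewrite lee_fin infinite_prod_ge0// => n; exact: factor.
    + apply/measurable_EFinP; apply: (measurable_fun_cvg (h := fun M w =>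
        \prod_(n < M) (1 - oapp (fun x => q a (x, X n w)) 0 (N n w)))).
        move=> M; apply: measurable_prod => n _; apply: measurable_funB => //.
        exact: (measurable_marked_oapp model).
      by move=> w _; apply: cvg_infinite_prod => n; exact: factor.
    + apply/measurable_EFinP; apply: measurable_funD => //.
      apply: measurable_funD; first exact: measurable_indic.
      by apply: measurable_funM => //; exact: measurable_indic.
    + by move=> w _; rewrite -EFinM -!EFinD lee_fin void_le.
  have ge01 (A : set T) w : (0 <= (\1_A w)%:E :> \bar R)%E.
    by rewrite lee_fin indicE; case: (w \in A).
  rewrite ge0_integralD//; last 3 first.
  - by move=> w _; rewrite adde_ge0// mule_ge0// lee_fin ltW.
  - apply/measurable_EFinP; apply: measurable_funD; first exact: measurable_indic.
    by apply: measurable_funM => //; exact: measurable_indic.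
  - by move=> w _; rewrite lee_fin exprn_ge0// ltW.
  rewrite ge0_integralD//; last 3 first.
  - by apply/measurable_EFinP; exact: measurable_indic.
  - by move=> w _; rewrite mule_ge0// lee_fin ltW.
  - apply/measurable_EFinP.
    by apply: measurable_funM => //; exact: measurable_indic.
  rewrite ge0_integralZl_EFin//; last first.
    by apply/measurable_EFinP; exact: measurable_indic.
  have Ia : (\int[P]_w (a ^+ 2)%:E = (a ^+ 2)%:E)%E.
    rewrite integral_cst// -[RHS]mule1; congr (_ * _)%E.
    exact: probability_setT.
  by rewrite !integral_indic// !setIT Ia.
rewrite void_int// no_point_probability in step.
have F0 w : 0 <= F w by rewrite !mulr_ge0// expR_ge0.
(* The tangent inequality [1 + x <= expR x] at [x = a * (L w * v1)]. *)
have conv : (\int[P]_w (expR (- (L w * v)))%:E + a%:E * \int[P]_w (F w)%:E <=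
    \int[P]_w (expR (- (L w * (v - a * v1))))%:E)%E.
  rewrite -ge0_integralZl_EFin//; last 2 first.
  - by move=> w _; rewrite lee_fin.
  - exact/measurable_EFinP.
  rewrite -ge0_integralD//; last 3 first.
  - exact/measurable_EFinP.
  - by move=> w _; rewrite mule_ge0 ?lee_fin// ltW.
  - by apply/measurable_EFinP; exact: measurable_funM.
  apply: ge0_le_integral => //.
  - by move=> w _; rewrite adde_ge0 ?mule_ge0 ?lee_fin ?expR_ge0.
  - apply/measurable_EFinP; apply: measurable_funD => //; exact: measurable_funM.
  - exact/measurable_EFinP.
  - move=> w _; rewrite -EFinM -EFinD lee_fin /F.
    have -> : - (L w * (v - a * v1)) = - (L w * v) + a * (L w * v1) by ring.
    rewrite expRD [X in _ + X](_ : _ = expR (- (L w * v)) * (a * (L w * v1))).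
      by rewrite -[X in X + _]mulr1 -mulrDr ler_wpM2l ?expR_ge0// expR_ge1Dx.
    by ring.
have : (\int[P]_w (expR (- (L w * v)))%:E + a%:E * \int[P]_w (F w)%:E <=
    \int[P]_w (expR (- (L w * v)))%:E +
    (a%:E * P (single_point D1 D) + (a ^+ 2)%:E))%E.
  by rewrite addeA; exact: le_trans conv step.
(* The void probability is finite and cancels; what remains is divisible by [a]. *)
rewrite leeD2lE; last first.
  rewrite ge0_fin_numE; last by apply: integral_ge0 => w _; rewrite lee_fin expR_ge0.
  rewrite -no_point_probability; apply: le_lt_trans (probability_le1 P mn) _.
  exact: ltry.
have -> : (a%:E * P (single_point D1 D) + (a ^+ 2)%:E =
    a%:E * (P (single_point D1 D) + a%:E))%E.
  by rewrite muleDr ?fin_num_adde_defl// -EFinM expr2.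
by rewrite lee_pmul2l// lte_fin.
Qed.

End point_events.

Lemma scaling_continuous (R : realType) (V : normedModType R) :
  continuous (fun p : R * V => p.1 *: p.2).
Proof. by move=> p; apply: cvgZ; [exact: cvg_fst|exact: cvg_snd]. Qed.

(** * Measurability of distances and contact directions *)

Section gauge_distance.
Context {R : realType} {V : normedModType R}.
Implicit Types (A K : set V) (t s : R).

(** As [A] need not be star-shaped, [gauge_dist A K <= t] means that [K] meets
    [star_hull A t], not that it meets [t A]. *)
Definition gauge_dist A K : \bar R :=
  ereal_inf [set t%:E | t in [set t | 0 <= t /\ exists2 b, A b & K (t *: b)]].

Definition star_hull A t : set V :=
  [set z | exists s b, [/\ 0 <= s, s <= t, A b & z = s *: b]].

Lemma gauge_dist_ge0 A K : (0 <= gauge_dist A K)%E.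
Proof. by apply: le_ereal_inf_tmp => _ [t [t0 _] <-]; rewrite lee_fin. Qed.

Lemma gauge_dist_le A K t b : 0 <= t -> A b -> K (t *: b) ->
  (gauge_dist A K <= t%:E)%E.
Proof. by move=> t0 Ab Kb; apply: ereal_inf_lbound; exists t => //; split => //; exists b. Qed.

Lemma scale_compact A t : compact A -> compact (star_hull A t).
Proof.
move=> cA.
rewrite (_ : star_hull A t = (fun p : R * V => p.1 *: p.2) @` (`[0, t] `*` A)).
  apply: continuous_compact; last by apply: compact_setX => //; exact: segment_compact.
  apply: continuous_subspaceT => p; exact: scaling_continuous.
apply/seteqP; split => z /=.
  by move=> [s [b [s0 st Ab ->]]]; exists (s, b) => //; split; rewrite //= in_itv/= s0.
move=> [[s b] [/= + Ab] <-]; rewrite in_itv/= => /andP[s0 st].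
by exists s, b.
Qed.

(** The admissible [t] up to a given one form a projection of a closed part of the compact set
    [[0, t0] x A]; so they are compact and have a least element. *)
Lemma gauge_dist_attained A K : compact A -> compact K ->
  (gauge_dist A K < +oo)%E ->
  exists2 b, A b & K (fine (gauge_dist A K) *: b).
Proof.
move=> cA cK; set S := [set t | 0 <= t /\ exists2 b, A b & K (t *: b)] => Afin.
have [_ [t0 St0 _] _] := ereal_inf_lt Afin.
have cS : compact (S `&` `[0, t0]).
  rewrite (_ : S `&` `[0, t0] =
    fst @` ((`[0, t0] `*` A) `&` (fun p : R * V => p.1 *: p.2) @^-1` K)).
    apply: continuous_compact.
      by apply: continuous_subspaceT => p; exact: cvg_fst.
    apply: compact_closedI.
      by apply: compact_setX => //; exact: segment_compact.
    apply: preimage_closed; first by move=> p _; exact: scaling_continuous.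
    by apply: compact_closed => //; exact: norm_hausdorff.
  apply/seteqP; split => t /=.
    by move=> [[t0' [b Ab Kb]] tt0]; exists (t, b).
  move=> [[s b] [[/= st0 Ab] Kb] <-]; split => //; split; last by exists b.
  by move: st0; rewrite in_itv/= => /andP[].
have [m [Sm mt0] mmin] : exists2 m, (S `&` `[0, t0]) m &
    forall t, (S `&` `[0, t0]) t -> m <= t.
  have S0 : S `&` `[0, t0] !=set0.
    by exists t0; split => //=; rewrite in_itv/= lexx andbT; case: St0.
  have [|m /set_mem mS mm] := @compact_EVT_min R R id _ S0 cS.
    by apply: continuous_subspaceT => x; exact: cvg_id.
  by exists m => // t /mem_set /mm.
have -> : gauge_dist A K = m%:E.
  apply/eqP; rewrite eq_le; apply/andP; split.
    by apply: ereal_inf_lbound; exists m.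
  apply: le_ereal_inf_tmp => _ [t St <-]; rewrite lee_fin.
  have [tt0|t0t] := leP t t0.
    by apply: mmin; split => //=; rewrite in_itv/= tt0 andbT; case: St.
  move: mt0; rewrite /= in_itv/= => /andP[_ mt0].
  exact: le_trans mt0 (ltW t0t).
by case: Sm.
Qed.

(** This turns a distance event into the hit event of a compact set, for which measurability is
    available. *)
Lemma gauge_dist_leP A K t : compact A -> compact K -> 0 <= t ->
  (gauge_dist A K <= t%:E)%E <-> K `&` star_hull A t !=set0.
Proof.
move=> cA cK t0; split.
  move=> le_t; have [b Ab Kb] := gauge_dist_attained cA cK (le_lt_trans le_t (ltry t)).
  have fin : gauge_dist A K \is a fin_num.
    by rewrite ge0_fin_numE ?gauge_dist_ge0// (le_lt_trans le_t)// ltry.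
  exists (fine (gauge_dist A K) *: b); split => //.
  exists (fine (gauge_dist A K)), b; split => //.
    by apply: fine_ge0; exact: gauge_dist_ge0.
  by rewrite -lee_fin fineK.
move=> [z [Kz [s [b [s0 st Ab zE]]]]]; apply: (@le_trans _ _ s%:E); last by rewrite lee_fin.
by apply: (gauge_dist_le s0 Ab); rewrite -zE.
Qed.

End gauge_distance.

Lemma closed_box_closed (R : realType) (d : nat) (p : 'rV[rat]_d * rat) :
  closed (closed_box p : set 'rV[R]_d).
Proof. by apply: compact_closed; [exact: norm_hausdorff|exact: closed_box_compact]. Qed.

Section singleton_random_set.
Context {R : realType} {d : nat} {d1 : measure_display} {S : measurableType d1}.
Variable D : S -> set 'rV[R]_d.
Hypothesis mD : forall C : set 'rV[R]_d, closed C ->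
  measurable [set s | D s `&` C !=set0].

Let singleton : set S := [set s | exists u, D s = [set u]].

(** A nonempty set has two distinct points iff it hits two disjoint closed rational boxes, and there
    are countably many pairs of them. *)
Let measurable_singleton : measurable singleton.
Proof.
pose sep (pq : ('rV[rat]_d * rat) * ('rV[rat]_d * rat)) :=
  closed_box pq.1 `&` closed_box pq.2 = set0 :> set 'rV[R]_d.
rewrite (_ : singleton = [set s | D s `&` setT !=set0] `\`
    \bigcup_pq (if `[< sep pq >] then [set s | D s `&` closed_box pq.1 !=set0] `&`
      [set s | D s `&` closed_box pq.2 !=set0] else set0)).
  apply: measurableD; first by apply: mD; exact: closedT.
  apply: bigcup_countType_measurable => pq; case: ifP => // _.
  by apply: measurableI; apply: mD; exact: closed_box_closed.
apply/seteqP; split => s /=.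
  move=> [u Du]; split; first by exists u; rewrite Du.
  move=> [pq _]; case: asboolP => // pq0 [[x [+ x1]] [y [+ y2]]].
  rewrite Du => xu yu; have : sep pq by [].
  by rewrite /sep -subset0 => /(_ u); apply; split; [rewrite -xu|rewrite -yu].
move=> [[u [Du _]] nD]; exists u; apply/seteqP; split => [v Dv|_ ->//].
apply: contrapT => /eqP vu.
have uv0 : 0 < `|v - u| / 2 by rewrite divr_gt0// normr_gt0 subr_eq0.
have [p [/open_box_closed_box pv pb]] := rational_box_basis_small v uv0.
have [p' [/open_box_closed_box pu pb']] := rational_box_basis_small u uv0.
apply: nD; exists (p, p') => //; rewrite asboolT; first by split; [exists v|exists u].
rewrite /sep -subset0 => z [/pb + /pb'] /=; rewrite -!ball_normE/= => vz uz.
have := ler_normD (v - z) (z - u); rewrite addrA subrK (distrC z).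
move=> h; have := le_lt_trans h (ltrD vz uz); rewrite -splitr ltxx//.
Qed.

(** The sets [C] with this property form a sigma-algebra; for open [C] the event says that the
    singleton misses the closed complement. *)
Lemma measurable_singleton_in (C : set (borel_rV R d)) : measurable C ->
  measurable [set s | exists2 u, D s = [set u] & C u].
Proof.
apply: (@smallest_sub _ _ _ [set C | measurable [set s | exists2 u, D s = [set u] & C u]]).
  split => /=.
  - by rewrite (_ : [set _ | _] = set0)//; apply/seteqP; split => s // [].
  - move=> A mA; rewrite (_ : [set _ | _] = singleton `\`
        [set s | exists2 u, D s = [set u] & A u]); first exact: measurableD.
    apply/seteqP; split => s /=.
      move=> [u Du [_ nAu]]; split; first by exists u.
      move=> [v Dv Av]; apply: nAu.
      by have /= <- : [set u] v by rewrite -Du Dv.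
    by move=> [[u Du] nA]; exists u => //; split => // Au; apply: nA; exists u.
  - move=> A mA; rewrite (_ : [set _ | _] =
        \bigcup_i [set s | exists2 u, D s = [set u] & A i u]); first exact: bigcupT_measurable.
    apply/seteqP; split => s /=.
      by move=> [u Du [i _ Ai]]; exists i => //; exists u.
    by move=> [i _ [u Du Ai]]; exists u => //; exists i.
move=> U oU /=; rewrite (_ : [set _ | _] = singleton `\`
    [set s | D s `&` ~` U !=set0]).
  by apply: measurableD => //; apply: mD; exact: open_closedC.
apply/seteqP; split => s /=.
  move=> [u Du Uu]; split; first by exists u.
  by rewrite Du => -[v [->]].
move=> [[u Du] nU]; exists u => //; apply: contrapT => nUu; apply: nU.
by exists u; rewrite Du.
Qed.

End singleton_random_set.

Section random_distance.
Context {R : realType} {d : nat} {d1 : measure_display} {S : measurableType d1}.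
Variables (u0 : 'rV[R]_d) (B : set 'rV[R]_d) (K : nat -> S -> set 'rV[R]_d).
Hypotheses (cB : compact B) (cK : forall n s, compact (K n s)).
Hypothesis mK : forall n (A : set 'rV[R]_d), compact A ->
  measurable [set s | K n s `&` A !=set0].

(** The sign comes from the direction of a contact: if the origin reaches the point [t *: b], then
    the direction is [- b]. *)
Definition gauge_part (B C : set 'rV[R]_d) : set 'rV[R]_d :=
  B `&` [set b | C (- b)].

Let part_compact C : closed C -> compact (gauge_part B C).
Proof.
move=> cC; apply: compact_closedI => //.
have cN : continuous (fun b : 'rV[R]_d => (-1) *: b + 0) by exact: affine_continuous.
have /continuous_closedP/(_ _ cC) := cN.
by congr closed; apply/funext => b /=; rewrite scaleN1r addr0.
Qed.

Let tau n C s : \bar R := gauge_dist (gauge_part B C) (K n s).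

Let measurable_tau n C : closed C -> measurable_fun setT (tau n C).
Proof.
move=> cC; apply: (measurability _ (ErealGenOInfty.measurableE R)) => //.
move=> _ [_ [r ->] <-]; rewrite setTI.
rewrite (_ : _ @^-1` _ = ~` [set s | (tau n C s <= r%:E)%E]); last first.
  by apply/seteqP; split => s /=; rewrite in_itv/= andbT ltNge => /negP.
apply: measurableC; have [r0|r0] := leP 0 r; last first.
  rewrite (_ : [set s | _] = set0)//; apply/seteqP; split => // s /= h.
  have := le_trans (gauge_dist_ge0 (gauge_part B C) (K n s)) h.
  by rewrite lee_fin leNgt r0.
rewrite (_ : [set s | _] = [set s | K n s `&` star_hull (gauge_part B C) r !=set0]).
  by apply: mK; apply: scale_compact; exact: part_compact.
by apply/seteqP; split => s /(gauge_dist_leP (part_compact cC) (@cK n s) r0).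
Qed.

Let Z s := \bigcup_n K n s.

Lemma dist_B0E (A : set 'rV[R]_d) : dist_B B 0 A = gauge_dist (gauge_part B setT) A.
Proof.
rewrite /dist_B /gauge_dist; congr ereal_inf; apply/seteqP; split.
  move=> _ [t [t0 [z [[b Bb bz] Az]]] <-]; exists t => //; split => //.
  by exists b => //; rewrite -[_ *: _]add0r bz.
move=> _ [t [t0 [b [Bb _] Ab]] <-]; exists t => //; split => //.
by exists (t *: b); split => //; exists b => //; rewrite add0r.
Qed.

Let dist_bigcup s : dist_B B 0 (Z s) = ereal_inf (range (fun n => tau n setT s)).
Proof.
apply/eqP; rewrite eq_le; apply/andP; split.
  apply: le_ereal_inf_tmp => _ [n _ <-]; rewrite dist_B0E /tau.
  apply: ereal_inf_le_tmp => _ [t [t0 [b Ab Kb]] <-]; exists t => //; split => //.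
  by exists b => //; exists n.
rewrite dist_B0E; apply: le_ereal_inf_tmp => _ [t [t0 [b Ab [n _ Kb]]] <-].
apply: le_trans (gauge_dist_le t0 Ab Kb); apply: ereal_inf_lbound.
by exists n.
Qed.

Lemma measurable_dist_B : measurable_fun setT (fun s => dist_B B 0 (Z s)).
Proof.
rewrite (_ : (fun s => _) = fun s => einfs (fun n => tau n setT s) 0).
  by apply: measurable_fun_einfs => n; apply: measurable_tau; exact: closedT.
apply/funext => s; rewrite dist_bigcup /einfs; congr ereal_inf.
by apply/seteqP; split => _ [n _ <-]; exists n.
Qed.

(** All directions in which a contact occurs; [dir_B] is the only element if there is exactly one,
    and the default otherwise. *)
Definition contact_dirs (A : set 'rV[R]_d) : set 'rV[R]_d :=
  [set u | [/\ (0 < dist_B B 0 A)%E, (dist_B B 0 A < +oo)%E, B (- u) &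
              A (fine (dist_B B 0 A) *: (- u))]].

Lemma dir_B_singleton A u : contact_dirs A = [set u] -> dir_B u0 B A 0 = u.
Proof.
move=> Au; have [d_gt0 d_fin Bu Au'] : contact_dirs A u by rewrite Au.
set t := fine (dist_B B 0 A) in Au' *.
have t0 : 0 < t by rewrite /t fine_gt0// d_gt0.
have cE : contact_set B 0 A = [set t *: - u].
  apply/seteqP; split => z /=; last first.
    move=> ->; split => //; exists (- u) => //; by rewrite add0r.
  move=> [[b Bb <-]]; rewrite add0r -/t => Ab; congr (_ *: _).
  have : contact_dirs A (- b) by split => //; rewrite opprK.
  by rewrite Au /= => <-; rewrite opprK.
rewrite /dir_B asboolT; last by do !split => //; exists (t *: - u).
rewrite cE.
rewrite (@xget_unique _ 0 [set t *: - u] (t *: - u))//.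
by rewrite -/t sub0r -(scalerN t) opprK scalerA mulVf ?gt_eqF// scale1r.
Qed.

Lemma dir_B_default A : ~ (exists u, contact_dirs A = [set u]) ->
  dir_B u0 B A 0 = u0.
Proof.
move=> nA; rewrite /dir_B asboolF// => -[d_gt0 [d_fin [y yE]]]; apply: nA.
set t := fine (dist_B B 0 A) in yE *.
have t0 : 0 < t by rewrite /t fine_gt0// d_gt0.
have yE' z : contact_set B 0 A z <-> z = y by rewrite yE.
exists (- (t^-1 *: y)); apply/seteqP; split => u /=.
  move=> [_ _ Bu Au]; have /yE' <- : contact_set B 0 A (t *: - u).
    by split => //; exists (- u) => //; rewrite add0r.
  by rewrite scalerA mulVf ?gt_eqF// scale1r opprK.
move=> ->; have [[b Bb by_] Ay] := (yE' y).2 erefl.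
have -> : t^-1 *: y = b.
  by rewrite -by_ add0r -/t scalerA mulVf ?gt_eqF// scale1r.
split => //; rewrite opprK// -/t.
by move: by_; rewrite add0r -/t => ->.
Qed.

(** A contact with direction in [C] exists iff restricting the gauge to these directions does not
    increase the distance. The distance is attained in a single compact [K n s], as the union may
    fail to be closed. *)
Let dirs_hit s C : closed C -> contact_dirs (Z s) `&` C !=set0 <->
  [/\ (0 < dist_B B 0 (Z s))%E, (dist_B B 0 (Z s) < +oo)%E &
      exists n, tau n C s = dist_B B 0 (Z s)].
Proof.
move=> cC; split.
  move=> [u [[d_gt0 d_fin Bu [n _ Ku]] Cu]]; split => //; exists n.
  have d0 : 0 <= fine (dist_B B 0 (Z s)) by apply: fine_ge0; exact: ltW.
  have dE : dist_B B 0 (Z s) = (fine (dist_B B 0 (Z s)))%:E.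
    by rewrite fineK// ge0_fin_numE// ltW.
  apply/eqP; rewrite eq_le; apply/andP; split.
    by rewrite dE; apply: (@gauge_dist_le _ _ _ _ _ (- u)) => //; split => //=; rewrite opprK.
  rewrite dist_bigcup; apply: (@le_trans _ _ (tau n setT s)).
    by apply: ereal_inf_lbound; exists n.
  apply: ereal_inf_le_tmp => _ [t [t0 [b [Bb _] Kb]] <-]; exists t => //.
  by split => //; exists b.
move=> [d_gt0 d_fin [n nE]].
have tau_fin : (tau n C s < +oo)%E by rewrite nE.
have [b [Bb Cb] Kb] := gauge_dist_attained (part_compact cC) (@cK n s) tau_fin.
exists (- b); split => //; split; rewrite ?opprK//.
by exists n => //; rewrite -nE.
Qed.

Lemma measurable_dir_B (C : set (borel_rV R d)) : measurable C ->
  measurable [set s | C (dir_B u0 B (Z s) 0)].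
Proof.
move=> mC.
have mD (A : set 'rV[R]_d) : closed A ->
    measurable [set s | contact_dirs (Z s) `&` A !=set0].
  move=> cA; rewrite (_ : [set s | _] =
      [set s | (0 < dist_B B 0 (Z s))%E] `&` [set s | (dist_B B 0 (Z s) < +oo)%E] `&`
      \bigcup_n [set s | tau n A s = dist_B B 0 (Z s)]); last first.
    apply/seteqP; split => s /=.
      by move=> /(dirs_hit s cA)[? ? [n nE]]; split => //; exists n.
    by move=> [[? ?] [n _ nE]]; apply/(dirs_hit s cA); split => //; exists n.
  apply: measurableI; first apply: measurableI.
  - rewrite -[X in measurable X]setTI; apply: emeasurable_fun_o_infty => //.
    exact: measurable_dist_B.
  - rewrite -[X in measurable X]setTI; apply: emeasurable_fun_infty_o => //.
    exact: measurable_dist_B.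
  - apply: bigcupT_measurable => n; rewrite -[X in measurable X]setTI.
    by apply: measurable_eqe => //; [exact: measurable_tau|exact: measurable_dist_B].
rewrite (_ : [set s | _] =
    [set s | exists2 u, contact_dirs (Z s) = [set u] & C u] `|`
    (if `[< C u0 >] then ~` [set s | exists2 u, contact_dirs (Z s) = [set u] & setT u]
     else set0)).
  apply: measurableU; first exact: measurable_singleton_in.
  by case: ifP => // _; apply: measurableC; exact: (measurable_singleton_in mD).
apply/seteqP; split => s /=.
  have [[u Zu]|nZ] := pselect (exists u, contact_dirs (Z s) = [set u]).
    by rewrite (dir_B_singleton Zu) => Cu; left; exists u.
  rewrite dir_B_default// => Cu0; right; rewrite asboolT// => -[u Zu _].
  by apply: nZ; exists u.
move=> [[u Zu Cu]|]; first by rewrite (dir_B_singleton Zu).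
case: asboolP => //= Cu0 nZ; rewrite dir_B_default// => -[u Zu].
by apply: nZ; exists u.
Qed.

End random_distance.

(** * Hit events of translated grains *)

Section translates.
Context {R : realType} {d : nat}.
Implicit Types (K A : set 'rV[R]_d) (x : 'rV[R]_d).
Local Notation pairs := (borel_rV R d * marks R d)%type.

Definition translate K x : set 'rV[R]_d := [set z | exists2 y, K y & z = y + x].

Lemma translate_compact K x : compact K -> compact (translate K x).
Proof.
move=> cK; rewrite (_ : translate K x = (fun y => 1 *: y + x) @` K).
  apply: continuous_compact => //; apply: continuous_subspaceT.
  exact: affine_continuous.
apply/seteqP; split => z /= [y Ky].
  by move=> ->; exists y; rewrite ?scale1r.
by rewrite scale1r => <-; exists y.
Qed.

Let ball_add (x y u v : 'rV[R]_d) (e : R) :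
  ball x (e / 2) u -> ball y (e / 2) v -> ball (y + x) e (v + u).
Proof.
rewrite -!ball_normE/= => xu yv.
rewrite (_ : y + x - (v + u) = (x - u) + (y - v)); last first.
  by rewrite opprD addrACA addrC.
by apply: le_lt_trans (ler_normD _ _) _; rewrite (splitr e) ltrD.
Qed.

(** Rational boxes around the position and around a point of the grain witness the hit of an open
    set; each such witness is a product event. *)
Let measurable_translate_open (O : set 'rV[R]_d) : open O ->
  measurable [set z : pairs | translate z.2 z.1 `&` O !=set0].
Proof.
move=> oO.
pose ok (pq : ('rV[rat]_d * rat) * ('rV[rat]_d * rat)) := forall x y : 'rV[R]_d,
  open_box pq.1 x -> closed_box pq.2 y -> O (y + x).
rewrite (_ : [set z | _] = \bigcup_pq (if `[< ok pq >] then
    (open_box pq.1 : set (borel_rV R d)) `*`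
    ([set K | K `&` closed_box pq.2 !=set0] : set (marks R d)) else set0)).
  apply: bigcup_countType_measurable => pq; case: ifP => // _.
  apply: measurableX.
    by apply: sub_sigma_algebra; exact: open_box_open.
  apply: hit_sigma_measurable; apply: sub_sigma_algebra.
  by exists (closed_box pq.2) => //; exact: closed_box_compact.
apply/seteqP; split => -[x K] /=; last first.
  move=> [pq _]; case: asboolP => // okpq [/= px [y [Ky qy]]].
  by exists (y + x); split; [exists y|exact: okpq].
move=> [_ [[y Ky ->] Oyx]].
have /nbhs_ballP[e /= e0 eO] : nbhs (y + x) O by exact: open_nbhs_nbhs.
have e20 : 0 < e / 2 by rewrite divr_gt0.
have [p [px pb]] := rational_box_basis_small x e20.
have [q [/open_box_closed_box qy qb]] := rational_box_basis_small y e20.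
exists (p, q) => //; rewrite asboolT /=; first by split => //; exists y.
move=> u v /= /open_box_closed_box /pb xu /qb yv; apply: eO.
exact: ball_add.
Qed.

(** The differences of points of [K] and [A] form a compact set, which contains arbitrarily small
    vectors and hence 0. So the hit of a compact set is a countable intersection of hits of open
    neighbourhoods. *)
Lemma hit_approx K A : compact K -> compact A ->
  (forall n, K `&` (\bigcup_(a in A) ball a n.+1%:R^-1) !=set0) ->
  K `&` A !=set0.
Proof.
move=> cK cA KA.
pose D := (fun p : 'rV[R]_d * 'rV[R]_d => p.1 - p.2) @` (K `*` A).
have cD : closed D.
  apply: compact_closed; first exact: norm_hausdorff.
  apply: continuous_compact; last exact: compact_setX.
  by apply: continuous_subspaceT => p; exact: sub_continuous.
suff [[k a] [/= Kk Aa] /eqP] : D 0.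
  by rewrite subr_eq0 => /eqP ka; exists k; split => //; rewrite ka.
apply: cD => U /nbhs_ballP[e /= e0 eU].
have [n _ ne] := near_infty_natSinv_lt (PosNum e0).
have [k [Kk [a Aa ak]]] := KA n.
exists (k - a); split; first by exists (k, a).
apply: eU; move: ak; rewrite -!ball_normE/= sub0r normrN distrC => h.
by apply: lt_trans h _; exact: (ne n (leqnn n)).
Qed.

(** Marks are arbitrary sets; taking the empty set for those that are not convex bodies makes the
    body compact for every pair. *)
Definition pair_body (z : pairs) : set 'rV[R]_d :=
  [set v | convex_body z.2 /\ translate z.2 z.1 v].

Lemma pair_bodyE x K : convex_body K -> pair_body (x, K) = translate K x.
Proof. by move=> bK; apply/seteqP; split => z //= [_]. Qed.

Lemma pair_body_compact z : compact (pair_body z).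
Proof.
have [bK|nK] := pselect (convex_body z.2).
  case: z bK => x K /= bK; rewrite pair_bodyE//; apply: translate_compact.
  by case: bK.
rewrite (_ : pair_body z = set0); first exact: compact0.
by apply/seteqP; split => v // [].
Qed.

Lemma measurable_pair_body A : compact A ->
  measurable [set z : pairs | pair_body z `&` A !=set0].
Proof.
move=> cA; rewrite (_ : [set z | _] = (setT `*` [set K | convex_body K]) `&`
    \bigcap_n [set z : pairs | translate z.2 z.1 `&`
      (\bigcup_(a in A) ball a n.+1%:R^-1) !=set0]).
  apply: measurableI; first by apply: measurableX => //; exact: convex_body_measurable.
  apply: bigcapT_measurable => n; apply: measurable_translate_open.
  by apply: bigcup_open => a _; exact: ball_open.
apply/seteqP; split => -[x K] /=.
  move=> [v [[bK Kv] Av]]; split => // n _; exists v; split => //.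
  by exists v => //; exact: ballxx.
move=> [[_ bK] hK]; rewrite pair_bodyE//; apply: hit_approx => //.
  by apply: translate_compact; case: bK.
by move=> n; exact: hK.
Qed.

End translates.

(** * Pairs of position and grain reached within a distance *)

Section reached_pairs.
Context {R : realType} {d : nat}.
Variables (u0 : 'rV[R]_d) (B : set 'rV[R]_d).
Hypothesis cB : compact B.
Local Notation pairs := (borel_rV R d * marks R d)%type.

Definition reached (t : R) : set pairs :=
  [set z | (dist_B B 0 (pair_body z) <= t%:E)%E].

Definition shell (s t : R) (C : set 'rV[R]_d) : set pairs :=
  [set z | (s%:E < dist_B B 0 (pair_body z) <= t%:E)%E /\
           C (dir_B u0 B (pair_body z) 0)].

Let bodyE (z : pairs) : \bigcup_(n in [set: nat]) pair_body z = pair_body z.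
Proof. by rewrite bigcup_const. Qed.

Let measurable_pair_dist :
  measurable_fun setT (fun z : pairs => dist_B B 0 (pair_body z)).
Proof.
have := @measurable_dist_B R d _ pairs B (fun _ z => pair_body z) cB
  (fun n => @pair_body_compact R d) (fun n => @measurable_pair_body R d).
by rewrite (_ : (fun s => _) = (fun z : pairs => dist_B B 0 (pair_body z)))//;
   apply/funext => z; rewrite bodyE.
Qed.

Lemma measurable_reached t : measurable (reached t).
Proof.
rewrite -[X in measurable X]setTI; exact: emeasurable_fun_infty_c.
Qed.

Lemma measurable_shell s t (C : set (borel_rV R d)) :
  measurable C -> measurable (shell s t C).
Proof.
move=> mC; rewrite (_ : shell s t C = (reached t `\` reached s) `&`
    [set z | C (dir_B u0 B (pair_body z) 0)]).
  apply: measurableI; first by apply: measurableD; exact: measurable_reached.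
  have := @measurable_dir_B R d _ pairs u0 B (fun _ z => pair_body z) cB
    (fun n => @pair_body_compact R d) (fun n => @measurable_pair_body R d) C mC.
  by congr measurable; apply/funext => z /=; rewrite bodyE.
apply/seteqP; split => z /=.
  by move=> [/andP[st tt] Cz]; do !split => //; apply/negP; rewrite -ltNge.
by move=> [[zt /negP zs] Cz]; split => //; rewrite ltNge zs.
Qed.

Lemma shell_sub_reached s t C : shell s t C `<=` reached t.
Proof. by move=> z [/andP[]]. Qed.

Lemma reachedS s t : s <= t -> reached s `<=` reached t.
Proof. by move=> st z /= zs; apply: le_trans zs _; rewrite lee_fin. Qed.

Lemma bigcap_reached t : \bigcap_n reached (t + n.+1%:R^-1) = reached t.
Proof.
apply/seteqP; split => z /=; last first.
  by move=> zt n _; apply: reachedS zt; rewrite lerDl.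
move=> h; apply/lee_addgt0Pr => e e0.
have [n _ ne] := near_infty_natSinv_lt (PosNum e0).
apply: le_trans (h n I) _; rewrite -EFinD lee_fin lerD2l ltW//.
exact: (ne n (leqnn n)).
Qed.

End reached_pairs.

(** * Distance and direction of the union of all germs *)

Lemma dir_B_congr (R : realType) (d : nat) (u0 : 'rV[R]_d) B A A' :
  dist_B B 0 A = dist_B B 0 A' -> contact_set B 0 A = contact_set B 0 A' ->
  dir_B u0 B A 0 = dir_B u0 B A' 0.
Proof. by rewrite /dir_B => -> ->. Qed.

Section germs.
Context {R : realType} {d : nat} {d1 : measure_display} {T : measurableType d1}.
Variables (N : nat -> T -> option 'rV[R]_d) (X : nat -> T -> set 'rV[R]_d).
Variables (u0 : 'rV[R]_d) (B : set 'rV[R]_d).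
Hypothesis X_body : forall n w, convex_body (X n w).

Definition germ n w : set 'rV[R]_d :=
  [set v | exists x y, [/\ N n w = Some x, X n w y & v = y + x]].

Lemma germ_grainE w : germ_grain N X w = \bigcup_n germ n w.
Proof.
apply/seteqP; split => v.
  by move=> [n [x [y [? ? ?]]]]; exists n => //; exists x, y.
by move=> [n _ [x [y [? ? ?]]]]; exists n, x, y.
Qed.

Lemma germ_some n w x : N n w = Some x -> germ n w = pair_body (x, X n w).
Proof.
move=> Nx; rewrite pair_bodyE; last exact: X_body.
apply/seteqP; split => v /=; first by move=> [x' [y [+ Xy ->]]]; rewrite Nx => -[<-]; exists y.
by move=> [y Xy ->]; exists x, y.
Qed.

Lemma germ_none n w : N n w = None -> germ n w = set0.
Proof. by move=> Nw; apply/seteqP; split => v // [x [y [+ _]]]; rewrite Nw. Qed.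

Lemma germ_compact n w : compact (germ n w).
Proof.
case E : (N n w) => [x|]; first by rewrite (germ_some E); exact: pair_body_compact.
by rewrite (germ_none E); exact: compact0.
Qed.

Lemma germ_hit n (A : set 'rV[R]_d) :
  [set w | germ n w `&` A !=set0] =
  marked_in N X n [set z | pair_body z `&` A !=set0].
Proof.
apply/seteqP; split => w /=.
  move=> [v [gv Av]]; have [x [y [Nx _ _]]] := gv.
  by exists x => //; exists v; split => //; rewrite -(germ_some Nx).
by move=> [x Nx [v [bv Av]]]; exists v; split => //; rewrite (germ_some Nx).
Qed.

Lemma dist_set0 : dist_B B 0 set0 = +oo%E.
Proof.
by apply/ereal_inf_pinfty => y [t [_ [z [_ []]]]].
Qed.

Lemma germ_reached n w t : marked_in N X n (reached B t) w <->
  (dist_B B 0 (germ n w) <= t%:E)%E.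
Proof.
split; first by move=> [x Nx]; rewrite (germ_some Nx).
case E : (N n w) => [x|]; first by rewrite (germ_some E) => h; exists x.
by rewrite (germ_none E) dist_set0.
Qed.

Lemma dist_le_germ n w : (dist_B B 0 (germ_grain N X w) <= dist_B B 0 (germ n w))%E.
Proof.
apply: ereal_inf_le_tmp => _ [t [t0 [v [Bv gv]]] <-]; exists t => //; split => //.
by exists v; split => //; rewrite germ_grainE; exists n.
Qed.

Lemma le_dist_germ w (m : \bar R) : (forall n, m <= dist_B B 0 (germ n w))%E ->
  (m <= dist_B B 0 (germ_grain N X w))%E.
Proof.
move=> h; apply: le_ereal_inf_tmp => _ [t [t0 [v [Bv +]]] <-].
rewrite germ_grainE => -[n _ gv]; apply: le_trans (h n) _.
by apply: ereal_inf_lbound; exists t => //; split => //; exists v.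
Qed.

(** All other germs are farther away than [t], so the union has the distance and the contact set of
    the single reached germ, and [dir_B] depends on these only. *)
Lemma single_point_contact w s t C :
  single_point N X (shell u0 B s t C) (reached B t) w ->
  (s%:E < dist_B B 0 (germ_grain N X w) <= t%:E)%E /\
  C (dir_B u0 B (germ_grain N X w) 0).
Proof.
move=> [n [[x Nx [/andP[sd dt] Cd]] nD]].
rewrite -(germ_some Nx) in sd dt Cd.
have far m : m != n -> (t%:E < dist_B B 0 (germ m w))%E.
  by move=> /nD h; rewrite ltNge; apply/negP => /germ_reached.
have dE : dist_B B 0 (germ_grain N X w) = dist_B B 0 (germ n w).
  apply/eqP; rewrite eq_le dist_le_germ/=; apply: le_dist_germ => m.
  by have [->//|/far mt] := eqVneq m n; apply: le_trans dt _; exact: ltW.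
rewrite dE sd dt; split=> //; rewrite (@dir_B_congr _ _ _ _ _ (germ n w))//.
rewrite /contact_set dE; apply/seteqP; split => v [Bv gv]; split => //; last first.
  by rewrite germ_grainE; exists n.
move: gv; rewrite germ_grainE => -[m _ gv].
have [<-//|/far mt] := eqVneq m n.
have d0 : (0 <= dist_B B 0 (germ n w))%E by rewrite dist_B0E gauge_dist_ge0.
have : (dist_B B 0 (germ m w) <= dist_B B 0 (germ n w))%E.
  rewrite -[leRHS]fineK ?ge0_fin_numE ?(le_lt_trans dt) ?ltry//.
  apply: ereal_inf_lbound; exists (fine (dist_B B 0 (germ n w))) => //.
  by split; [exact: fine_ge0|exists v].
by move=> /le_trans/(_ dt); rewrite leNgt mt.
Qed.

(** The strict inequality [t < t'] is essential: the infimum over infinitely many germs can be [t]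
    although no germ is reached within distance [t]. *)
Lemma no_point_reached w t t' : t < t' ->
  no_point N X (reached B t') w -> (t%:E < dist_B B 0 (germ_grain N X w))%E.
Proof.
move=> tt' h; apply: (@lt_le_trans _ _ t'%:E); first by rewrite lte_fin.
apply: le_dist_germ => n; rewrite leNgt; apply/negP => /ltW nt.
by apply: (h n); exact/germ_reached.
Qed.

Lemma reached_no_point w t : (t%:E < dist_B B 0 (germ_grain N X w))%E ->
  no_point N X (reached B t) w.
Proof.
move=> td n /germ_reached nt; move: td.
by rewrite ltNge (le_trans (dist_le_germ n w) nt).
Qed.

End germs.

Lemma convex_body_conv (R : realType) (d : nat) (K : set 'rV[R]_d) (l : R) x y :
  convex_body K -> K x -> K y -> 0 < l -> l <= 1 -> K (l *: x + (1 - l) *: y).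
Proof.
move=> [_ _ cK] Kx Ky l0 l1; have l0' := ltW l0.
by have /set_mem := cK x y (Itv01 l0' l1) (mem_set Kx) (mem_set Ky).
Qed.

(** * Volume of the reached germs *)

Section grain_measure.
Context {R : realType} {d : nat}.
Variable B : set 'rV[R]_d.
Hypothesis cB : compact B.
Context {d0 : measure_display} {T0 : measurableType d0} (P0 : probability T0 R).
Variable X0 : T0 -> set 'rV[R]_d.
Hypothesis X0_typical : typical_grain P0 X0.

Let X0_body : random_convex_body X0 := X0_typical.1.

Local Notation vol := (volume_measure R d).
Local Notation nu := (vol \x mark_law P0 X0_body)%E.
Local Notation pairs := (borel_rV R d * marks R d)%type.

Lemma grain_measureE (D : set pairs) : measurable D ->
  (nu D = \int[P0]_w vol (ysection D (X0 w)))%E.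
Proof.
move=> mD.
rewrite -[D in LHS]setIT -integral_indic// indic_fubini_tonelli1//.
rewrite indic_fubini_tonelli// indic_fubini_tonelli_GE//.
rewrite /mark_law (@ge0_integral_distribution _ _ _ _ _ P0)//.
exact: measurable_fun_ysection.
Qed.

Let gB t := star_hull (gauge_part B setT) t.

Let gauge_part_compact : compact (gauge_part B setT).
Proof. by rewrite (_ : gauge_part B setT = B)//; apply/seteqP; split => b // []. Qed.

Let reached_translate K x t : convex_body K -> 0 <= t ->
  ysection (reached B t) K x <-> exists2 y, K y & gB t (y + x).
Proof.
move=> bK t0; rewrite /ysection/= in_setE /reached/= pair_bodyE// dist_B0E.
have cKx : compact (translate K x) by apply: translate_compact; case: bK.
split.
  by move=> /(gauge_dist_leP gauge_part_compact cKx t0)[_ [[y Ky ->] gy]]; exists y.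
move=> [y Ky gy]; apply/(gauge_dist_leP gauge_part_compact cKx t0).
by exists (y + x); split => //; exists y.
Qed.

Let mreached t K : measurable (ysection (reached B t) K : set (borel_rV R d)).
Proof. by apply: measurable_ysection; exact: measurable_reached. Qed.

(** The positions from which a grain is reached are the reflection of its Minkowski sum with the
    reflected compact hull [gB t], and the mean volume of such a sum is finite for a typical
    grain. *)
Lemma grain_measure_reached_fin t : 0 <= t -> (nu (reached B t) < +oo)%E.
Proof.
move=> t0; have [_ fin] := X0_typical.
have cr : compact (reflection (gB t)).
  rewrite (_ : reflection (gB t) = (fun b => (-1) *: b + 0) @` gB t).
    apply: continuous_compact; last exact: scale_compact.
    by apply: continuous_subspaceT; exact: affine_continuous.
  by apply/seteqP; split => z [b gb <-]; exists b; rewrite // scaleN1r addr0.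
apply: le_lt_trans (fin _ cr).
rewrite grain_measureE; last exact: measurable_reached.
rewrite le_eqVlt; apply/orP; left; apply/eqP; apply: eq_integral => w _.
have bK : convex_body (X0 w) := X0_body.1 w.
have N10 : (-1 : R) != 0 by rewrite oppr_eq0 oner_eq0.
rewrite volume_measureE// (volume_affine 0 N10)// normrN1 expr1n mul1e.
congr volume; apply/seteqP; split => x /=; rewrite scaleN1r addr0.
  move=> /(reached_translate _ bK t0)[y Ky gy]; exists y => //.
  exists (- (y - x)); first by exists (y - x).
  by rewrite opprB addrC subrK.
move=> [y Ky [_ [z gz <-] <-]]; apply/(reached_translate _ bK t0); exists y => //.
by rewrite opprD opprK addNKr.
Qed.

Definition reached_volume t : R := fine (nu (reached B t)).

Let nuE t : 0 <= t -> nu (reached B t) = (reached_volume t)%:E.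
Proof. by move=> t0; rewrite /reached_volume fineK// ge0_fin_numE// grain_measure_reached_fin. Qed.

Lemma reached_volume_ge0 t : 0 <= reached_volume t.
Proof. exact: fine_ge0. Qed.

Lemma reached_volume_le s t : 0 <= s -> s <= t -> reached_volume s <= reached_volume t.
Proof.
move=> s0 st; rewrite -lee_fin -(nuE s0) -(nuE (le_trans s0 st)).
by apply: le_measure; rewrite ?inE; [exact: measurable_reached|
  exact: measurable_reached|exact: reachedS].
Qed.

(** For a fixed grain, a contraction with factor [l] maps the positions reached within [t] into
    those reached within [l * t]: if [y] is the grain point that is met, convexity provides the
    grain point [l *: y + (1 - l) *: k0], and it is met after the contraction. *)
Lemma reached_volume_scale (l t : R) : 0 < l -> l <= 1 -> 0 <= t ->
  l ^+ d * reached_volume t <= reached_volume (l * t).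
Proof.
move=> l0 l1 t0; have lt0 : 0 <= l * t by rewrite mulr_ge0// ltW.
have ld0 : 0 <= l ^+ d by rewrite exprn_ge0// ltW.
rewrite -lee_fin EFinM -!nuE// !grain_measureE; try exact: measurable_reached.
have mvol s : measurable_fun setT (fun w => vol (ysection (reached B s) (X0 w))).
  have mX0 := measurable_random_convex_body P0 X0_body.
  exact: (measurableT_comp (measurable_fun_ysection vol (measurable_reached cB s)) mX0).
rewrite -ge0_integralZl_EFin//.
apply: ge0_le_integral => //.
- by move=> w _; rewrite mule_ge0.
- by apply: emeasurable_funM => //; exact: measurable_cst.
move=> w _; have bK : convex_body (X0 w) := X0_body.1 w.
have [k0 Kk0] : X0 w !=set0 by case: bK.
rewrite !volume_measureE//.
(* The contraction fixes [- k0], the position that puts the point [k0] of the grain at the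
   origin. *)
rewrite [leRHS](volume_affine (l *: k0 - k0) (lt0r_neq0 l0))//.
rewrite gtr0_norm// lee_wpmul2l//.
pose A := [set x | ysection (reached B (l * t)) (X0 w) (l *: x + (l *: k0 - k0))].
have mA : measurable (A : set (borel_rV R d)).
  apply: (@borel_preimage R d d (fun x => l *: x + (l *: k0 - k0))
    (ysection (reached B (l * t)) (X0 w))); last exact: mreached.
  exact: affine_continuous.
rewrite -(volume_measureE mA) -volume_measureE//.
apply: le_measure; rewrite ?inE// => x.
move=> /(reached_translate _ bK t0)[y Ky [s [b [s0 st Bb yxE]]]].
apply/(reached_translate _ bK lt0); exists (l *: y + (1 - l) *: k0).
  exact: convex_body_conv.
exists (l * s), b; split => //; first by rewrite mulr_ge0// ltW.
  by rewrite ler_wpM2l// ltW.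
rewrite -scalerA -yxE; apply/rowP => i; rewrite !mxE; ring.
Qed.

(** Scaling by [l = s / t] bounds [reached_volume s] from below by the power [(s / t) ^+ d], which
    Bernoulli's inequality makes linear. *)
Lemma reached_volume_lip s t : 0 < s -> s <= t ->
  reached_volume t - reached_volume s <= d%:R * reached_volume t / t * (t - s).
Proof.
move=> s0 st; have t0 : 0 < t by exact: lt_le_trans st.
have l0 : 0 < s / t by rewrite divr_gt0.
have l1 : s / t <= 1 by rewrite ler_pdivrMr// mul1r.
have := reached_volume_scale l0 l1 (ltW t0); rewrite divfK ?gt_eqF//.
have bern (x : R) n : 0 <= x <= 1 -> 1 - n%:R * (1 - x) <= x ^+ n.
  move=> /andP[x0 x1]; elim: n => [|n IH]; first by rewrite mul0r subr0 expr0.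
  rewrite exprS; apply: (@le_trans _ _ (x * (1 - n%:R * (1 - x)))); last first.
    exact: ler_wpM2l.
  rewrite -natr1 -subr_ge0 (_ : _ - _ = n%:R * (1 - x) ^+ 2); last by ring.
  by rewrite mulr_ge0// sqr_ge0.
have := bern (s / t) d; rewrite ltW// l1 => /(_ isT) bd.
have v0 := reached_volume_ge0 t.
move=> h.
have : (1 - d%:R * (1 - s / t)) * reached_volume t <= reached_volume s.
  by apply: le_trans h; exact: ler_wpM2r.
rewrite mulrBl mul1r => h2.
have -> : d%:R * reached_volume t / t * (t - s) =
    d%:R * (1 - s / t) * reached_volume t.
  by field; rewrite gt_eqF.
by rewrite lerBlDr -lerBlDl.
Qed.

(** Continuity of the measure from above; it covers [t = 0], where the Lipschitz bound gives
    nothing. *)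
Lemma reached_volume_cvg t : 0 <= t ->
  reached_volume (t + n.+1%:R^-1) @[n --> \oo] --> reached_volume t.
Proof.
move=> t0.
have tn0 n : 0 <= t + n.+1%:R^-1 by rewrite addr_ge0.
have := @nonincreasing_cvg_mu _ _ _ nu (fun n => reached B (t + n.+1%:R^-1)).
rewrite bigcap_reached.
move=> /(_ (grain_measure_reached_fin (tn0 0%N)) (fun n => measurable_reached cB _)
  (measurable_reached cB _)).
have nd : nonincreasing_seq (fun n => reached B (t + n.+1%:R^-1)).
  move=> m n mn; apply/subsetPset; apply: reachedS.
  by rewrite lerD2l lef_pV2 ?posrE// ler_nat.
move=> /(_ nd) h; apply: fine_cvg; rewrite -nuE//.
Qed.

End grain_measure.

(** * Laplace transform of the intensity *)

Section laplace.
Context {R : realType} {d : measure_display} {T : measurableType d}.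
Context (P : probability T R) (L : {RV P >-> R}).
Hypotheses (L_ge0 : forall w, 0 <= L w) (EL_gt0 : (0 < 'E_P[L])%E)
  (EL_fin : ('E_P[L] < +oo)%E).

Definition laplace (x : R) : R := \int[P]_w expR (- (L w * x)).

Definition laplace_slope (x : R) : R := \int[P]_w (L w * expR (- (L w * x))).

Let intL : P.-integrable setT (EFin \o L).
Proof.
apply/integrableP; split; first exact/measurable_EFinP.
move: EL_fin; rewrite unlock; congr (_ < _)%E; apply: eq_integral => w _ /=.
by rewrite ger0_norm.
Qed.

Let mexp x : measurable_fun setT (fun w => expR (- (L w * x))).
Proof.
by apply: measurableT_comp => //; apply: measurableT_comp => //; exact: measurable_funM.
Qed.

Let exp_le1 x w : 0 <= x -> expR (- (L w * x)) <= 1.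
Proof. by move=> x0; rewrite -[leRHS]expR0 ler_expR oppr_le0 mulr_ge0. Qed.

Lemma integrable_laplace x : 0 <= x ->
  P.-integrable setT (EFin \o (fun w => expR (- (L w * x)))).
Proof.
move=> x0; have icst : P.-integrable setT (cst 1%E) by exact: finite_measure_integrable_cst.
apply: (le_integrable measurableT _ _ icst); first exact/measurable_EFinP.
by move=> w _ /=; rewrite lee_fin !ger0_norm ?expR_ge0// exp_le1.
Qed.

Lemma integrable_laplace_slope x : 0 <= x ->
  P.-integrable setT (EFin \o (fun w => L w * expR (- (L w * x)))).
Proof.
move=> x0; apply: (le_integrable measurableT _ _ intL).
  by apply/measurable_EFinP; exact: measurable_funM.
by move=> w _ /=; rewrite lee_fin !ger0_norm ?mulr_ge0 ?expR_ge0// ler_piMr// exp_le1.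
Qed.

Lemma laplaceE x : 0 <= x ->
  (\int[P]_w (expR (- (L w * x)))%:E = (laplace x)%:E)%E.
Proof.
by move=> x0; rewrite /laplace /Rintegral fineK//; exact: integrable_fin_num (integrable_laplace x0).
Qed.

Lemma laplace_slopeE x : 0 <= x ->
  (\int[P]_w (L w * expR (- (L w * x)))%:E = (laplace_slope x)%:E)%E.
Proof.
move=> x0; rewrite /laplace_slope /Rintegral fineK//.
exact: integrable_fin_num (integrable_laplace_slope x0).
Qed.

Let integral_eq0_ae (f : T -> R) : measurable_fun setT f -> (forall w, 0 <= f w) ->
  (\int[P]_w (f w)%:E = 0)%E -> {ae P, forall w, f w = 0}.
Proof.
move=> mf f0 intf.
have mEf : measurable_fun setT (EFin \o f) by exact/measurable_EFinP.
have [h _] := ae_eq_integral_abs P measurableT mEf.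
have {}h : ae_eq P setT (EFin \o f) (cst 0%E).
  apply: h; rewrite -[RHS]intf; apply: eq_integral => w _ /=.
  by rewrite ger0_norm.
by apply: filterS h => w /(_ I) [].
Qed.

Let ae_false : ~ {ae P, forall w : T, False}.
Proof.
move=> [A [mA PA0 TA]]; have := probability_setT P.
rewrite (_ : setT = A) ?PA0; last by apply/seteqP; split => // w _; apply: TA.
by move=> /eqP; rewrite eq_sym onee_eq0.
Qed.

Lemma laplace_gt0 x : 0 <= x -> 0 < laplace x.
Proof.
move=> x0; rewrite lt_neqAle; apply/andP; split; last first.
  by apply: Rintegral_ge0 => w _; exact: expR_ge0.
apply/negP => /eqP l0; apply: ae_false.
have := integral_eq0_ae (mexp x) (fun w => expR_ge0 _).
rewrite laplaceE// -l0 => /(_ erefl); apply: filterS => w /eqP.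
by rewrite gt_eqF// expR_gt0.
Qed.

(** If it vanished, [L] would be 0 almost surely, against the positive mean. Strictness allows
    division by the slope when densities are compared. *)
Lemma laplace_slope_gt0 x : 0 <= x -> 0 < laplace_slope x.
Proof.
move=> x0; have f0 w : 0 <= L w * expR (- (L w * x)) by rewrite mulr_ge0// expR_ge0.
rewrite lt_neqAle; apply/andP; split; last exact: Rintegral_ge0.
apply/negP => /eqP l0; move: EL_gt0; rewrite expectation_def.
rewrite (ae_eq_integral (cst 0%E))// ?integral0 ?ltxx//.
  exact/measurable_EFinP.
have mf : measurable_fun setT (fun w => L w * expR (- (L w * x))).
  exact: measurable_funM.
have := integral_eq0_ae mf f0; rewrite laplace_slopeE// -l0 => /(_ erefl).
apply: filterS => w /eqP; rewrite mulf_eq0 => /orP[/eqP -> //|].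
by rewrite gt_eqF// expR_gt0.
Qed.

Lemma laplace_slope_anti x y : 0 <= x -> x <= y -> laplace_slope y <= laplace_slope x.
Proof.
move=> x0 xy; have y0 := le_trans x0 xy.
apply: le_Rintegral => //.
- exact: integrable_laplace_slope.
- exact: integrable_laplace_slope.
- by move=> w _; rewrite ler_wpM2l// ler_expR lerN2 ler_wpM2l.
Qed.

(** This and the next bound integrate the tangent inequality [1 + x <= expR x], taken at one end of
    the interval each. *)
Lemma laplaceB_le x y : 0 <= x -> x <= y ->
  laplace x - laplace y <= laplace_slope x * (y - x).
Proof.
move=> x0 xy; have y0 := le_trans x0 xy.
rewrite /laplace -RintegralB//; try exact: integrable_laplace.
rewrite /laplace_slope -RintegralZr//; last exact: integrable_laplace_slope.
apply: le_Rintegral => //.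
- exact: (integrableB measurableT (integrable_laplace x0) (integrable_laplace y0)).
- exact: (integrableZr measurableT (y - x) (integrable_laplace_slope x0)).
- move=> w _ /=; have -> : - (L w * y) = - (L w * x) + - (L w * (y - x)) by ring.
  rewrite expRD; have := expR_ge1Dx (- (L w * (y - x))).
  have := expR_ge0 (- (L w * x)); nra.
Qed.

Lemma laplaceB_ge x y : 0 <= x -> x <= y ->
  laplace_slope y * (y - x) <= laplace x - laplace y.
Proof.
move=> x0 xy; have y0 := le_trans x0 xy.
rewrite /laplace -RintegralB//; try exact: integrable_laplace.
rewrite /laplace_slope -RintegralZr//; last exact: integrable_laplace_slope.
apply: le_Rintegral => //.
- exact: (integrableZr measurableT (y - x) (integrable_laplace_slope y0)).
- exact: (integrableB measurableT (integrable_laplace x0) (integrable_laplace y0)).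
- move=> w _ /=; have -> : - (L w * x) = - (L w * y) + L w * (y - x) by ring.
  rewrite expRD; have := expR_ge1Dx (L w * (y - x)).
  have := expR_ge0 (- (L w * y)); nra.
Qed.

(** The integrable bound [L] dominates for nonnegative arguments only, which is why the limit at a
    possible [x = 0] is taken from the right. *)
Lemma laplace_slope_cvg x : 0 <= x ->
  laplace_slope (x + h) @[h --> 0^'+] --> laplace_slope x.
Proof.
move=> x0; apply/cvg_at_rightP => u [u0 ucvg].
have xu0 n : 0 <= x + u n by rewrite addr_ge0// ltW.
have : (\int[P]_w (L w * expR (- (L w * (x + u n))))%:E @[n --> \oo] -->
    \int[P]_w (L w * expR (- (L w * x)))%:E)%E.
  apply: (@dominated_cvg _ _ _ P setT measurableT
    (fun n w => (L w * expR (- (L w * (x + u n))))%:E)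
    (fun w => (L w * expR (- (L w * x)))%:E) (EFin \o L)) => //.
  - by move=> n; apply/measurable_EFinP; exact: measurable_funM.
  - move=> w _; apply/fine_cvgP; split; first exact: nearW.
    apply: cvgM; first exact: cvg_cst.
    apply: continuous_cvg; first exact: continuous_expR.
    apply: cvgN; apply: cvgM; first exact: cvg_cst.
    by rewrite -[X in _ --> X]addr0; apply: cvgD => //; exact: cvg_cst.
  - move=> n w _ /=; rewrite lee_fin ger0_norm ?mulr_ge0 ?expR_ge0//.
    by rewrite ler_piMr// exp_le1.
rewrite laplace_slopeE// => /fine_cvgP[_]; rewrite /laplace_slope /Rintegral.
exact.
Qed.

End laplace.

(** * The derivative of the cumulant generating function *)

Section cumulants.
Context {R : realType} {d : measure_display} {T : measurableType d}.
Context (P : probability T R) (L : {RV P >-> R}).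
Hypotheses (L_ge0 : forall w, 0 <= L w) (EL_gt0 : (0 < 'E_P[L])%E)
  (EL_fin : ('E_P[L] < +oo)%E).

Lemma cumulant_genE s : s <= 0 -> cumulant_gen P L s = ln (laplace L (- s)).
Proof.
move=> s0; rewrite /cumulant_gen /mmt_gen_fun unlock; congr ln.
rewrite /laplace /Rintegral; congr fine; apply: eq_integral => w _ /=.
by rewrite mulrN opprK mulrC.
Qed.

Let quotN (a b k : R) : (a - b) / - k = (b - a) / k.
Proof. by rewrite invrN mulrN -mulNr opprB. Qed.

Let lnB_le (a b : R) : 0 < a -> 0 < b -> ln a - ln b <= (a - b) / b.
Proof.
move=> a0 b0; rewrite -ln_div ?posrE//.
have := expR_ge1Dx (ln (a / b)); rewrite lnK ?posrE ?divr_gt0//.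
rewrite mulrBl divff ?gt_eqF//; lra.
Qed.

Lemma laplace_cvg x : 0 <= x -> laplace L (x + h) @[h --> 0^'+] --> laplace L x.
Proof.
move=> x0; pose S := laplace_slope L x.
apply: (@squeeze_cvgr _ _ _ _ (fun h => laplace L x - S * h) (cst (laplace L x))).
- near=> h; have h0 : 0 < h by near: h; exact: nbhs_right_gt.
  have xh : x <= x + h by rewrite lerDl ltW.
  have := laplaceB_le L_ge0 EL_fin x0 xh; rewrite -/S (addrC x h) addrK.
  have := laplaceB_ge L_ge0 EL_fin x0 xh; rewrite (addrC x h) addrK.
  have := laplace_slope_gt0 L_ge0 EL_gt0 EL_fin (le_trans x0 xh).
  rewrite (addrC x h) => sl0 h1 h2 /=; apply/andP; split; first lra.
  by have := mulr_gt0 sl0 h0; lra.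
- rewrite -[X in _ --> X]subr0 -[X in _ --> _ - X](mulr0 S).
  apply: cvgB; first exact: cvg_cst.
  apply: cvgM; first exact: cvg_cst.
  by apply: cvg_at_right_filter; exact: cvg_id.
- exact: cvg_cst.
Unshelve. all: by end_near. Qed.

(** The inequality [ln a - ln b <= (a - b) / b], used in both orders, encloses the difference
    quotient between two ratios of slope to transform, which have the same limit. *)
Lemma cumulant_derivE s : s <= 0 ->
  cumulant_deriv P L s = laplace_slope L (- s) / laplace L (- s).
Proof.
move=> s0; have x0 : 0 <= - s by rewrite oppr_ge0.
set x := - s in x0 *; apply: cvg_lim => //.
have lx := laplace_gt0 L_ge0 x0.
suff : (ln (laplace L x) - ln (laplace L (x + h))) / h @[h --> 0^'+] -->
    laplace_slope L x / laplace L x.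
  (* Under [x = - s] the left-hand quotient at [s] becomes a right-hand quotient at [x]. *)
  move=> h; apply/cvg_at_leftNP; rewrite oppr0.
  apply: cvg_trans h; apply: near_eq_cvg; near=> k.
  have k0 : 0 < k by near: k; exact: nbhs_right_gt.
  rewrite /= !cumulant_genE//; last by lra.
  rewrite opprD opprK -/x.
  exact: (esym (quotN _ _ k)).
apply: (@squeeze_cvgr _ _ _ _
  (fun h => laplace_slope L (x + h) / laplace L x)
  (fun h => laplace_slope L x / laplace L (x + h))).
- near=> h; have h0 : 0 < h by near: h; exact: nbhs_right_gt.
  have xh : x <= x + h by rewrite lerDl ltW.
  have lxh := laplace_gt0 L_ge0 (le_trans x0 xh).
  have := laplaceB_le L_ge0 EL_fin x0 xh; rewrite [x + h - x]addrAC subrr add0r => h1.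
  have := laplaceB_ge L_ge0 EL_fin x0 xh; rewrite [x + h - x]addrAC subrr add0r => h2.
  have h3 := lnB_le lx lxh; have h4 := lnB_le lxh lx.
  apply/andP; split.
    rewrite ler_pdivlMr// mulrAC ler_pdivrMr//.
    apply: (le_trans h2).
    by rewrite -ler_pdivrMr// -lerN2 -mulNr !opprB.
  rewrite ler_pdivrMr// mulrAC.
  apply: (le_trans h3); rewrite ler_pM2r ?invr_gt0//.
- apply: cvgM; last exact: cvg_cst.
  exact: laplace_slope_cvg.
- apply: cvgM; first exact: cvg_cst.
  by apply: cvgV; [rewrite gt_eqF|exact: laplace_cvg].
Unshelve. all: by end_near. Qed.

End cumulants.

(** * Densities and hazards of the empty space function *)

Section sandwich_steps.
Context {R : realFieldType}.
Implicit Types (a b c e k l w x y : R).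

(** The lemmas of this section hold the linear arithmetic of the bounds below: [a], [b], [c] stand
    for values of [phi], and [k], [l] for increments of shell volumes. *)
Lemma coarse_step a b k l x y Fs Ft Fs' Ft' ms mt :
  ms - mt <= a * (y - x) -> b * l <= Ft' - Fs' -> k + l = y - x ->
  Fs + Fs' = 1 - ms -> Ft + Ft' = 1 - mt -> 0 <= (a - b) * k ->
  Ft - Fs <= a * k + (a - b) * (y - x).
Proof. by move=> h1 h2 h3; move: h1; rewrite -h3 => h1 h4 h5 h6; lra. Qed.

Lemma chain_step a b c e k l w Fs Fm Fn :
  Fm - Fs <= a * k + (a - b) * e -> Fn - Fm <= b * l + (b - c) * w ->
  b * l <= a * l -> (b - c) * w <= (b - c) * e ->
  Fn - Fs <= a * (k + l) + (a - c) * e.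
Proof. by move=> *; lra. Qed.

Lemma zero_step a b k l x y F0 Fe Ft F0' Fe' m0 me :
  Ft - Fe <= b * l -> F0 + F0' = 1 - m0 -> Fe + Fe' = 1 - me ->
  m0 - me <= a * (y - x) -> 0 <= Fe' - F0' -> b * l <= a * k ->
  Ft - F0 <= a * k + a * (y - x).
Proof. by move=> *; lra. Qed.

End sandwich_steps.

Section hazard_sandwich.
Context {R : realType} {d : measure_display} {T : measurableType d}.
Context (P : probability T R) (L : {RV P >-> R}).
Hypotheses (L_ge0 : forall w, 0 <= L w) (EL_gt0 : (0 < 'E_P[L])%E)
  (EL_fin : ('E_P[L] < +oo)%E).
Local Notation M := (laplace L).
Local Notation phi := (laplace_slope L).

(** [v t] stands for the volume of the germs reached up to distance [t], [g]
    and [g'] for the parts of its increments with directions in a set and in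
    its complement, [F] and [F'] for the corresponding parts of the empty
    space function. *)
Variables (n : nat) (v F F' : R -> R) (g g' : R -> R -> R).
Hypotheses (v_ge0 : forall t, 0 <= v t)
  (v_le : forall s t, 0 <= s -> s <= t -> v s <= v t)
  (v_lip : forall s t, 0 < s -> s <= t -> v t - v s <= n%:R * v t / t * (t - s))
  (v_cvg : forall t, 0 <= t -> v (t + k.+1%:R^-1) @[k --> \oo] --> v t).
Hypotheses (g_ge0 : forall s t, 0 <= g s t) (g'_ge0 : forall s t, 0 <= g' s t)
  (gg' : forall s t, 0 <= s -> s <= t -> g s t + g' s t = v t - v s)
  (g_add : forall s t u, 0 <= s -> s <= t -> t <= u -> g s t + g t u = g s u).
Hypotheses (FF' : forall t, 0 <= t -> F t + F' t = 1 - M (v t))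
  (F_ge : forall s t, 0 <= s -> s <= t -> phi (v t) * g s t <= F t - F s)
  (F'_ge : forall s t, 0 <= s -> s <= t -> phi (v t) * g' s t <= F' t - F' s).

Let phi_anti s t : 0 <= s -> s <= t -> phi (v t) <= phi (v s).
Proof. by move=> s0 st; apply: laplace_slope_anti => //; exact: v_le. Qed.

Let phi_gt0 t : 0 < phi (v t).
Proof. exact: laplace_slope_gt0. Qed.

Let coarse_upper s t : 0 <= s -> s <= t ->
  F t - F s <= phi (v s) * g s t + (phi (v s) - phi (v t)) * (v t - v s).
Proof.
move=> s0 st; have t0 := le_trans s0 st.
have vst := v_le s0 st.
have h1 := laplaceB_le L_ge0 EL_fin (v_ge0 s) vst.
have h2 := F'_ge s0 st.
have h3 := gg' s0 st.
have h4 := FF' s0; have h5 := FF' t0.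
(* The error obtained is [(phi (v s) - phi (v t)) * g' s t]; this term enlarges it to the whole
   increment of [v]. *)
have h6 : 0 <= (phi (v s) - phi (v t)) * g s t.
  by rewrite mulr_ge0// subr_ge0 phi_anti.
exact: (coarse_step h1 h2 h3 h4 h5 h6).
Qed.

(** The errors telescope in [phi], so the total carries a single factor [e], however many steps
    there are. *)
Let chain_upper s e (sigma : nat -> R) m : 0 <= s -> sigma 0%N = s ->
  (forall i, sigma i <= sigma i.+1) ->
  (forall i, (i < m)%N -> v (sigma i.+1) - v (sigma i) <= e) ->
  F (sigma m) - F s <=
    phi (v s) * g s (sigma m) + (phi (v s) - phi (v (sigma m))) * e.
Proof.
move=> s0 sigma0 sigmaS; have s_le i : s <= sigma i.
  by elim: i => [|i IH]; [rewrite sigma0|exact: le_trans IH (sigmaS i)].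
elim: m => [_|m IH inc].
  rewrite sigma0 !subrr mul0r addr0 mulr_ge0// ltW//.
have {}IH := IH (fun i im => inc i (ltnW im)).
have sm0 : 0 <= sigma m := le_trans s0 (s_le m).
have h1 := coarse_upper sm0 (sigmaS m).
have h2 := inc m (ltnSn m).
have h3 := g_add s0 (s_le m) (sigmaS m).
have h4 : phi (v (sigma m)) <= phi (v s) by exact: phi_anti.
have h5 : phi (v (sigma m.+1)) <= phi (v (sigma m)) by exact: phi_anti.
have h6 := g_ge0 (sigma m) (sigma m.+1).
have h7 : phi (v (sigma m)) * g (sigma m) (sigma m.+1) <=
    phi (v s) * g (sigma m) (sigma m.+1) by exact: ler_wpM2r.
have h8 : (phi (v (sigma m)) - phi (v (sigma m.+1))) *
    (v (sigma m.+1) - v (sigma m)) <=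
    (phi (v (sigma m)) - phi (v (sigma m.+1))) * e.
  by rewrite ler_wpM2l// subr_ge0.
rewrite -h3; exact: (chain_step IH h1 h7 h8).
Qed.

Let upper_pos s t : 0 < s -> s <= t -> F t - F s <= phi (v s) * g s t.
Proof.
move=> s0 st; have t0 := lt_le_trans s0 st.
apply/ler_addgt0Pr => e e0.
(* On the interval from [s] to [t] the slope of [v] is at most [n%:R * v t / s], so [c] bounds the
   increment of [v], and [c / m.+1%:R] that over one of [m.+1] equal steps. *)
pose c := n%:R * v t / s * (t - s).
have c0 : 0 <= c by rewrite !mulr_ge0// ?invr_ge0 ?subr_ge0// ltW.
(* The denominator contains [c + 1] because [c] may be 0. *)
have [m _ mle] := near_infty_natSinv_lt (PosNum (divr_gt0 e0
  (mulr_gt0 (phi_gt0 s) (ltr_wpDl c0 ltr01)))).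
have {}mle := mle m (leqnn m).
(* The minimum keeps the partition at [t] after its last step, so that it is monotone in all
   indices. *)
pose sigma i := s + (minn i m.+1)%:R / m.+1%:R * (t - s).
have m0 : 0 < m.+1%:R :> R by rewrite ltr0n.
have ts0 : 0 <= t - s by rewrite subr_ge0.
have sigmam : sigma m.+1 = t by rewrite /sigma minnn divff ?gt_eqF// mul1r addrC subrK.
have sigma0 : sigma 0%N = s by rewrite /sigma min0n !mul0r addr0.
have sigmaS i : sigma i <= sigma i.+1.
  rewrite /sigma lerD2l ler_wpM2r// ler_wpM2r ?invr_ge0 ?ler0n// ler_nat.
  by rewrite leq_min geq_minr andbT (leq_trans (geq_minl _ _)).
have sigma_s i : s <= sigma i by rewrite /sigma lerDl mulr_ge0// divr_ge0.
have inc i : (i < m.+1)%N -> v (sigma i.+1) - v (sigma i) <= c / m.+1%:R.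
  move=> im; have si0 : 0 < sigma i := lt_le_trans s0 (sigma_s i).
  apply: le_trans (v_lip si0 (sigmaS i)) _.
  have -> : sigma i.+1 - sigma i = (t - s) / m.+1%:R.
    rewrite /sigma (minn_idPl im) (minn_idPl (ltnW im)) -[i.+1%:R]natr1.
    by field; rewrite ?natr1 gt_eqF.
  rewrite /c -[leRHS]mulrA ler_wpM2r ?divr_ge0//.
  have sit : sigma i.+1 <= t.
    rewrite -sigmam /sigma lerD2l ler_wpM2r// ler_wpM2r ?invr_ge0 ?ler0n// ler_nat.
    by rewrite minnn geq_minr.
  apply: ler_pM; rewrite ?mulr_ge0 ?invr_ge0//.
  - exact: le_trans (ltW s0) (sigma_s i.+1).
  - by rewrite ler_wpM2l// v_le// (le_trans (ltW s0)).
  - by rewrite lef_pV2 ?posrE// (lt_le_trans s0).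
have := chain_upper (ltW s0) sigma0 sigmaS inc; rewrite sigmam => h.
apply: le_trans h _; rewrite lerD2l.
have h1 := phi_gt0 t; have h2 := phi_gt0 s.
apply: (@le_trans _ _ (phi (v s) * (c / m.+1%:R))).
  by rewrite ler_wpM2r ?divr_ge0// gerBl ltW.
have c10 : 0 < c + 1 by rewrite ltr_wpDl.
move: mle; rewrite /= ltr_pdivlMr ?mulr_gt0// => mle.
apply: ltW; apply: le_lt_trans mle.
rewrite mulrA mulrC ler_wpM2l ?invr_ge0// ler_wpM2l//; first exact: ltW.
by rewrite lerDl.
Qed.

(** For [s = 0] the Lipschitz bound breaks down. The part up to [k.+1%:R^-1] is bounded by the total
    increase of [F + F'] there, which tends to 0 by right continuity of [v]. *)
Lemma sandwich_upper s t : 0 <= s -> s <= t -> F t - F s <= phi (v s) * g s t.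
Proof.
rewrite le_eqVlt => /predU1P[<- t0|s0]; last exact: upper_pos.
move: t0; rewrite le_eqVlt => /predU1P[<-|t0].
  by rewrite subrr mulr_ge0// ltW.
have C : phi (v 0) * g 0 t + phi (v 0) * (v (0 + k.+1%:R^-1) - v 0)
    @[k --> \oo] --> phi (v 0) * g 0 t.
  rewrite [X in _ --> X](_ : _ = phi (v 0) * g 0 t + phi (v 0) * (v 0 - v 0)).
    apply: cvgD; first exact: cvg_cst.
    apply: cvgM; first exact: cvg_cst.
    by apply: cvgB; [exact: v_cvg|exact: cvg_cst].
  by rewrite subrr mulr0 addr0.
rewrite -(cvg_lim _ C)//; apply: limr_ge; first exact: cvgP C.
near=> k; rewrite add0r /=.
have k0 : 0 < k.+1%:R^-1 :> R by rewrite invr_gt0 ltr0n.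
have kt : k.+1%:R^-1 <= t :> R.
  apply: ltW; near: k; exact: (near_infty_natSinv_lt (PosNum t0)).
have h1 := upper_pos k0 kt.
have h2 := FF' (lexx 0); have h3 := FF' (ltW k0).
have h4 := laplaceB_le L_ge0 EL_fin (v_ge0 0) (v_le (lexx 0) (ltW k0)).
have h5 : 0 <= F' k.+1%:R^-1 - F' 0.
  by apply: le_trans (F'_ge (lexx 0) (ltW k0)); rewrite mulr_ge0// ltW.
have h6 := g_add (lexx 0) (ltW k0) kt; have h7 := g_ge0 0 k.+1%:R^-1.
have h8 := phi_anti (lexx 0) (ltW k0).
have h9 : phi (v k.+1%:R^-1) * g k.+1%:R^-1 t <= phi (v 0) * g 0 t.
  by apply: ler_pM => //; [exact: ltW|rewrite -h6 lerDr].
exact: (zero_step h1 h2 h3 h4 h5 h9).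
Unshelve. all: by end_near. Qed.

(** Monotonicity of [v] extends its right continuity from the sequence [t + k.+1%:R^-1] to all small
    [h]; then [phi] is monotone and right-continuous. *)
Lemma phi_v_cvg t : 0 <= t -> phi (v (t + h)) @[h --> 0^'+] --> phi (v t).
Proof.
move=> t0; apply/cvgrPdist_lt => e e0.
have := laplace_slope_cvg L_ge0 EL_fin (v_ge0 t) => /cvgrPdist_lt/(_ e e0).
move=> [r /= r0 hr].
have r20 : 0 < r / 2 by rewrite divr_gt0.
have /cvgrPdist_lt/(_ _ r20)[m _ /(_ m (leqnn m))/= vm] := v_cvg t0.
near=> h.
have h0 : 0 < h by near: h; exact: nbhs_right_gt.
have hm : h <= m.+1%:R^-1.
  by near: h; apply: nbhs_right_le; rewrite invr_gt0 ltr0n.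
have vh : v (t + h) <= v t + r / 2.
  apply: (@le_trans _ _ (v (t + m.+1%:R^-1))).
    by apply: v_le; [rewrite addr_ge0// ltW|rewrite lerD2l].
  by move: vm; rewrite ltr_distlC addrC => /andP[_ /ltW]; rewrite addrC.
have th : t <= t + h by rewrite lerDl ltW.
have h1 := phi_anti t0 th.
rewrite ger0_norm ?subr_ge0//.
have h2 : phi (v t + r / 2) <= phi (v (t + h)).
  by apply: laplace_slope_anti.
have := hr (r / 2); rewrite /= sub0r normrN gtr0_norm// => /(_ _ r20).
rewrite ltr_pdivrMr// mulr2n mulrDr mulr1 ltrDl r0 => /(_ isT).
rewrite ltr_distlC => /andP[h3 _].
by rewrite ltrBlDr -ltrBlDl (lt_le_trans h3).
Unshelve. all: by end_near. Qed.

Lemma density_lim t : 0 <= t ->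
  lim ((F (t + h) - F t) / h @[h --> 0^'+]) =
  phi (v t) * lim (g t (t + h) / h @[h --> 0^'+]).
Proof.
move=> t0.
have lower : \forall h \near 0^'+, phi (v (t + h)) * (g t (t + h) / h) <=
    (F (t + h) - F t) / h.
  near=> h; have h0 : 0 < h by near: h; exact: nbhs_right_gt.
  by rewrite mulrA ler_pM2r ?invr_gt0// F_ge// lerDl ltW.
have upper : \forall h \near 0^'+, (F (t + h) - F t) / h <=
    phi (v t) * (g t (t + h) / h).
  near=> h; have h0 : 0 < h by near: h; exact: nbhs_right_gt.
  by rewrite mulrA ler_pM2r ?invr_gt0// sandwich_upper// lerDl ltW.
have [gc|ngc] := pselect (cvg (g t (t + h) / h @[h --> 0^'+])).
  apply: cvg_lim => //; apply: squeeze_cvgr.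
  - by near=> h; apply/andP; split; near: h; [exact: lower|exact: upper].
  - by apply: cvgM; [exact: phi_v_cvg|exact: gc].
  - by apply: cvgM; [exact: cvg_cst|exact: gc].
(* Positivity of [phi] inverts the squeeze: a limit for [F] would force one for [g]. So both
   quotients diverge, and both [lim] take the default value 0. *)
rewrite (dvgP ngc) (dvgP _) ?mulr0// => /cvg_ex[/= l Fl]; apply: ngc.
apply/cvg_ex; exists (l / phi (v t)).
apply: (@squeeze_cvgr _ _ _ _ (fun h => (F (t + h) - F t) / h / phi (v t))
  (fun h => (F (t + h) - F t) / h / phi (v (t + h)))).
- near=> h; have p0 := phi_gt0 t; have p1 := phi_gt0 (t + h).
  rewrite ler_pdivrMr// ler_pdivlMr//.
  rewrite (mulrC _ (phi (v t))) (mulrC _ (phi (v (t + h)))).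
  by apply/andP; split; near: h; [exact: upper|exact: lower].
- by apply: cvgM => //; exact: cvg_cst.
- apply: cvgM => //; apply: cvgV; last exact: phi_v_cvg.
  by rewrite gt_eqF.
Unshelve. all: by end_near. Qed.

End hazard_sandwich.

(** * Volume of shells with directions in a given set *)

Section shell_volume.
Context {R : realType} {d : nat}.
Variables (u0 : 'rV[R]_d) (B : set 'rV[R]_d).
Hypothesis cB : compact B.
Context {d0 : measure_display} {T0 : measurableType d0} (P0 : probability T0 R).
Variable X0 : T0 -> set 'rV[R]_d.
Hypothesis X0_typical : typical_grain P0 X0.

Local Notation nu := (volume_measure R d \x mark_law P0 X0_typical.1)%E.

Definition shell_volume (C : set 'rV[R]_d) s t : R := fine (nu (shell u0 B s t C)).

Lemma shell_volume_ge0 C s t : 0 <= shell_volume C s t.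
Proof. exact: fine_ge0. Qed.

Lemma shell_fin (C : set (borel_rV R d)) s t : measurable C -> 0 <= t ->
  (nu (shell u0 B s t C) < +oo)%E.
Proof.
move=> mC t0; apply: le_lt_trans (grain_measure_reached_fin cB X0_typical t0).
apply: le_measure; rewrite ?inE; [exact: measurable_shell|exact: measurable_reached|].
exact: shell_sub_reached.
Qed.

Lemma shell_volumeE (C : set (borel_rV R d)) s t : measurable C -> 0 <= t ->
  nu (shell u0 B s t C) = (shell_volume C s t)%:E.
Proof. by move=> mC t0; rewrite fineK// ge0_fin_numE// shell_fin. Qed.

(** Every pair has a value of [dir_B], possibly the default, so [C] and its complement split the
    pairs reached after [s] and within [t]. *)
Lemma shell_volumeC (C : set (borel_rV R d)) s t : measurable C ->
  0 <= s -> s <= t ->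
  shell_volume C s t + shell_volume (~` C) s t =
  reached_volume B X0_typical t - reached_volume B X0_typical s.
Proof.
move=> mC s0 st; have t0 := le_trans s0 st.
have mCC : measurable (~` C : set (borel_rV R d)) by exact: measurableC.
have rE r : 0 <= r -> nu (reached B r) = (reached_volume B X0_typical r)%:E.
  by move=> r0; rewrite fineK// ge0_fin_numE// grain_measure_reached_fin.
suff : nu (reached B t) = (nu (reached B s) +
    (nu (shell u0 B s t C) + nu (shell u0 B s t (~` C))))%E.
  by rewrite !rE// !shell_volumeE// -!EFinD => -[->]; rewrite addrAC subrr add0r.
rewrite (_ : reached B t = reached B s `|` (shell u0 B s t C `|` shell u0 B s t (~` C))).
  have m1 := measurable_shell u0 cB s t mC; have m2 := measurable_shell u0 cB s t mCC.
  rewrite measureU//.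
  - congr (_ + _)%E; rewrite measureU//.
    by apply/seteqP; split => // z [[_ Cz] [_ nCz]].
  - exact: measurable_reached.
  - exact: measurableU.
  - apply/seteqP; split => // z [/= zs [[/andP[sz _] _]|[/andP[sz _] _]]];
    by move: sz; rewrite ltNge zs.
apply/seteqP; split => z /=.
  move=> zt; have [zs|zs] := pselect (reached B s z); first by left.
  have sz : (s%:E < dist_B B 0 (pair_body z))%E by rewrite ltNge; apply/negP.
  right; have [Cz|nCz] := pselect (C (dir_B u0 B (pair_body z) 0)).
    by left; rewrite /shell/= sz.
  by right; rewrite /shell/= sz.
by move=> [zs|[|]] => [|[/andP[]]|[/andP[]]]//; exact: reachedS zs.
Qed.

Lemma shell_volumeD (C : set (borel_rV R d)) s t u : measurable C ->
  0 <= s -> s <= t -> t <= u ->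
  shell_volume C s t + shell_volume C t u = shell_volume C s u.
Proof.
move=> mC s0 st tu; have t0 := le_trans s0 st; have u0' := le_trans t0 tu.
suff : nu (shell u0 B s u C) =
    (nu (shell u0 B s t C) + nu (shell u0 B t u C))%E.
  by rewrite !shell_volumeE// -EFinD => -[].
rewrite (_ : shell u0 B s u C = shell u0 B s t C `|` shell u0 B t u C).
  have m1 := measurable_shell u0 cB s t mC; have m2 := measurable_shell u0 cB t u mC.
  rewrite measureU//; apply/seteqP; split => // z [[/andP[_ zt] _] [/andP[tz _] _]].
  by move: tz; rewrite ltNge zt.
apply/seteqP; split => z /=.
  move=> [/andP[sz zu] Cz]; have [zt|tz] := leP (dist_B B 0 (pair_body z)) t%:E.
    by left; rewrite /shell/= sz.
  by right; rewrite /shell/= tz.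
move=> [|] [/andP[a b] Cz]; rewrite /shell/=; split => //; apply/andP; split => //.
  by apply: le_trans b _; rewrite lee_fin.
by apply: le_lt_trans a; rewrite lee_fin.
Qed.

End shell_volume.

(** * The empty space function of the mixed Poisson model *)

Section empty_space.
Context {R : realType} {d : nat}.
Variables (u0 : 'rV[R]_d) (B : set 'rV[R]_d).
Hypothesis cB : compact B.
Context {d0 : measure_display} {T0 : measurableType d0} (P0 : probability T0 R).
Variable X0 : T0 -> set 'rV[R]_d.
Hypothesis X0_typical : typical_grain P0 X0.
Context {d1 : measure_display} {T : measurableType d1} (P : probability T R).
Variables (L : {RV P >-> R}) (N : nat -> T -> option 'rV[R]_d)
  (X : nat -> T -> set 'rV[R]_d).
Hypothesis model : mixed_poisson_germ_grain P0 X0 L N X.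

Local Notation nu := (volume_measure R d \x mark_law P0 X0_typical.1)%E.
Local Notation Z := (germ_grain N X).
Local Notation F := (empty_space_fun P u0 B Z).
Local Notation rv := (reached_volume B X0_typical).
Local Notation sv := (shell_volume u0 B X0_typical).

Let X_body n w : convex_body (X n w).
Proof. by case: model => _ [bX _]; have [h _] := bX n; exact: (h w). Qed.

Let L_ge0 w : 0 <= L w. Proof. by case: model => -[]. Qed.
Let EL_fin : ('E_P[L] < +oo)%E. Proof. by case: model => -[_ /andP[]]. Qed.
Let EL_gt0 : (0 < 'E_P[L])%E. Proof. by case: model => -[_ /andP[]]. Qed.

Let measurable_germ_hit n (A : set 'rV[R]_d) : compact A ->
  measurable [set w | germ N X n w `&` A !=set0].
Proof.
move=> cA; rewrite germ_hit//.
by apply: (measurable_marked_in model); exact: (measurable_pair_body cA).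
Qed.

Let measurable_dist : measurable_fun setT (fun w => dist_B B 0 (Z w)).
Proof.
have := measurable_dist_B cB (@germ_compact _ _ _ _ N X X_body) measurable_germ_hit.
by rewrite (_ : (fun s => _) = (fun w => dist_B B 0 (Z w)))//;
   apply/funext => w; rewrite germ_grainE.
Qed.

Let event t (C : set 'rV[R]_d) : set T :=
  [set w | (dist_B B 0 (Z w) <= t%:E)%E /\ C (dir_B u0 B (Z w) 0)].

Let measurable_event t (C : set (borel_rV R d)) :
  measurable C -> measurable (event t C).
Proof.
move=> mC; rewrite (_ : event t C = [set w | (dist_B B 0 (Z w) <= t%:E)%E] `&`
    [set w | C (dir_B u0 B (Z w) 0)])//; apply: measurableI.
  rewrite -[X in measurable X]setTI; exact: emeasurable_fun_infty_c.
have := measurable_dir_B u0 cB (@germ_compact _ _ _ _ N X X_body)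
  measurable_germ_hit mC.
by congr measurable; apply/funext => w /=; rewrite germ_grainE.
Qed.

Let FE t (C : set (borel_rV R d)) : measurable C -> (P (event t C) = (F t C)%:E)%E.
Proof.
by move=> mC; rewrite /empty_space_fun fineK// fin_num_measure//; exact: measurable_event.
Qed.

Lemma empty_space_funC t (C : set (borel_rV R d)) : measurable C ->
  F t C + F t (~` C) = F t setT.
Proof.
move=> mC; have mCC : measurable (~` C : set (borel_rV R d)) by exact: measurableC.
apply/eqP; rewrite -eqe EFinD; apply/eqP; rewrite -!FE//.
rewrite -measureU; [|exact: measurable_event|exact: measurable_event|].
  congr (P _); apply/seteqP; split => w /=; first by move=> [[? _]|[? _]].
  move=> [wt _]; have [Cw|nCw] := pselect (C (dir_B u0 B (Z w) 0)).
    by left; split.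
  by right; split.
by apply/seteqP; split => // w [[_ Cw] [_ nCw]].
Qed.

(** The event of a distance above [t] lies in the void event at [t] and contains the void events at
    [t + k.+1%:R^-1]; right continuity of the reached volume closes the gap. *)
Lemma empty_space_fun_total t : 0 <= t -> F t setT = 1 - laplace L (rv t).
Proof.
move=> t0.
have rfin r : 0 <= r -> (nu (reached B r) < +oo)%E.
  exact: grain_measure_reached_fin.
have no_pointE r : 0 <= r ->
    P (no_point N X (reached B r)) = (laplace L (rv r))%:E.
  move=> r0; rewrite (no_point_probability model (measurable_reached cB r) (measurable_reached cB r)
    (@subset_refl _ _) (rfin r r0)).
  by rewrite laplaceE// fine_ge0.
have PE : P (event t setT) = (F t setT)%:E by exact: FE.
have mE : measurable (event t setT) by exact: measurable_event.
have PC : P (~` event t setT) = (1 - F t setT)%:E.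
  by rewrite probability_setC// PE EFinB.
have mN r : measurable (no_point N X (reached B r)).
  exact: (measurable_no_point model (measurable_reached cB r)).
have notE w : (~` event t setT) w <-> (t%:E < dist_B B 0 (Z w))%E.
  rewrite /event/=; split; first by move=> h; rewrite ltNge; apply/negP => wt; apply: h.
  by rewrite ltNge => /negP h [].
have ub : 1 - F t setT <= laplace L (rv t).
  rewrite -lee_fin -PC -no_pointE//; apply: le_measure; rewrite ?inE//.
    exact: measurableC.
  by move=> w /notE; exact: reached_no_point.
have lb : laplace L (rv t) <= 1 - F t setT.
  have C : laplace L (rv t) - laplace_slope L (rv t) *
      (rv (t + k.+1%:R^-1) - rv t) @[k --> \oo] --> laplace L (rv t).
    rewrite [X in _ --> X](_ : _ = laplace L (rv t) - laplace_slope L (rv t) *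
      (rv t - rv t)).
      apply: cvgB; first exact: cvg_cst.
      apply: cvgM; first exact: cvg_cst.
      by apply: cvgB; [exact: reached_volume_cvg|exact: cvg_cst].
    by rewrite subrr mulr0 subr0.
  rewrite -(cvg_lim _ C)//; apply: limr_le; first exact: cvgP C.
  apply: nearW => k; have k0 : 0 < k.+1%:R^-1 :> R by rewrite invr_gt0 ltr0n.
  have tk : t <= t + k.+1%:R^-1 by rewrite lerDl ltW.
  have rle : rv t <= rv (t + k.+1%:R^-1) by exact: reached_volume_le.
  have := laplaceB_le L_ge0 EL_fin (reached_volume_ge0 _ _ t) rle.
  suff le_F : laplace L (rv (t + k.+1%:R^-1)) <= 1 - F t setT.
    move=> slope_le; rewrite lerBlDr; apply: (@le_trans _ _ (_ + _)).
      by rewrite -lerBlDr; exact: slope_le.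
    by rewrite addrC lerD2r.
  rewrite -lee_fin -PC -no_pointE ?(le_trans t0)//.
  apply: le_measure; rewrite ?inE//; first exact: measurableC.
  move=> w h; apply/notE; apply: (no_point_reached X_body _ h).
  by rewrite ltrDl.
by rewrite -(le_anti (introT andP (conj ub lb))) opprB addrC subrK.
Qed.

(** A single reached germ, lying in the shell, passes its distance and direction to the union, so
    the single-point event lies in the increment of the event measured by [F]. *)
Lemma empty_space_fun_ge s t (C : set (borel_rV R d)) : measurable C ->
  0 <= s -> s <= t ->
  laplace_slope L (rv t) * sv C s t <= F t C - F s C.
Proof.
move=> mC s0 st; have t0 := le_trans s0 st.
have ms := measurable_shell u0 cB s t mC; have mr := measurable_reached cB t.
have rfin : (nu (reached B t) < +oo)%E by exact: grain_measure_reached_fin.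
have sub := @shell_sub_reached _ _ u0 B s t C.
have := single_point_probability model ms mr sub rfin.
have msp := measurable_single_point model ms mr.
have mes := measurable_event s mC; have met := measurable_event t mC.
have sle : (P (single_point N X (shell u0 B s t C) (reached B t)) <=
    P (event t C `\` event s C))%E.
  apply: le_measure; rewrite ?inE//; first exact: measurableD.
  move=> w /(single_point_contact X_body)[/andP[sd dt] Cd]; split => //.
  by move=> [/= ds _]; move: sd; rewrite ltNge ds.
have DE : P (event t C `\` event s C) = (F t C - F s C)%:E.
  rewrite measureD//; last by rewrite -ge0_fin_numE// fin_num_measure.
  rewrite (_ : event t C `&` event s C = event s C).
    by rewrite EFinB; congr (_ - _)%E; exact: FE.
  apply/seteqP; split => w; first by move=> [].
  move=> [ws Cw]; split => //; split => //.
  by apply: le_trans ws _; rewrite lee_fin.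
move=> h; rewrite -lee_fin -DE; apply: le_trans sle; apply: le_trans h.
rewrite le_eqVlt; apply/orP; left; apply/eqP.
rewrite EFinM -laplace_slopeE ?fine_ge0// muleC -ge0_integralZl_EFin ?fine_ge0//.
- by apply: eq_integral => w _; rewrite -EFinM; congr _%:E; rewrite /shell_volume; ring.
- by move=> w _; rewrite lee_fin mulr_ge0// expR_ge0.
- apply/measurable_EFinP; apply: measurable_funM => //.
  by apply: measurableT_comp => //; apply: measurableT_comp => //; exact: measurable_funM.
Qed.

Lemma empty_space_densityE t (C : set (borel_rV R d)) : measurable C -> 0 <= t ->
  empty_space_density P u0 B Z t C =
  laplace_slope L (rv t) * lim (sv C t (t + h) / h @[h --> 0^'+]).
Proof.
move=> mC t0; have mCC : measurable (~` C : set (borel_rV R d)) by exact: measurableC.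
apply: (@density_lim _ _ _ P L L_ge0 EL_gt0 EL_fin d rv (F ^~ C) (F ^~ (~` C))
  (sv C) (sv (~` C))) => //.
- exact: reached_volume_ge0.
- exact: reached_volume_le.
- exact: reached_volume_lip.
- exact: reached_volume_cvg.
- exact: shell_volume_ge0.
- exact: shell_volume_ge0.
- by move=> s r s0 sr; exact: shell_volumeC.
- by move=> s r u *; exact: shell_volumeD.
- by move=> r r0; rewrite empty_space_funC// empty_space_fun_total.
- by move=> s r s0 sr; exact: empty_space_fun_ge.
- by move=> s r s0 sr; exact: empty_space_fun_ge.
Qed.

Lemma empty_space_hazardE t (C : set (borel_rV R d)) : measurable C -> 0 <= t ->
  empty_space_hazard P u0 B Z t C =
  cumulant_deriv P L (- rv t) * lim (sv C t (t + h) / h @[h --> 0^'+]).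
Proof.
move=> mC t0; rewrite /empty_space_hazard empty_space_densityE//.
rewrite empty_space_fun_total// subKr cumulant_derivE//; last first.
  by rewrite oppr_le0 reached_volume_ge0.
by rewrite opprK mulrAC.
Qed.

End empty_space.

Theorem proposition5p2 (R : realType) (d : nat) (B : set 'rV[R]_d)
    (u0 : 'rV[R]_d)
    (d0 : measure_display) (T0 : measurableType d0) (P0 : probability T0 R)
    (d1 : measure_display) (T1 : measurableType d1) (P1 : probability T1 R)
    (d2 : measure_display) (T2 : measurableType d2) (P2 : probability T2 R)
    (X0 : T0 -> set 'rV[R]_d)
    (L1 : {RV P1 >-> R}) (N1 : nat -> T1 -> option 'rV[R]_d)
    (X1 : nat -> T1 -> set 'rV[R]_d)
    (L2 : {RV P2 >-> R}) (N2 : nat -> T2 -> option 'rV[R]_d)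
    (X2 : nat -> T2 -> set 'rV[R]_d)
    (d_gt0 : (0 < d)%N)
    (B_structuring : structuring_element B)
    (u0_boundary : boundary (reflection B) u0)
    (X0_typical : typical_grain P0 X0)
    (X0_position :
      {ae P0, forall w, general_relative_position (X0 w) (reflection B)})
    (model1 : mixed_poisson_germ_grain P0 X0 L1 N1 X1)
    (model2 : mixed_poisson_germ_grain P0 X0 L2 N2 X2)
    (L12 : cum_order P1 P2 L1 L2) :
  hazard_order P1 P2 u0 B (germ_grain N1 X1) (germ_grain N2 X2).
Proof.
move=> t C t0 mC; have cB : compact B by case: B_structuring.
rewrite (empty_space_hazardE u0 cB X0_typical model1)//.
rewrite (empty_space_hazardE u0 cB X0_typical model2)//.
(* The factor common to both models is a limit of nonnegative quotients, or the default value 0. *)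
set ell := lim _; have ell0 : 0 <= ell.
  rewrite /ell; have [gc|ngc] := pselect (cvg (shell_volume u0 B X0_typical C t (t + h) / h
      @[h --> 0^'+])); last by rewrite (dvgP ngc).
  apply: limr_ge => //; near=> h.
  have h0 : 0 < h by near: h; exact: nbhs_right_gt.
  by rewrite divr_ge0 ?shell_volume_ge0// ltW.
rewrite ler_wpM2r//; apply: L12.
by rewrite oppr_le0 reached_volume_ge0.
Unshelve. all: by end_near. Qed.
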